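(* Let $A$ be a ring, $L$ an invertible $A$-module, $v\colon L\to A$ an injective $A$-linear map, $I=v(L)$, and $R=A/I$. Let $(E,E',\Phi)$ be a vector bundle on $\mathrm{Re}(A,v)^{\neq0}$, i.e. $E,E'$ are finite projective $A$-modules and $\Phi\colon E[1/I]\to E'[1/I]$ is an isomorphism of $A[1/I]$-modules. The following are equivalent. (i) $(E,E',\Phi)$ is in the essential image of the restriction functor $\mathrm{Vec}(\mathrm{Re}(A,v))\to\mathrm{Vec}(\mathrm{Re}(A,v)^{\neq0})$. (ii) The following conditions are satisfied, where $M_j:=I^j\Phi^{-1}(E')\cap E$ (intersection in $E[1/I]$) for $j\in\mathbb Z$: (a) $M_j$ is a finite projective $A$-module for all $j$; (b) $M_j=M_{j-1}$ for $j\ll0$ and $M_{j+1}=IM_j$ for $j\gg0$; (c) $M_j/(M_{j+1}+IM_{j-1})$ is a finite projective $R$-module for all $j\in\mathbb Z$. (iii) Zariski locally on $\operatorname{Spec}A$, $(E,E',\Phi)$ is isomorphic to a triple $(A^n,A^n,\Phi)$ where $\Phi$ is given by a diagonal matrix $\mathrm{diag}(z^{e_1},\dots,z^{e_n})$ for a generator $z$ of $I$ (which exists Zariski locally) and integers $e_1\ge\dots\ge e_n$.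
   Context: Let $B=\bigoplus_{j\in\mathbb Z}I^jt^{-j}\subseteq A[t,t^{-1}]$ with $I^j:=A$ for $j\le0$, graded by placing $I^jt^{-j}$ in degree $j$ (so $\deg t=-1$); if $I=(z)$ then $B\cong A[t,u]/(tu-z)$ with $\deg u=1$. $\mathrm{Re}(A,v)=[\mathbb G_{m,A}\backslash\operatorname{Spec}B]$ and $\mathrm{Re}(A,v)^{\neq0}$ is the open complement of the closed substack defined by the ideal generated by all homogeneous elements of nonzero degree. It is the scheme obtained by gluing two copies of $\operatorname{Spec}A$ (the locus where $t$ is invertible, giving $E$, and the locus where $B_1$ generates the unit ideal, giving $E'$) along $\operatorname{Spec}A[1/I]$, so that vector bundles on it are triples $(E,E',\Phi)$ as in the claim. Here $\operatorname{Spec}A[1/I]$ is the complement of $V(I)$ in $\operatorname{Spec}A$, $E[1/I]=E\otimes_AA[1/I]$, and for negative $j$, $I^j$ denotes the inverse fractional ideal inside $A[1/I]$. *)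

(* Defs.v *)
From HB Require Import structures.
From mathcomp Require Import all_boot all_order all_algebra finmap.
From mathcomp Require Import boolp classical_sets zify.

Set Implicit Arguments.
Unset Strict Implicit.
Unset Printing Implicit Defensive.

Import GRing.Theory.
Local Open Scope fset_scope.
Local Open Scope classical_set_scope.
Local Open Scope ring_scope.

(* Rings are commutative and possibly zero ([comPzRingType]): localizations *)
(* and quotients of a nonzero ring may vanish.  A phi-semilinear map is a    *)
(* [{linear U -> V | phi \; *:%R}].                                          *)

Section Laurent.
Variable C : comPzRingType.

(* C[t, t^-1]; following the grading with deg t = -1, [f j] is the           *)
(* coefficient of t^-j, i.e. of the monomial of degree j.                    *)
Definition laurent : Type := {fsfun int -> C with 0}.
HB.instance Definition _ := Choice.on laurent.
Definition coef (f : laurent) : int -> C := f.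

Definition lmk (S : {fset int}) (h : int -> C) : laurent :=
  [fsfun j in S => h j | 0].

Lemma lmkE S h j : (j \notin S -> h j = 0) -> coef (lmk S h) j = h j.
Proof. by rewrite /coef /lmk fsfun_fun; case: ifP => // _ ->. Qed.

Lemma coef_out (f : laurent) j : j \notin finsupp f -> coef f j = 0.
Proof. exact: fsfun_dflt. Qed.

Lemma laurentP (f g : laurent) : coef f =1 coef g -> f = g.
Proof. by move=> fg; apply/fsfunP. Qed.

Definition ladd (f g : laurent) :=
  lmk (finsupp f `|` finsupp g)%fset (fun j => coef f j + coef g j).
Definition lopp (f : laurent) := lmk (finsupp f) (fun j => - coef f j).
Definition lconst (c : C) := lmk [fset 0] (fun j => if j == 0 then c else 0).
Definition lmul (f g : laurent) :=
  lmk [fset (i + j)%R | i in finsupp f, j in finsupp g]%fset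
      (fun k => \sum_(i <- finsupp f) coef f i * coef g (k - i)).

Lemma laddE f g j : coef (ladd f g) j = coef f j + coef g j.
Proof.
by apply: lmkE; rewrite in_fsetU negb_or => /andP[/coef_out-> /coef_out->];
  rewrite addr0.
Qed.

Lemma loppE f j : coef (lopp f) j = - coef f j.
Proof. by apply: lmkE => /coef_out ->; rewrite oppr0. Qed.

Lemma lconstE c j : coef (lconst c) j = if j == 0 then c else 0.
Proof. by apply: lmkE; rewrite in_fset1 => /negbTE ->. Qed.

Lemma lmulE f g k :
  coef (lmul f g) k = \sum_(i <- finsupp f) coef f i * coef g (k - i).
Proof.
apply: lmkE => kN; rewrite big_seq big1 // => i fi.
rewrite [coef g _]coef_out ?mulr0 //; apply: contra kN => gi.
by apply/imfset2P; exists i => //; exists (k - i) => //; rewrite addrC subrK.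
Qed.

Lemma lmulwE (S : {fset int}) f g k : (finsupp f `<=` S)%fset ->
  coef (lmul f g) k = \sum_(i <- S) coef f i * coef g (k - i).
Proof.
by move=> fS; rewrite lmulE; apply: big_fset_incl => // i _ /coef_out ->;
  rewrite mul0r.
Qed.

Fact laddA : associative ladd.
Proof. by move=> f g h; apply: laurentP => j; rewrite !laddE addrA. Qed.
Fact laddC : commutative ladd.
Proof. by move=> f g; apply: laurentP => j; rewrite !laddE addrC. Qed.
Fact ladd0 : left_id (lconst 0) ladd.
Proof.
by move=> f; apply: laurentP => j; rewrite laddE lconstE if_same add0r.
Qed.
Fact laddN : left_inverse (lconst 0) lopp ladd.
Proof.
by move=> f; apply: laurentP => j; rewrite laddE loppE lconstE if_same addNr.
Qed.
HB.instance Definition _ :=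
  GRing.isZmodule.Build laurent laddA laddC ladd0 laddN.

Fact lmulC : commutative lmul.
Proof.
move=> f g; apply: laurentP => k.
pose T := [fset (k - j)%R | j in finsupp g]%fset.
rewrite lmulE (@lmulE g f).
transitivity (\sum_(i <- T) coef f i * coef g (k - i)).
  pose W := (finsupp f `|` T)%fset.
  rewrite (@big_fset_incl _ _ _ _ _ W) ?fsubsetUl //; last first.
    by move=> i _ /coef_out ->; rewrite mul0r.
  symmetry; apply: big_fset_incl; first exact: fsubsetUr.
  move=> i _ iT; rewrite [coef g _]coef_out ?mulr0 //.
  apply: contra iT => gi; apply/imfsetP; exists (k - i) => //.
  by rewrite subKr.
rewrite big_imfset /=; last first.
  by move=> i j _ _ /addrI /oppr_inj.
by apply: eq_bigr => j _; rewrite subKr mulrC.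
Qed.

Fact lmulA : associative lmul.
Proof.
move=> f g h; apply: laurentP => k.
rewrite lmulE (lmulE (lmul f g)).
pose S := finsupp (lmul f g).
pose T := [fset (i + j)%R | i in finsupp f, j in finsupp g]%fset.
have -> : \sum_(m <- S) coef (lmul f g) m * coef h (k - m) =
          \sum_(m <- T) coef (lmul f g) m * coef h (k - m).
  apply: big_fset_incl => [|m _ /coef_out ->]; last by rewrite mul0r.
  exact: finsupp_sub.
under [RHS]eq_bigr => m _ do rewrite lmulE mulr_suml.
rewrite exchange_big /=; apply: eq_big_seq => i fi.
rewrite lmulE mulr_sumr.
pose U := [fset (i + j)%R | j in finsupp g]%fset.
transitivity (\sum_(m <- U) coef f i * coef g (m - i) * coef h (k - m)).
  rewrite big_imfset /=; last by move=> a b _ _ /addrI.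
  by apply: eq_bigr => j _; rewrite [i + j]addrC addrK mulrA opprD addrAC addrA.
apply: big_fset_incl => [|m _ mU].
  apply/fsubsetP => _ /imfsetP[j gj ->]; apply/imfset2P.
  by exists i => //; exists j.
rewrite [coef g _]coef_out ?mulr0 ?mul0r //; apply: contra mU => gm.
by apply/imfsetP; exists (m - i) => //; rewrite addrC subrK.
Qed.

Fact lmul1 : left_id (lconst 1) lmul.
Proof.
move=> f; apply: laurentP => k; rewrite (@lmulwE [fset 0]%fset).
  by rewrite big_seq_fset1 lconstE eqxx mul1r subr0.
exact: finsupp_sub.
Qed.

Fact lmulDl : left_distributive lmul ladd.
Proof.
move=> f g h; apply: laurentP => k.
pose W := (finsupp (ladd f g) `|` (finsupp f `|` finsupp g))%fset.
have sub1 : (finsupp (ladd f g) `<=` W)%fset by exact: fsubsetUl.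
have sub2 : (finsupp f `<=` W)%fset.
  by rewrite fsubsetU // fsubsetUl orbT.
have sub3 : (finsupp g `<=` W)%fset.
  by rewrite fsubsetU // fsubsetUr orbT.
rewrite laddE (lmulwE _ _ sub1) (lmulwE _ _ sub2) (lmulwE _ _ sub3).
by rewrite -big_split /=; apply: eq_bigr => i _; rewrite laddE mulrDl.
Qed.

HB.instance Definition _ :=
  GRing.Zmodule_isComPzRing.Build laurent lmulA lmulC lmul1 lmulDl.

Lemma coefD (f g : laurent) j : coef (f + g) j = coef f j + coef g j.
Proof. exact: laddE. Qed.
Lemma coefN (f : laurent) j : coef (- f) j = - coef f j.
Proof. exact: loppE. Qed.
Lemma coef0 j : coef 0 j = 0.
Proof. by rewrite lconstE if_same. Qed.
Lemma coef1 j : coef 1 j = if j == 0 then 1 else 0.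
Proof. exact: lconstE. Qed.
Lemma coefM (f g : laurent) k :
  coef (f * g) k = \sum_(i <- finsupp f) coef f i * coef g (k - i).
Proof. exact: lmulE. Qed.

Fact lconst_zmod : zmod_morphism lconst.
Proof.
move=> a b; apply: laurentP => j; rewrite coefD coefN !lconstE.
by case: ifP; rewrite ?subr0.
Qed.
Fact lconst_monoid : monoid_morphism lconst.
Proof.
split=> // a b; apply: laurentP => j; rewrite coefM.
rewrite -[LHS]/(coef (lconst (a * b)) j).
have -> : \sum_(i <- finsupp (lconst a)) coef (lconst a) i * coef (lconst b) (j - i)
  = coef (lmul (lconst a) (lconst b)) j by rewrite lmulE.
rewrite (@lmulwE [fset 0]%fset); last exact: finsupp_sub.
by rewrite big_seq_fset1 !lconstE eqxx subr0; case: ifP; rewrite ?mulr0.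
Qed.
HB.instance Definition _ :=
  GRing.isZmodMorphism.Build C laurent lconst lconst_zmod.
HB.instance Definition _ :=
  GRing.isMonoidMorphism.Build C laurent lconst lconst_monoid.

End Laurent.

Section LaurentMap.
Variables (C D : comPzRingType) (phi : {rmorphism C -> D}).

Definition lmap (f : laurent C) : laurent D :=
  lmk (finsupp f) (fun j => phi (coef f j)).

Lemma lmapE f j : coef (lmap f) j = phi (coef f j).
Proof. by apply: lmkE => /coef_out ->; rewrite rmorph0. Qed.

Fact lmap_zmod : zmod_morphism lmap.
Proof.
move=> f g; apply: laurentP => j.
by rewrite coefD coefN !lmapE coefD coefN rmorphB.
Qed.
Fact lmap_monoid : monoid_morphism lmap.
Proof.
split=> [|f g]; apply: laurentP => j.
  by rewrite lmapE !coef1; case: ifP; rewrite ?rmorph1 ?rmorph0.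
rewrite lmapE coefM -[RHS]/(coef (lmul (lmap f) (lmap g)) j).
rewrite (@lmulwE _ (finsupp f)); last exact: finsupp_sub.
by rewrite rmorph_sum; apply: eq_bigr => i _; rewrite !lmapE rmorphM.
Qed.
HB.instance Definition _ :=
  GRing.isZmodMorphism.Build (laurent C) (laurent D) lmap lmap_zmod.
HB.instance Definition _ :=
  GRing.isMonoidMorphism.Build (laurent C) (laurent D) lmap lmap_monoid.
End LaurentMap.

Definition homog (C : comPzRingType) (i : int) : set (laurent C) :=
  [set f | forall j, j != i -> coef f j = 0].

Record filtration (C : comPzRingType) := Filtration {
  fil :> int -> set C;
  fil0 : forall j, fil j 0;
  filB : forall j a b, fil j a -> fil j b -> fil j (a - b);
  fil1 : fil 0 1;
  filM : forall i j a b, fil i a -> fil j b -> fil (i + j) (a * b) }.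

Section ReesRing.
Variables (C : comPzRingType) (F : filtration C).

Definition in_rees : {pred laurent C} :=
  fun f => `[< forall j, F j (coef f j) >].

Fact in_rees_subring : subring_closed in_rees.
Proof.
split.
- apply/asboolP => j; rewrite coef1; case: eqP => [->|_]; first exact: fil1.
  exact: fil0.
- move=> f g /asboolP Ff /asboolP Fg; apply/asboolP => j.
  by rewrite coefD coefN; apply: filB.
- move=> f g /asboolP Ff /asboolP Fg; apply/asboolP => j; rewrite coefM.
  elim/big_rec: _ => [|i x _ Fx]; first exact: fil0.
  rewrite -[x]opprK; apply: filB.
    by rewrite -[X in F X](subrKC i); apply: filM.
  by rewrite -sub0r; apply: filB => //; exact: fil0.
Qed.
(* The graded ring of the f in C[t, t^-1] whose coefficient in each degree *)
(* j lies in F j.                                                          *)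
Record rees := Rees { rees_val : laurent C; _ : rees_val \in in_rees }.
HB.instance Definition _ := [isSub for rees_val].
HB.instance Definition _ := [Choice of rees by <:].
HB.instance Definition _ :=
  GRing.SubChoice_isSubComPzRing.Build (laurent C) in_rees rees in_rees_subring.
Fact rees_val_zmod : zmod_morphism rees_val. Proof. by []. Qed.
Fact rees_val_monoid : monoid_morphism rees_val. Proof. by []. Qed.
HB.instance Definition _ :=
  GRing.isZmodMorphism.Build rees (laurent C) rees_val rees_val_zmod.
HB.instance Definition _ :=
  GRing.isMonoidMorphism.Build rees (laurent C) rees_val rees_val_monoid.

Definition rees_homog (i : int) : set rees := [set f | homog i (rees_val f)].

Section Lift.
Variables (D : comPzRingType) (h : {rmorphism D -> laurent C}).
Hypothesis hF : forall d j, F j (coef (h d) j).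

Definition rees_lift (d : D) : rees := Rees (introT (asboolP _) (hF d)).

Fact rees_lift_zmod : zmod_morphism rees_lift.
Proof. by move=> a b; apply: val_inj; rewrite /= rmorphB. Qed.
Fact rees_lift_monoid : monoid_morphism rees_lift.
Proof.
by split=> [|a b]; apply: val_inj; rewrite /= ?rmorph1 ?rmorphM.
Qed.
HB.instance Definition _ :=
  GRing.isZmodMorphism.Build D rees rees_lift rees_lift_zmod.
HB.instance Definition _ :=
  GRing.isMonoidMorphism.Build D rees rees_lift rees_lift_monoid.
End Lift.
End ReesRing.

Section Span.
Variables (C : comPzRingType) (V : lmodType C).

(* The additive span of the products c *: s; this is JS when J is an ideal,  *)
(* a fractional ideal or generating set of one, and S a submodule.           *)
Inductive mulspan (J : set C) (S : set V) : V -> Prop :=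
| mulspan0 : mulspan J S 0
| mulspanD x y : mulspan J S x -> mulspan J S y -> mulspan J S (x + y)
| mulspanZ c s : J c -> S s -> mulspan J S (c *: s).

Lemma mulspanZl (J : set C) (S : set V) (a : C) x :
  (forall s, S s -> S (a *: s)) -> mulspan J S x -> mulspan J S (a *: x).
Proof.
move=> Sa; elim=> [|y z _ IHy _ IHz|c s Jc Ss]; first by rewrite scaler0; exact: mulspan0.
  by rewrite scalerDr; apply: mulspanD.
by rewrite scalerA mulrC -scalerA; apply: mulspanZ => //; apply: Sa.
Qed.
End Span.

Section IdealPowers.
Variable A : comPzRingType.
Implicit Type I : set A.

Definition ideal_gen I : set A := @mulspan A A^o I setT.

Fixpoint ideal_pow I (n : nat) : set A :=
  if n is m.+1 then @mulspan A A^o I (ideal_pow I m) else setT.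

Lemma ideal_pow0 I n : ideal_pow I n 0.
Proof. by case: n => [//|n]; exact: mulspan0. Qed.

Lemma ideal_powD I n a b :
  ideal_pow I n a -> ideal_pow I n b -> ideal_pow I n (a + b).
Proof. by case: n => [//|n]; exact: mulspanD. Qed.

Lemma ideal_powMl I n c a : ideal_pow I n a -> ideal_pow I n (c * a).
Proof.
elim: n a => [//|n IHn] a /=; apply: (@mulspanZl A A^o) => s; exact: IHn.
Qed.

Lemma ideal_powB I n a b :
  ideal_pow I n a -> ideal_pow I n b -> ideal_pow I n (a - b).
Proof.
by move=> Ia Ib; apply: ideal_powD => //; rewrite -mulN1r; apply: ideal_powMl.
Qed.

Lemma ideal_powM I m n a b :
  ideal_pow I m a -> ideal_pow I n b -> ideal_pow I (m + n) (a * b).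
Proof.
elim: m a => [|m IHm] a /=; first by move=> _; apply: ideal_powMl.
move=> Ia Ib; elim: Ia => [|x y _ IHx _ IHy|c s Ic Is].
- by rewrite mul0r; exact: (@mulspan0 A A^o).
- by rewrite mulrDl; apply: (@mulspanD A A^o).
- by rewrite -mulrA; apply: (@mulspanZ A A^o) => //; apply: IHm.
Qed.

Lemma ideal_pow_le I m n a : (m <= n)%N -> ideal_pow I n a -> ideal_pow I m a.
Proof.
move=> /subnK <-; elim: (n - m)%N a => [//|k IHk] a /=.
elim=> [|x y _ IHx _ IHy|c s _ Is]; first exact: ideal_pow0.
  exact: ideal_powD.
by apply: ideal_powMl; apply: IHk.
Qed.

(* I^j with the convention I^j = A for j <= 0. *)
Definition tpow I (j : int) : set A := ideal_pow I (if j is Posz n then n else 0).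

Fact tpowM I i j a b : tpow I i a -> tpow I j b -> tpow I (i + j) (a * b).
Proof.
move=> Ia Ib; have := ideal_powM Ia Ib; apply: ideal_pow_le.
by case: i j {Ia Ib} => [m|m] [n|n] //=; case E: (_ + _)%R => [k|k]; lia.
Qed.

Definition tpow_fil I : filtration A :=
  @Filtration A (tpow I) (fun j => ideal_pow0 I _)
    (fun j => @ideal_powB I _) Logic.I (@tpowM I).

End IdealPowers.

Section FractionalPowers.
Variables (A A1 : comPzRingType) (iota : {rmorphism A -> A1}) (I : set A).

(* I^j inside A1 = A[1/I]: for j = -n < 0 this is the inverse fractional *)
(* ideal (A : I^n).                                                      *)
Definition fpow (j : int) : set A1 :=
  match j with
  | Posz n => [set x | exists2 a, ideal_pow I n a & x = iota a]
  | Negz n => [set x | forall a, ideal_pow I n.+1 a -> exists b, iota a * x = iota b]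
  end.

Fact fpow0 j : fpow j 0.
Proof.
case: j => n /=; first by exists 0; rewrite ?rmorph0 //; exact: ideal_pow0.
by move=> a _; exists 0; rewrite mulr0 rmorph0.
Qed.

Fact fpowB j x y : fpow j x -> fpow j y -> fpow j (x - y).
Proof.
case: j => n /= => [[a Ia ->] [b Ib ->]|Ix Iy a Ia].
  by exists (a - b); rewrite ?rmorphB //; exact: ideal_powB.
have [[b xb] [c yc]] := (Ix a Ia, Iy a Ia).
by exists (b - c); rewrite mulrBr xb yc rmorphB.
Qed.

Fact fpow1 : fpow 0 1.
Proof. by exists 1; rewrite ?rmorph1. Qed.

Lemma fpow_absorb p y :
  (forall a, ideal_pow I p a -> exists b, iota a * y = iota b) ->
  forall k a, ideal_pow I (k + p) a ->
    exists2 b, ideal_pow I k b & iota a * y = iota b.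
Proof.
move=> Iy; elim=> [|k IHk] a /=; first by move=> /Iy[b yb]; exists b.
elim=> [|c d _ [c1 Ic cE] _ [d1 Id dE]|c d Ic /IHk[b Ib bE]].
- by exists 0; rewrite ?rmorph0 ?mul0r //; exact: mulspan0.
- by exists (c1 + d1); [exact: mulspanD | rewrite !rmorphD mulrDl cE dE].
- by exists (c * b); [exact: mulspanZ | rewrite !rmorphM -mulrA bE].
Qed.

Fact fpowM i j x y : fpow i x -> fpow j y -> fpow (i + j) (x * y).
Proof.
wlog: i j x y / (j <= i)%R => [hw|].
  by case/orP: (Order.TotalTheory.le_total j i) => ij Ix Iy; [|rewrite addrC mulrC];
    apply: hw.
case: i j => [m|m] [n|n] ij /=.
- by case=> a Ia -> [b Ib ->]; exists (a * b); rewrite ?rmorphM //;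
    exact: ideal_powM.
- move=> [a Ia ->] Iy; case E: (_ + _)%R => [k|k] /=.
    have km : m = (k + n.+1)%N by lia.
    by rewrite km in Ia; apply: fpow_absorb Ia.
  move=> b Ib; rewrite mulrA -rmorphM; apply: Iy.
  have nk : (k.+1 + m)%N = n.+1 by lia.
  by have := @ideal_powM A I k.+1 m b a Ib Ia; rewrite nk.
- by lia.
- move=> Ix Iy a Ia.
  have /(@fpow_absorb n.+1 y Iy)[b /Ix[c bc] ab] : ideal_pow I (m.+1 + n.+1) a.
    by have -> : (m.+1 + n.+1 = (m + n).+2)%N by lia.
  by exists c; rewrite mulrCA ab mulrC.
Qed.

Definition fpow_fil : filtration A1 :=
  Filtration fpow0 fpowB fpow1 fpowM.

End FractionalPowers.

(* Spec A1 -> Spec A represents the complement of V(J) in Spec A. *)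
Definition is_complement (A A1 : comPzRingType) (J : set A)
    (phi : {rmorphism A -> A1}) : Prop :=
  ideal_gen [set phi a | a in J] 1 /\
  forall (C : comPzRingType) (g : {rmorphism A -> C}),
    ideal_gen [set g a | a in J] 1 ->
    (exists h : {rmorphism A1 -> C}, forall a, h (phi a) = g a) /\
    (forall h1 h2 : {rmorphism A1 -> C},
       (forall a, h1 (phi a) = h2 (phi a)) -> h1 =1 h2).

(* rho exhibits P as the tensor product of N with D over C. *)
Definition base_change (C D : comPzRingType) (phi : {rmorphism C -> D})
    (N : lmodType C) (P : lmodType D) (rho : {linear N -> P | phi \; *:%R}) :
    Prop :=
  forall (Q : lmodType D) (h : {linear N -> Q | phi \; *:%R}),
    (exists k : {linear P -> Q}, forall x, k (rho x) = h x) /\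
    (forall k1 k2 : {linear P -> Q},
       (forall x, k1 (rho x) = k2 (rho x)) -> k1 =1 k2).

Definition finite_projective (C : comPzRingType) (M : lmodType C) : Prop :=
  exists n (i : {linear M -> 'cV[C]_n}) (p : {linear 'cV[C]_n -> M}),
    cancel i p.

(* P holds on the members D(f k) = Spec Af of a finite open cover of Spec A. *)
Definition zariski_locally (A : comPzRingType)
    (P : forall Af : comPzRingType, {rmorphism A -> Af} -> Prop) : Prop :=
  exists m (f : 'I_m -> A), ideal_gen (range f) 1 /\
    forall k, exists (Af : comPzRingType) (phi : {rmorphism A -> Af}),
      is_complement [set f k] phi /\ P Af phi.

Definition invertible_module (A : comPzRingType) (L : lmodType A) : Prop :=
  zariski_locally (fun (Af : comPzRingType) (phi : {rmorphism A -> Af}) =>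
    exists g : {linear L -> Af^o | phi \; *:%R}, base_change g).

(* Vector bundles on Re(A,v)^{<>0}: gE, gE' are E, E', and gE1, gE1' are  *)
(* E[1/I], E'[1/I], where iota : A -> A1 = A[1/I].                         *)
Record gluing (A A1 : comPzRingType) (iota : {rmorphism A -> A1}) := Gluing {
  gE : lmodType A;
  gE' : lmodType A;
  gE_fp : finite_projective gE;
  gE'_fp : finite_projective gE';
  gE1 : lmodType A1;
  gE1' : lmodType A1;
  gloc : {linear gE -> gE1 | iota \; *:%R};
  gloc' : {linear gE' -> gE1' | iota \; *:%R};
  gloc_bc : base_change gloc;
  gloc'_bc : base_change gloc';
  gPhi : {linear gE1 -> gE1'};
  gPhi_bij : bijective gPhi }.

(* A[1/I]-modules are regarded as A-modules along iota. *)
Record submodule (A A1 : comPzRingType) (iota : {rmorphism A -> A1})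
    (V : lmodType A1) := Submodule {
  smem : set V;
  smem0 : smem 0;
  smemD : forall x y, smem x -> smem y -> smem (x + y);
  smemZ : forall a x, smem x -> smem (iota a *: x) }.

Section SubmoduleType.
Variables (A A1 : comPzRingType) (iota : {rmorphism A -> A1}).
Variables (V : lmodType A1) (S : submodule iota V).

Definition in_subm : {pred V} := fun x => `[< smem S x >].

Fact in_subm_zmod : zmod_closed in_subm.
Proof.
split; first by apply/asboolP; exact: smem0.
move=> x y /asboolP Sx /asboolP Sy; apply/asboolP; apply: smemD => //.
by rewrite -scaleN1r -(rmorph1 iota) -rmorphN; apply: smemZ.
Qed.

Record subm := Subm { subm_val : V; subm_valP : subm_val \in in_subm }.
HB.instance Definition _ := [isSub for subm_val].
HB.instance Definition _ := [Choice of subm by <:].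
HB.instance Definition _ :=
  GRing.SubChoice_isSubZmodule.Build V in_subm subm in_subm_zmod.

Fact subm_scale_subproof a (x : subm) : iota a *: subm_val x \in in_subm.
Proof. by apply/asboolP; apply: smemZ; apply/asboolP; exact: subm_valP. Qed.
Definition subm_scale a x := Subm (subm_scale_subproof a x).

Fact subm_scaleA a b x : subm_scale a (subm_scale b x) = subm_scale (a * b) x.
Proof. by apply: val_inj; rewrite /= scalerA rmorphM. Qed.
Fact subm_scale1 : left_id 1 subm_scale.
Proof. by move=> x; apply: val_inj; rewrite /= rmorph1 scale1r. Qed.
Fact subm_scaleDr : right_distributive subm_scale +%R.
Proof. by move=> a x y; apply: val_inj; rewrite /= scalerDr. Qed.
Fact subm_scaleDl x : {morph subm_scale^~ x : a b / a + b}.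
Proof. by move=> a b; apply: val_inj; rewrite /= rmorphD scalerDl. Qed.
HB.instance Definition _ := GRing.Zmodule_isLmodule.Build A subm
  subm_scaleA subm_scale1 subm_scaleDr subm_scaleDl.
End SubmoduleType.

Section Lattices.
Variables (A A1 : comPzRingType) (iota : {rmorphism A -> A1}) (I : set A).
Variable T : gluing iota.

Definition lattice_set (j : int) : set (gE1 T) :=
  mulspan (fpow iota I j) [set x | exists e', gPhi T x = gloc' T e'] `&`
  range (gloc T).

Fact lattice0 j : lattice_set j 0.
Proof. by split; [exact: mulspan0 | exists 0; rewrite ?raddf0]. Qed.

Fact latticeD j x y :
  lattice_set j x -> lattice_set j y -> lattice_set j (x + y).
Proof.
case=> Mx [e _ ex] [My [f _ fy]]; split; first exact: mulspanD.
by exists (e + f); rewrite // linearD ex fy.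
Qed.

Fact latticeZ j a x : lattice_set j x -> lattice_set j (iota a *: x).
Proof.
case=> Mx [e _ ex]; split; last by exists (a *: e); rewrite // linearZ ex.
apply: mulspanZl Mx => s [e' se]; exists (a *: e').
by rewrite linearZ se [RHS]linearZ.
Qed.

(* M_j = I^j Phi^-1(E') :&: E *)
Definition lattice (j : int) : submodule iota (gE1 T) :=
  Submodule (lattice0 j) (@latticeD j) (@latticeZ j).

(* M_{j+1} + I M_{j-1} *)
Definition lattice_denom (j : int) : set (gE1 T) :=
  [set x | exists y z, [/\ smem (lattice (j + 1)) y,
     mulspan [set iota a | a in I] (smem (lattice (j - 1))) z & x = y + z]].

End Lattices.
Arguments lattice_denom {A A1 iota} I T j.

(* M/K, as a module over R = pi(A), is finite projective. *)
Definition finite_projective_quotient (A R : comPzRingType)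
    (pi : {rmorphism A -> R}) (M : lmodType A) (K : set M) : Prop :=
  exists (Q : lmodType R) (q : {linear M -> Q | pi \; *:%R}),
    [/\ forall y, exists x, q x = y, forall x, q x = 0 <-> K x
      & finite_projective Q].

Record grading (C : comPzRingType) (F : filtration C) (N : lmodType (rees F)) :=
  Grading {
    gr :> int -> set N;
    gr0 : forall j, gr j 0;
    grB : forall j x y, gr j x -> gr j y -> gr j (x - y);
    gr_act : forall i j b x,
      @rees_homog C F i b -> gr j x -> gr (i + j) (b *: x);
    gr_sum : forall x, exists (s : {fset int}) (c : int -> N),
      (forall j, gr j (c j)) /\ x = \sum_(j <- s) c j;
    gr_direct : forall (s : {fset int}) (c : int -> N),
      (forall j, gr j (c j)) -> \sum_(j <- s) c j = 0 ->
      forall j, j \in s -> c j = 0 }.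

(* The degree 0 part of the base change P of a graded module N to a graded *)
(* ring D, homD being the homogeneous parts of D.                          *)
Inductive deg0 (D : comPzRingType) (homD : int -> set D) (N : Type)
    (grN : int -> set N) (P : lmodType D) (rho : N -> P) : P -> Prop :=
| deg0_0 : deg0 homD grN rho 0
| deg0_D x y : deg0 homD grN rho x -> deg0 homD grN rho y ->
    deg0 homD grN rho (x + y)
| deg0_M j c x : homD (- j) c -> grN j x -> deg0 homD grN rho (c *: rho x).

Section Restriction.
Variables (A A1 : comPzRingType) (iota : {rmorphism A -> A1}) (I : set A).

(* B, and the coordinate ring B' = \bigoplus_j I^j t^-j (with the fractional *)
(* ideals I^j, j < 0) of the locus of Spec B where B_1 generates the unit    *)
(* ideal.  The locus where t is invertible is Spec A[t, t^-1], and these two *)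
(* loci meet in Spec A[1/I][t, t^-1].                                        *)
Local Notation ringB := (rees (tpow_fil I)).
Local Notation ringB' := (rees (fpow_fil iota I)).

Definition toAt : {rmorphism ringB -> laurent A} := @rees_val A (tpow_fil I).
Definition toA1t : {rmorphism ringB -> laurent A1} := lmap iota \o toAt.

Fact toB'_subproof b j : fpow iota I j (coef (toA1t b) j).
Proof.
rewrite lmapE; case: b => f /= /asboolP /(_ j); case: j => n /=; last first.
  by move=> _ a _; exists (a * coef f (Negz n)); rewrite rmorphM.
by exists (coef f n).
Qed.
Definition toB' : {rmorphism ringB -> ringB'} :=
  @rees_lift A1 (fpow_fil iota I) ringB toA1t toB'_subproof.

Definition B'toA1t : {rmorphism ringB' -> laurent A1} :=
  @rees_val A1 (fpow_fil iota I).

Fact AtoB'_subproof a j : fpow iota I j (coef ((@lconst A1 \o iota) a) j).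
Proof.
rewrite /= lconstE; case: eqP => [->|_]; last exact: (fil0 (fpow_fil iota I)).
by exists a.
Qed.
Definition AtoB' : {rmorphism A -> ringB'} :=
  @rees_lift A1 (fpow_fil iota I) A (@lconst A1 \o iota) AtoB'_subproof.

(* The restriction of the graded B-module N to Re(A,v)^{<>0} is isomorphic *)
(* to T: r1, r2, r12 are the restrictions of N to the two loci above and   *)
(* their intersection; a1, a2 identify E, E' with the degree 0 parts, i.e. *)
(* descend along the quotient by G_m, and on the intersection both         *)
(* identifications correspond under Phi.                                   *)
Definition restricts_to (N : lmodType ringB) (grN : grading N)
    (T : gluing iota) : Prop :=
  exists (P1 : lmodType (laurent A)) (P2 : lmodType ringB')
    (P12 : lmodType (laurent A1))
    (r1 : {linear N -> P1 | toAt \; *:%R})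
    (r2 : {linear N -> P2 | toB' \; *:%R})
    (r12 : {linear N -> P12 | toA1t \; *:%R})
    (s1 : {linear P1 -> P12 | lmap iota \; *:%R})
    (s2 : {linear P2 -> P12 | B'toA1t \; *:%R})
    (a1 : {linear gE T -> P1 | @lconst A \; *:%R})
    (a2 : {linear gE' T -> P2 | AtoB' \; *:%R})
    (b1 : {linear gE1 T -> P12 | @lconst A1 \; *:%R})
    (b2 : {linear gE1' T -> P12 | @lconst A1 \; *:%R}),
  [/\ [/\ base_change r1, base_change r2 & base_change r12],
      (forall x, s1 (r1 x) = r12 x) /\ (forall x, s2 (r2 x) = r12 x),
      injective a1 /\ range a1 = deg0 (@homog A) grN r1,
      injective a2 /\ range a2 = deg0 (@rees_homog A1 _) grN r2
    & [/\ forall e, b1 (gloc T e) = s1 (a1 e),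
          forall e, b2 (gloc' T e) = s2 (a2 e)
        & forall x, b2 (gPhi T x) = b1 x]].

(* Vec(Re(A,v)) = Vec([G_m \ Spec B]) consists of the graded B-modules that *)
(* are finite projective over B.                                            *)
Definition in_essential_image (T : gluing iota) : Prop :=
  exists (N : lmodType ringB) (grN : grading N),
    finite_projective N /\ restricts_to grN T.

End Restriction.

(* z ^ e for a unit z with inverse w *)
Definition zpow (C : comPzRingType) (z w : C) (e : int) : C :=
  match e with Posz n => z ^+ n | Negz n => w ^+ n.+1 end.

(* Over Spec Af, with Af1 = Af[1/I], the base change of T is isomorphic to *)
(* (Af^n, Af^n, diag(z^e_1, ..., z^e_n)).                                   *)
Definition diagonal_over (A A1 : comPzRingType) (iota : {rmorphism A -> A1})
    (I : set A) (T : gluing iota) (Af : comPzRingType)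
    (phi : {rmorphism A -> Af}) : Prop :=
  exists (Af1 : comPzRingType) (psi : {rmorphism Af -> Af1})
    (phi1 : {rmorphism A1 -> Af1}) (z : Af) (w : Af1) (n : nat) (e : 'I_n -> int)
    (a : {linear gE T -> 'cV[Af]_n | phi \; *:%R})
    (a' : {linear gE' T -> 'cV[Af]_n | phi \; *:%R})
    (b : {linear gE1 T -> 'cV[Af1]_n | phi1 \; *:%R})
    (b' : {linear gE1' T -> 'cV[Af1]_n | phi1 \; *:%R}),
  [/\ is_complement [set phi x | x in I] psi /\
        (forall x, phi1 (iota x) = psi (phi x)),
      ideal_gen [set phi x | x in I] = ideal_gen [set z] /\ psi z * w = 1,
      forall i k : 'I_n, (i <= k)%N -> e k <= e i,
      base_change a /\ base_change a'
    & [/\ forall x, b (gloc T x) = map_mx psi (a x),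
          forall x, b' (gloc' T x) = map_mx psi (a' x)
        & forall x, b' (gPhi T x) =
            diag_mx (\row_i zpow (psi z) w (e i)) *m b x]].

(* Main.v *)
(* Write V = E[1/I], S = E and S' = Phi^-1(E') inside V.  All three conditions *)
(* are equivalent to the existence of a graded dual basis: finitely many x k   *)
(* in M_(e k) and A1-linear functionals xi k on V with xi k (S) in A and       *)
(* xi k (S') in I^(- e k) such that y = \sum_k xi k y *: x k.                  *)
(* The functionals restrict to graded B-linear maps from the sum of the M_j to *)
(* shifts of B, so that the idempotent matrix xi i (x k), placed in degree     *)
(* e k - e i, cuts a graded projective B-module out of a free one; its         *)
(* restriction is (E, E', Phi), and every graded projective B-module arises so. *)
(* The s in A for which such a family represents s times the identity of V     *)
(* form an ideal, so the existence of a dual basis is a local question.  At a  *)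
(* prime containing I one lifts bases of the M_j / (M_(j+1) + I M_(j-1));      *)
(* Nakayama shows that the lifts generate, and since z y in M_j forces y in    *)
(* M_(j-1), a relation between them has coefficients in I, so they form a      *)
(* basis in which Phi is diagonal.                                             *)

Require Import Defs.
From HB Require Import structures.
From mathcomp Require Import all_boot all_order all_algebra finmap.
From mathcomp Require Import boolp classical_sets ring zify.

Set Implicit Arguments.
Unset Strict Implicit.
Unset Printing Implicit Defensive.

Import GRing.Theory.
Local Open Scope classical_set_scope.
Local Open Scope ring_scope.

(** * Semilinear maps, ideals and primes *)

(** Inside V = E[1/I] lie two lattices, S = E and S' = Phi^-1(E'), and M_j = I^j S' :&: S. Every
    condition is compared with [gdb]: vectors x_k in M_(e_k) and functionals xi_k on V, with values
    in A on S and in I^(- e_k) on S', such that s y is the sum of the xi_k(y) x_k. For s = 1 this is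
    a homogeneous dual basis of the graded B-module formed by the M_j.

    (i) is equivalent to [gdb] at 1. The matrix xi_i(x_k), placed in degree e_k - e_i, is idempotent
    over B. Its image is a graded finite projective module whose degree 0 parts over A[t, t^-1] and
    B' are S and S' ([locus_restriction], [gdb_essential_image]). Conversely, a graded finite
    projective module has a homogeneous dual basis ([graded_dual_basis]), and shifting it to degree
    0 over A[t, t^-1] gives the family ([essential_image_gdb]).

    [gdb] at 1 implies (ii). In degree j the dual basis makes M_j finite projective ([lattice_fp]).
    Modulo M_(j+1) + I M_(j-1) only the x_k with e_k = j survive, with coefficients modulo I
    ([lattice_fp_quotient]). Stability for small and large j holds because S and S' have bounded
    denominators relative to each other ([lat_low], [lat_high_step]).

    (iii) implies [gdb] at 1. Over D(f) the standard basis and its coordinates form a graded dual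
    basis; clearing denominators gives [gdb] at a power of f ([diagonal_gdb]), and the admissible s
    form an ideal ([gdb_ideal]).

    (ii) implies, at each prime m, that some f outside m is [adapted]: over D(f) a basis of E
    becomes, after rescaling by powers of a generator of I, a basis of S'. If m does not contain I,
    the two lattices agree near m ([adapted_away]). If it does, bases of the M_j/(M_(j+1) + I
    M_(j-1)) are lifted. By Nakayama the lifts generate E ([span_bottom]), and then also M_j = I^j
    S' for large j ([span_top]). Since z y in M_j forces y in M_(j-1) for y in E, relations between
    the lifts have coefficients in m ([relation_in_m]), so the lifts form a basis
    ([combine_adapted]). Such f generate the unit ideal; this yields [gdb] at 1 and, by
    [adapted_diagonal], condition (iii). *)

Section MkLin.
Variables (C D : comPzRingType) (phi : {rmorphism C -> D}).
Variables (U : lmodType C) (V : lmodType D) (f : U -> V).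
Hypotheses (fD : forall x y, f (x + y) = f x + f y)
  (fZ : forall a x, f (a *: x) = phi a *: f x).

Fact mksemilin_subproof : GRing.linear_for (phi \; *:%R) f.
Proof. by move=> a x y; rewrite fD fZ. Qed.

Definition mksemilin : {linear U -> V | phi \; *:%R} :=
  HB.pack f (GRing.isLinear.Build C U V (phi \; *:%R) f mksemilin_subproof).
End MkLin.
Arguments mksemilin {C D phi U V} f fD fZ.

Section MkLin1.
Variables (C : comPzRingType) (U V : lmodType C) (f : U -> V).
Hypotheses (fD : forall x y, f (x + y) = f x + f y)
  (fZ : forall a x, f (a *: x) = a *: f x).

Fact mklin_subproof : GRing.linear_for *:%R f.
Proof. by move=> a x y; rewrite fD fZ. Qed.

Definition mklin : {linear U -> V} :=
  HB.pack f (GRing.isLinear.Build C U V *:%R f mklin_subproof).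
End MkLin1.
Arguments mklin {C U V} f fD fZ.

Definition is_ideal (C : comPzRingType) (J : set C) :=
  [/\ J 0, forall x y, J x -> J y -> J (x + y) & forall a x, J x -> J (a * x)].

Definition is_prime (C : comPzRingType) (m : set C) :=
  [/\ is_ideal m, ~ m 1 & forall a b, m (a * b) -> m a \/ m b].

Section Ideals.
Variable C : comPzRingType.
Implicit Types (J S m : set C).

Lemma ideal_sum J (K : Type) (r : seq K) (P : pred K) (x : K -> C) :
  is_ideal J -> (forall k, P k -> J (x k)) -> J (\sum_(k <- r | P k) x k).
Proof. by case=> J0 JD _ Jx; elim/big_rec: _ => // k y Pk Jy; apply: JD => //; apply: Jx. Qed.

Lemma ideal_mulr J a x : is_ideal J -> J a -> J (a * x).
Proof. by case=> _ _ JM Ja; rewrite mulrC; apply: JM. Qed.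

Lemma ideal_opp J x : is_ideal J -> J x -> J (- x).
Proof. by case=> _ _ JM Ja; rewrite -mulN1r; apply: JM. Qed.

Lemma ideal_gen_ideal S : is_ideal (ideal_gen S).
Proof.
split; first exact: (@mulspan0 C C^o); first exact: (@mulspanD C C^o).
by move=> a x; apply: (@mulspanZl C C^o).
Qed.

Lemma ideal_genM S a x : ideal_gen S x -> ideal_gen S (a * x).
Proof. by have [_ _] := ideal_gen_ideal S; apply. Qed.

Lemma ideal_gen_sub S x : S x -> ideal_gen S x.
Proof. by move=> Sx; rewrite -[x]mulr1; apply: (@mulspanZ C C^o). Qed.

Lemma ideal_gen_min S J : is_ideal J -> S `<=` J -> ideal_gen S `<=` J.
Proof.
move=> iJ; have [J0 JD _] := iJ => SJ x; elim=> [//|y z _ Jy _ Jz|c s Sc _]; first exact: JD.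
exact: (ideal_mulr s iJ (SJ _ Sc)).
Qed.

Lemma ideal_gen_exists S x : ideal_gen S x ->
  exists n (c s : 'I_n -> C), (forall k, S (s k)) /\ x = \sum_k c k * s k.
Proof.
elim=> [|y z _ [n [c [s [Sc ->]]]] _ [n' [c' [s' [Sc' ->]]]]|a c Sa _].
- by exists 0, (fun _ => 0), (fun _ => 0); split; [case | rewrite big_ord0].
- pose d (f : 'I_n -> C) (g : 'I_n' -> C) k := match split k with inl i => f i | inr i => g i end.
  exists (n + n')%N, (d c c'), (d s s'); split.
    by move=> k; rewrite /d; case: split.
  rewrite big_split_ord /=; congr (_ + _); apply: eq_bigr => i _; rewrite /d.
    by rewrite (unsplitK (inl _ i)).
  by rewrite (unsplitK (inr _ i)).
- by exists 1, (fun _ => c), (fun _ => a); rewrite big_ord1 mulrC.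
Qed.

Lemma ideal_gen_sum n (c s : 'I_n -> C) :
  ideal_gen (range s) (\sum_k c k * s k).
Proof.
apply: ideal_sum => [|k _]; first exact: ideal_gen_ideal.
by have [_ _] := ideal_gen_ideal (range s); apply; apply: ideal_gen_sub; exists k.
Qed.

(* The radical of an ideal is an ideal. *)
Lemma ideal_gen_pow S J : is_ideal J -> (forall f, S f -> exists n, J (f ^+ n)) ->
  forall x, ideal_gen S x -> exists n, J (x ^+ n).
Proof.
move=> iJ SJ; have [J0 JD JM] := iJ; apply: ideal_gen_min => //; split.
- by exists 1.
- move=> x y [n Jx] [p Jy]; exists (n + p)%N; rewrite exprDn.
  apply: ideal_sum => // i _; rewrite -mulr_natl; apply: (JM).
  case: (leqP p i) => ip.
    by apply: (JM); rewrite -(subnK ip) exprD; apply: (JM).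
  by apply: ideal_mulr => //; rewrite -(@subnK n (n + p - i)) ?exprD; [apply: JM | lia].
- by move=> a x [n Jx]; exists n; rewrite exprMn; apply: JM.
Qed.

Lemma ideal_gen_pow1 S J : is_ideal J -> (forall f, S f -> exists n, J (f ^+ n)) ->
  ideal_gen S 1 -> J 1.
Proof. by move=> iJ SJ /(ideal_gen_pow iJ SJ)[n]; rewrite expr1n. Qed.

Lemma prime_pow m x n : is_prime m -> m (x ^+ n) -> m x.
Proof.
case=> [_ m1 mM]; elim: n => [|n IHn]; rewrite ?expr0 ?exprS // => /mM[] //.
Qed.

Lemma prime_notM m x y : is_prime m -> ~ m x -> ~ m y -> ~ m (x * y).
Proof. by case=> [_ _ mM] Nx Ny /mM[]. Qed.

Lemma prime_notX m x n : is_prime m -> ~ m x -> ~ m (x ^+ n).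
Proof. by move=> pm Nx /(prime_pow pm). Qed.

Lemma prime_notprod m (K : finType) (P : pred K) (x : K -> C) :
  is_prime m -> (forall k, P k -> ~ m (x k)) -> ~ m (\prod_(k | P k) x k).
Proof.
move=> pm Nx; elim/big_rec: _ => [|k y Pk Ny]; first by case: pm.
by apply: prime_notM => //; apply: Nx.
Qed.

Lemma exists_prime J : is_ideal J -> ~ J 1 -> exists m, is_prime m /\ J `<=` m.
Proof.
move=> iJ NJ; have [J0 JD JM] := iJ.
pose P (m : set C) := m = set0 \/ [/\ is_ideal m, ~ m 1 & J `<=` m].
have [F FP Ftot|m [Pm maxm]] := @Zorn_bigcup C P.
  have [[X FX [x Xx]]|FN] := pselect (exists2 X, F X & X !=set0); last first.
    left; apply/seteqP; split=> // x [X FX Xx]; apply: FN.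
    by exists X => //; exists x.
  right; have nz Y y : F Y -> Y y -> [/\ is_ideal Y, ~ Y 1 & J `<=` Y].
    by move=> /FP [-> //|].
  have [iX NX JX] := nz _ _ FX Xx.
  split; last by move=> y Jy; exists X => //; apply: JX.
    split; first by exists X => //; apply: JX.
      move=> a b [Y FY Ya] [Z FZ Zb]; case: (Ftot _ _ FY FZ) => sub.
        by exists Z => //; have [[_ ZD _] _ _] := nz _ _ FZ Zb; apply: ZD => //; apply: sub.
      by exists Y => //; have [[_ ZD _] _ _] := nz _ _ FY Ya; apply: ZD => //; apply: sub.
    by move=> a y [Y FY Yy]; exists Y => //; have [[_ _ YM] _ _] := nz _ _ FY Yy; apply: YM.
  by move=> [Y FY Y1]; have [_ /(_ Y1)] := nz _ _ FY Y1.
have [im Nm Jm] : [/\ is_ideal m, ~ m 1 & J `<=` m].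
  case: Pm => [m0|//]; exfalso; apply: (maxm J); last by right; split.
  by rewrite m0; split=> // /(_ 0 J0).
exists m; split=> //; split=> // a b mab.
have [m0 mD mM] := im.
have grow c : ~ m c -> exists d, m (1 - d * c).
  move=> Nc; apply: contrapT => Nd.
  pose M := [set x | exists d, m (x - d * c)].
  apply: (maxm M).
    split; first by move=> x mx; exists 0; rewrite mul0r subr0.
    by move=> /(_ c); apply: contra_not Nc; apply; exists 1; rewrite mul1r subrr.
  right; split=> //.
  - split; first by exists 0; rewrite mul0r subr0.
    + move=> x y [d md] [e me]; exists (d + e).
      by rewrite mulrDl opprD addrACA; apply: mD.
    + by move=> e x [d md]; exists (e * d); rewrite -mulrA -mulrBr; apply: mM.
  - by move=> x /Jm mx; exists 0; rewrite mul0r subr0.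
have [ma|/grow[d md]] := pselect (m a); [by left | right].
have -> : b = b * (1 - d * a) + d * (a * b) by ring.
by apply: mD; apply: mM.
Qed.

(** The local-global principle: when the denominators solving a problem form an ideal, the problem
    may be solved at one prime at a time. *)
Lemma prime_cover J : is_ideal J ->
  (forall m, is_prime m -> exists2 s, ~ m s & J s) -> J 1.
Proof.
move=> iJ H; apply: contrapT => /(exists_prime iJ)[m [pm Jm]].
by have [s Ns /Jm] := H m pm.
Qed.

Lemma ideal_prod_sub m (K : finType) (x y : K -> C) : is_ideal m ->
  (forall k, m (x k - y k)) -> m (\prod_k x k - \prod_k y k).
Proof.
move=> im mxy; elim: (index_enum K) => [|k r IH]; first by rewrite !big_nil subrr; case: im.
rewrite !big_cons.
have -> : forall a b c d : C, a * b - c * d = (a - c) * b + c * (b - d) by move=> *; ring.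
have [_ mD mM] := im.
by apply: mD; [apply: ideal_mulr | apply: mM].
Qed.

(** A determinant is a polynomial in the entries, so congruent matrices have congruent determinants;
    the comparison is with the scalar matrix [s]. *)
Lemma ideal_det_sub m n (P : 'M[C]_n) (s : C) : is_ideal m ->
  (forall i k, m (P i k - s *+ (i == k))) -> m (\det P - s ^+ n).
Proof.
move=> im mP; have [m0 mD mM] := im.
rewrite -(det_scalar n s) /determinant -sumrB.
apply: ideal_sum => // σ _; rewrite -mulrBr; apply: mM.
by apply: ideal_prod_sub => // k; rewrite !mxE.
Qed.

Lemma prime_det m n (P : 'M[C]_n) (s : C) : is_prime m -> ~ m s ->
  (forall i k, m (P i k - s *+ (i == k))) -> ~ m (\det P).
Proof.
move=> pm Ns mP mdet; have [im _ _] := pm; have [m0 mD mM] := im.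
apply: (@prime_notX m s n) => //.
rewrite -[_ ^+ n](subKr (\det P)); apply: mD => //; apply: ideal_opp => //.
exact: ideal_det_sub.
Qed.

End Ideals.

Section IdealMap.
Variables (C D : comPzRingType) (phi : {rmorphism C -> D}).

Lemma ideal_gen_map (S : set C) x :
  ideal_gen S x -> ideal_gen (phi @` S) (phi x).
Proof.
have iD := ideal_gen_ideal (phi @` S); have [i0 iDD iDM] := iD.
apply: (@ideal_gen_min _ S [set x | ideal_gen (phi @` S) (phi x)]).
  split=> [|y z|a y] /=; rewrite ?rmorph0 ?rmorphD ?rmorphM //; [exact: iDD|exact: iDM].
by move=> y Sy; apply: ideal_gen_sub; exists y.
Qed.

End IdealMap.

(** * Localization and complements *)

Section Localization.
Local Open Scope quotient_scope.
Variables (A : comPzRingType) (f : A).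

(** The pair (a, n) stands for a / f^n. The extra power f^k is there because f may be a zero
    divisor. *)
Definition loc_rel (x y : A * nat) : bool :=
  `[< exists k, f ^+ (k + y.2) * x.1 = f ^+ (k + x.2) * y.1 >].

Fact loc_rel_refl : reflexive loc_rel.
Proof. by move=> x; apply/asboolP; exists 0. Qed.
Fact loc_rel_sym : symmetric loc_rel.
Proof. by move=> x y; apply: asbool_equiv_eq; split=> -[k E]; exists k. Qed.
Fact loc_rel_trans : transitive loc_rel.
Proof.
move=> [b m] [a n] [c p] /asboolP[k /= E] /asboolP[l /= F]; apply/asboolP => /=.
exists (k + l + m)%N; move: E F; rewrite !exprD => E F.
have -> : f ^+ k * f ^+ l * f ^+ m * f ^+ p * a = (f ^+ k * f ^+ m * a) * (f ^+ l * f ^+ p) by ring.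
rewrite E; have -> : f ^+ k * f ^+ n * b * (f ^+ l * f ^+ p) =
  (f ^+ k * f ^+ n) * (f ^+ l * f ^+ p * b) by ring.
by rewrite F; ring.
Qed.

Definition loc_equiv := EquivRel loc_rel loc_rel_refl loc_rel_sym loc_rel_trans.
Definition loc : Type := {eq_quot loc_equiv}.
HB.instance Definition _ := Choice.on loc.

Definition lfrac (a : A) (n : nat) : loc := \pi_({eq_quot loc_equiv}) (a, n).

Lemma lfrac_eq a n b p :
  lfrac a n = lfrac b p <-> exists k, f ^+ (k + p) * a = f ^+ (k + n) * b.
Proof.
split; first by move=> /eqmodP/asboolP.
by move=> H; apply/eqmodP/asboolP.
Qed.

Lemma lfracP (x : loc) : exists a n, x = lfrac a n.
Proof. by exists (repr x).1, (repr x).2; rewrite /lfrac -surjective_pairing reprK. Qed.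

Definition loc_add (x y : loc) :=
  lfrac (f ^+ (repr y).2 * (repr x).1 + f ^+ (repr x).2 * (repr y).1)
    ((repr x).2 + (repr y).2).
Definition loc_mul (x y : loc) :=
  lfrac ((repr x).1 * (repr y).1) ((repr x).2 + (repr y).2).
Definition loc_opp (x : loc) := lfrac (- (repr x).1) (repr x).2.

Lemma lfrac_repr a n : exists k,
  f ^+ (k + n) * (repr (lfrac a n)).1 = f ^+ (k + (repr (lfrac a n)).2) * a.
Proof. by apply/lfrac_eq; rewrite /lfrac -surjective_pairing reprK. Qed.

Lemma loc_addE a n b p :
  loc_add (lfrac a n) (lfrac b p) = lfrac (f ^+ p * a + f ^+ n * b) (n + p).
Proof.
apply/lfrac_eq; have [[k +] [l]] := (lfrac_repr a n, lfrac_repr b p).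
move: (repr (lfrac a n)) (repr (lfrac b p)) => [a' n'] [b' p'] /=; rewrite !exprD => E F.
exists (k + l)%N; rewrite !exprD !mulrDr; congr (_ + _).
  transitivity ((f ^+ k * f ^+ n * a') * f ^+ l * f ^+ p * f ^+ p'); first by ring.
  by rewrite E; ring.
transitivity ((f ^+ l * f ^+ p * b') * f ^+ k * f ^+ n * f ^+ n'); first by ring.
by rewrite F; ring.
Qed.

Lemma loc_mulE a n b p :
  loc_mul (lfrac a n) (lfrac b p) = lfrac (a * b) (n + p).
Proof.
apply/lfrac_eq; have [[k +] [l]] := (lfrac_repr a n, lfrac_repr b p).
move: (repr (lfrac a n)) (repr (lfrac b p)) => [a' n'] [b' p'] /=; rewrite !exprD => E F.
exists (k + l)%N; rewrite !exprD.
transitivity ((f ^+ k * f ^+ n * a') * (f ^+ l * f ^+ p * b')); first by ring.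
by rewrite E F; ring.
Qed.

Lemma loc_oppE a n : loc_opp (lfrac a n) = lfrac (- a) n.
Proof.
apply/lfrac_eq; have [k] := lfrac_repr a n.
by move: (repr _) => [a' n'] /= E; exists k; rewrite !mulrN E.
Qed.

Fact loc_addA : associative loc_add.
Proof.
move=> x y z; have [a [n ->]] := lfracP x; have [b [p ->]] := lfracP y.
have [c [q ->]] := lfracP z; rewrite !loc_addE; apply/lfrac_eq; exists 0.
by rewrite !add0n !exprD; ring.
Qed.
Fact loc_addC : commutative loc_add.
Proof.
move=> x y; have [a [n ->]] := lfracP x; have [b [p ->]] := lfracP y.
by rewrite !loc_addE addrC addnC.
Qed.
Fact loc_add0 : left_id (lfrac 0 0) loc_add.
Proof.
move=> x; have [a [n ->]] := lfracP x.
by rewrite !loc_addE mulr0 add0r mul1r.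
Qed.
Fact loc_addN : left_inverse (lfrac 0 0) loc_opp loc_add.
Proof.
move=> x; have [a [n ->]] := lfracP x; rewrite loc_oppE loc_addE.
by apply/lfrac_eq; exists 0; rewrite mulrN addNr !mulr0.
Qed.
HB.instance Definition _ :=
  GRing.isZmodule.Build loc loc_addA loc_addC loc_add0 loc_addN.

Fact loc_mulA : associative loc_mul.
Proof.
move=> x y z; have [a [n ->]] := lfracP x; have [b [p ->]] := lfracP y.
by have [c [q ->]] := lfracP z; rewrite !loc_mulE mulrA addnA.
Qed.
Fact loc_mulC : commutative loc_mul.
Proof.
move=> x y; have [a [n ->]] := lfracP x; have [b [p ->]] := lfracP y.
by rewrite !loc_mulE mulrC addnC.
Qed.
Fact loc_mul1 : left_id (lfrac 1 0) loc_mul.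
Proof. by move=> x; have [a [n ->]] := lfracP x; rewrite loc_mulE mul1r. Qed.
Fact loc_mulDl : left_distributive loc_mul loc_add.
Proof.
move=> x y z; have [a [n ->]] := lfracP x; have [b [p ->]] := lfracP y.
have [c [q ->]] := lfracP z; rewrite [in LHS]loc_addE !loc_mulE loc_addE; apply/lfrac_eq; exists 0.
by rewrite !add0n !exprD; ring.
Qed.
HB.instance Definition _ :=
  GRing.Zmodule_isComPzRing.Build loc loc_mulA loc_mulC loc_mul1 loc_mulDl.

Definition tolocf (a : A) := lfrac a 0.
Fact tolocf_zmod : zmod_morphism tolocf.
Proof.
move=> a b; rewrite /tolocf -[_ - _ in RHS]/(loc_add _ (loc_opp _)).
by rewrite loc_oppE loc_addE !mul1r.
Qed.
Fact tolocf_monoid : monoid_morphism tolocf.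
Proof. by split=> // a b; rewrite -[_ * _ in RHS]/(loc_mul _ _) loc_mulE. Qed.
HB.instance Definition _ := GRing.isZmodMorphism.Build A loc tolocf tolocf_zmod.
HB.instance Definition _ := GRing.isMonoidMorphism.Build A loc tolocf tolocf_monoid.
Definition toloc : {rmorphism A -> loc} := tolocf.

Lemma toloc_ker a : toloc a = 0 -> exists n, f ^+ n * a = 0.
Proof.
by rewrite -(rmorph0 toloc) => /lfrac_eq[k]; rewrite mulr0 addn0 => E; exists k.
Qed.

Lemma lfrac_mul a n : toloc (f ^+ n) * lfrac a n = toloc a.
Proof.
rewrite -[LHS]/(loc_mul _ _) loc_mulE; apply/lfrac_eq; exists 0.
by rewrite !add0n mul1r.
Qed.

Lemma toloc_unit : toloc f * lfrac 1 1 = 1.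
Proof. exact: (lfrac_mul 1 1). Qed.

Section LocLift.
Variables (C : comPzRingType) (g : {rmorphism A -> C}) (w : C).
Hypothesis gw : g f * w = 1.

Lemma locw n : g (f ^+ n) * w ^+ n = 1.
Proof. by rewrite rmorphXn -exprMn gw expr1n. Qed.

Definition locliftf (x : loc) : C := w ^+ (repr x).2 * g (repr x).1.

Lemma locliftE a n : locliftf (lfrac a n) = w ^+ n * g a.
Proof.
rewrite /locliftf; have [k] := lfrac_repr a n; move: (repr _) => [a' n'] /= E.
have {E}: g (f ^+ k) * (g (f ^+ n) * g a') = g (f ^+ k) * (g (f ^+ n') * g a).
  by rewrite -!rmorphM !mulrA -!exprD E.
move=> /(congr1 (fun x => w ^+ k * (w ^+ n * w ^+ n' * x))) E.
transitivity (w ^+ n' * g a' * (g (f ^+ k) * w ^+ k) * (g (f ^+ n) * w ^+ n)).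
  by rewrite !locw !mulr1.
transitivity (w ^+ n * g a * (g (f ^+ k) * w ^+ k) * (g (f ^+ n') * w ^+ n')); last first.
  by rewrite !locw !mulr1.
move: E; rewrite ?rmorphXn => E.
transitivity (w ^+ k * (w ^+ n * w ^+ n' * (g f ^+ k * (g f ^+ n * g a')))); first by ring.
by rewrite E; ring.
Qed.

Fact loclift_zmod : zmod_morphism locliftf.
Proof.
move=> x y; have [a [n ->]] := lfracP x; have [b [p ->]] := lfracP y.
rewrite -[_ - _ in LHS]/(loc_add _ (loc_opp _)) loc_oppE loc_addE !locliftE.
rewrite rmorphD !rmorphM rmorphN exprD.
transitivity (w ^+ n * g a * (g (f ^+ p) * w ^+ p) -
  w ^+ p * g b * (g (f ^+ n) * w ^+ n)); first by ring.
by rewrite !locw !mulr1.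
Qed.
Fact loclift_monoid : monoid_morphism locliftf.
Proof.
split; first by rewrite -[1 in LHS]/(lfrac 1 0) locliftE rmorph1 mulr1.
move=> x y; have [a [n ->]] := lfracP x; have [b [p ->]] := lfracP y.
by rewrite -[_ * _ in LHS]/(loc_mul _ _) loc_mulE !locliftE rmorphM exprD; ring.
Qed.
HB.instance Definition _ := GRing.isZmodMorphism.Build loc C locliftf loclift_zmod.
HB.instance Definition _ := GRing.isMonoidMorphism.Build loc C locliftf loclift_monoid.
Definition loclift : {rmorphism loc -> C} := locliftf.

Lemma loclift_toloc a : loclift (toloc a) = g a.
Proof. by rewrite [LHS]locliftE mul1r. Qed.
End LocLift.

Lemma loc_hom_eq (C : comPzRingType) (h1 h2 : {rmorphism loc -> C}) :
  (forall a, h1 (toloc a) = h2 (toloc a)) -> h1 =1 h2.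
Proof.
move=> E x; have [a [n ->]] := lfracP x.
have u : h1 (toloc (f ^+ n)) * h1 (lfrac 1 n) = 1 by rewrite -rmorphM lfrac_mul !rmorph1.
transitivity (h1 (toloc (f ^+ n)) * h1 (lfrac 1 n) * h1 (lfrac a n)); first by rewrite u mul1r.
rewrite mulrAC -rmorphM lfrac_mul E -(lfrac_mul a n) rmorphM -E.
by rewrite mulrAC u mul1r.
Qed.

End Localization.
Arguments toloc {A} f.

(** A ring map sends J to generators of the unit ideal exactly when it inverts f, so the complement
    of V(J) is D(f). *)
Lemma loc_complement (A : comPzRingType) (f : A) (J : set A) :
  ideal_gen J = ideal_gen [set f] -> is_complement J (toloc f).
Proof.
move=> JE; have Jf : ideal_gen J f by rewrite JE; apply: ideal_gen_sub.
split.
  rewrite -(toloc_unit f) mulrC; apply: ideal_genM.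
  exact: (ideal_gen_map (toloc f)).
move=> C g g1; split; last by move=> h1 h2; exact: loc_hom_eq.
have [w gw] : exists w, g f * w = 1.
  have: is_ideal [set x | exists w, g f * w = x].
    split=> [|x y [a <-] [b <-]|a x [b <-]].
    - by exists 0; rewrite mulr0.
    - by exists (a + b); rewrite mulrDr.
    - by exists (a * b); rewrite mulrCA.
  move=> /(@ideal_gen_min _ [set g a | a in J]); apply=> // _ [a Ja <-].
  have: ideal_gen [set f] a by rewrite -JE; exact: ideal_gen_sub.
  move: a {Ja}; apply: ideal_gen_min => [|_ ->]; last by exists 1; rewrite mulr1.
  split=> [|x y [a E] [b F]|a x [b E]] /=.
  - by exists 0; rewrite mulr0 rmorph0.
  - by exists (a + b); rewrite mulrDr rmorphD E F.
  - by exists (g a * b); rewrite mulrCA rmorphM E.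
by exists (loclift gw) => a; exact: loclift_toloc.
Qed.

Record subring (C : comPzRingType) := Subring {
  subring_pred :> {pred C}; subringP : subring_closed subring_pred }.

Section SubRing.
Variables (C : comPzRingType) (S : subring C).
Record subringt := SubRing { subringt_val : C; _ : subringt_val \in (S : {pred C}) }.
HB.instance Definition _ := [isSub for subringt_val].
HB.instance Definition _ := [Choice of subringt by <:].
HB.instance Definition _ :=
  GRing.SubChoice_isSubComPzRing.Build C (subring_pred S) subringt (subringP S).
Fact subringt_val_zmod : zmod_morphism subringt_val. Proof. by []. Qed.
Fact subringt_val_monoid : monoid_morphism subringt_val. Proof. by []. Qed.
HB.instance Definition _ :=
  GRing.isZmodMorphism.Build subringt C subringt_val subringt_val_zmod.
HB.instance Definition _ :=
  GRing.isMonoidMorphism.Build subringt C subringt_val subringt_val_monoid.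

Variables (A : comPzRingType) (phi : {rmorphism A -> C}).
Hypothesis phiS : forall a, phi a \in (S : {pred C}).
Definition subringt_lift a := SubRing (phiS a).
Fact subringt_lift_zmod : zmod_morphism subringt_lift.
Proof. by move=> a b; apply: val_inj; rewrite /= rmorphB. Qed.
Fact subringt_lift_monoid : monoid_morphism subringt_lift.
Proof. by split=> [|a b]; apply: val_inj; rewrite /= ?rmorph1 ?rmorphM. Qed.
HB.instance Definition _ :=
  GRing.isZmodMorphism.Build A subringt subringt_lift subringt_lift_zmod.
HB.instance Definition _ :=
  GRing.isMonoidMorphism.Build A subringt subringt_lift subringt_lift_monoid.
End SubRing.

Section Complement.
Variables (A A1 : comPzRingType) (J : set A) (phi : {rmorphism A -> A1}).
Hypothesis phiJ : is_complement J phi.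

(** D(f) lies in the complement of V(J), so A -> A[1/f] factors through [A1], and its kernel is the
    f-power torsion. *)
Lemma complement_ker f a : ideal_gen J f -> phi a = 0 -> exists n, f ^+ n * a = 0.
Proof.
move=> Jf phia; have [_ /(_ _ (toloc f))[]] := phiJ.
  rewrite -(toloc_unit f) mulrC; apply: ideal_genM.
  exact: (ideal_gen_map (toloc f)).
by move=> [h hE] _; apply: toloc_ker; rewrite -hE phia rmorph0.
Qed.

(* The inclusion of a subring over which J still generates the unit ideal *)
(* has a section, by the universal property of A1, hence is onto.         *)
Lemma complement_subring (P : {pred A1}) : subring_closed P ->
  (forall a, phi a \in P) ->
  forall n (s : 'I_n -> A1) (a : 'I_n -> A), (forall k, s k \in P) -> (forall k, J (a k)) ->
  \sum_k s k * phi (a k) = 1 -> forall x, x \in P.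
Proof.
move=> Pring phiS n s a Ss Ja E x; pose S := Subring Pring.
pose g : {rmorphism A -> subringt S} := @subringt_lift _ S _ phi phiS.
have [_ univ] := phiJ; have [|[h hE] _] := univ _ g.
  have -> : 1 = \sum_k (@SubRing _ S _ (Ss k) : subringt S) * g (a k).
    by apply: val_inj; rewrite /= -E [RHS](rmorph_sum (@subringt_val _ S)).
  apply: ideal_sum => [|k _]; first exact: ideal_gen_ideal.
  by apply: ideal_genM; apply: ideal_gen_sub; exists (a k).
have [_ /(_ (@subringt_val _ S \o h : {rmorphism A1 -> A1}) idfun)] := univ _ phi phiJ.1.
have Eh a' : (@subringt_val _ S \o h : {rmorphism A1 -> A1}) (phi a') = idfun (phi a').
  by rewrite /= hE.
by move=> /(_ Eh x) /= <-; case: (h x).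
Qed.
End Complement.

Section BasicOpen.
Variables (A Af : comPzRingType) (f : A) (phi : {rmorphism A -> Af}).
Hypothesis phif : is_complement [set f] phi.

Lemma basic_ker a : phi a = 0 -> exists n, f ^+ n * a = 0.
Proof. exact: (complement_ker phif (ideal_gen_sub (erefl f))). Qed.

Lemma basic_unit : exists w, phi f * w = 1.
Proof.
have [/ideal_gen_exists[n [c [s [Hs ->]]]] _] := phif.
exists (\sum_k c k); rewrite mulr_sumr; apply: eq_bigr => k _.
by have [a -> <-] := Hs k; rewrite mulrC.
Qed.

(** Elements with a power of f as denominator form a subring containing the image of A and the
    inverse of f, hence everything. *)
Lemma basic_frac y : exists n a, phi (f ^+ n) * y = phi a.
Proof.
pose S : {pred Af} := fun y => `[< exists n a, phi (f ^+ n) * y = phi a >].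
have Sring : subring_closed S.
  split.
  - by apply/asboolP; exists 0, 1; rewrite rmorph1 mulr1.
  - move=> x z /asboolP[n [a E]] /asboolP[p [b F]]; apply/asboolP.
    exists (n + p)%N, (f ^+ p * a - f ^+ n * b).
    by rewrite exprD rmorphB !rmorphM -E -F; ring.
  - move=> x z /asboolP[n [a E]] /asboolP[p [b F]]; apply/asboolP.
    by exists (n + p)%N, (a * b); rewrite exprD !rmorphM -E -F; ring.
have [w fw] := basic_unit.
apply/asboolP; apply: (complement_subring phif Sring _
  (n := 1) (s := fun=> w) (a := fun=> f)) => //.
- by move=> a; apply/asboolP; exists 0, a; rewrite rmorph1 mul1r.
- by move=> _; apply/asboolP; exists 1, 1; rewrite fw rmorph1.
- by rewrite big_ord1 mulrC.
Qed.

Lemma basic_powunit n : exists w, phi (f ^+ n) * w = 1.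
Proof.
by have [w fw] := basic_unit; exists (w ^+ n); rewrite rmorphXn -exprMn fw expr1n.
Qed.

Lemma basic_frac_fin (K : finType) (y : K -> Af) :
  exists n (a : K -> A), forall k, phi (f ^+ n) * y k = phi (a k).
Proof.
have H k : exists n, exists a, phi (f ^+ n) * y k = phi a := basic_frac (y k).
pose n k := projT1 (cid (H k)); have /choice[a aE] k := projT2 (cid (H k)).
exists (\sum_k n k)%N, (fun k => f ^+ (\sum_k n k - n k) * a k) => k.
have le : (n k <= \sum_k n k)%N by rewrite (bigD1 k) //= leq_addr.
by rewrite -{1}(subnK le) exprD !rmorphM -mulrA aE.
Qed.

End BasicOpen.

(** The sum of the individual exponents works. This clears finitely many denominators at once. *)
Lemma pow_uniform (A : comPzRingType) (f : A) (K : finType) (P : K -> A -> Prop) :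
  (forall k x a, P k x -> P k (a * x)) ->
  (forall k, exists n, P k (f ^+ n)) -> exists n, forall k, P k (f ^+ n).
Proof.
move=> PM /choice[n Pn]; exists (\sum_k n k)%N => k.
have le : (n k <= \sum_k n k)%N by rewrite (bigD1 k) //= leq_addr.
by rewrite -(subnK le) exprD; apply: PM.
Qed.

(** * The invertible ideal I inside A[1/I] *)

Section Span.
Variables (C : comPzRingType) (V : lmodType C).

Fact span0 (S : set V) : @mulspan C V setT S 0. Proof. exact: mulspan0. Qed.
Fact spanD (S : set V) x y :
  @mulspan C V setT S x -> @mulspan C V setT S y -> @mulspan C V setT S (x + y).
Proof. exact: mulspanD. Qed.
Fact spanZ (S : set V) (a : C) x :
  @mulspan C V setT S x -> @mulspan C V setT S ((idfun : {rmorphism C -> C}) a *: x).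
Proof.
elim=> [|y z _ IHy _ IHz|c s _ Ss]; first by rewrite scaler0; exact: mulspan0.
  by rewrite scalerDr; apply: mulspanD.
by rewrite scalerA; apply: mulspanZ.
Qed.
Definition span (S : set V) : submodule (idfun : {rmorphism C -> C}) V :=
  Submodule (span0 S) (@spanD S) (@spanZ S).
End Span.

Lemma subm_valD (A A1 : comPzRingType) (iota : {rmorphism A -> A1}) (V : lmodType A1)
  (S : submodule iota V) (x y : subm S) : subm_val (x + y) = subm_val x + subm_val y.
Proof. by []. Qed.
Lemma subm_valZ (A A1 : comPzRingType) (iota : {rmorphism A -> A1}) (V : lmodType A1)
  (S : submodule iota V) a (x : subm S) : subm_val (a *: x) = iota a *: subm_val x.
Proof. by []. Qed.

Lemma submP (A A1 : comPzRingType) (iota : {rmorphism A -> A1}) (V : lmodType A1)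
  (S : submodule iota V) (x : subm S) : smem S (subm_val x).
Proof. by apply/asboolP; exact: subm_valP. Qed.

Section BaseChange.
Variables (C D : comPzRingType) (phi : {rmorphism C -> D}).
Variables (N : lmodType C) (P : lmodType D) (rho : {linear N -> P | phi \; *:%R}).

(* The corestriction of rho to the span of its image extends to P, which *)
(* retracts P onto the span.                                             *)
Lemma base_change_span : base_change rho -> forall y, mulspan setT (range rho) y.
Proof.
move=> bc y; pose S := span (range rho).
have Srho x : rho x \in in_subm S.
  by apply/asboolP; rewrite -[rho x]scale1r; apply: mulspanZ.
pose h0 x : subm S := Subm (Srho x).
have h0D x z : h0 (x + z) = h0 x + h0 z by apply: val_inj; rewrite /= linearD.
have h0Z a x : h0 (a *: x) = phi a *: h0 x by apply: val_inj; rewrite /= linearZ.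
have [[k kE] _] := bc _ (mksemilin h0 h0D h0Z).
pose kv y := subm_val (k y).
have kvD x z : kv (x + z) = kv x + kv z by rewrite /kv linearD.
have kvZ a x : kv (a *: x) = a *: kv x by rewrite /kv linearZ.
have [_ /(_ (mklin kv kvD kvZ) idfun) E] := bc _ rho.
rewrite -[y]E => [|x]; first exact: (submP (k y)).
by rewrite /= /kv kE.
Qed.

End BaseChange.

Section InvertibleLocal.
Variables (A : comPzRingType) (L : lmodType A) (v : {linear L -> A^o}).
Hypothesis vinj : injective v.
Variables (Af : comPzRingType) (f : A) (phi : {rmorphism A -> Af}).
Hypothesis phif : is_complement [set f] phi.
Variable g : {linear L -> Af^o | phi \; *:%R}.
Hypothesis gbc : base_change g.

(** In the trivialization of L over D(f), [x0] corresponds to a power of f, hence generates L there.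
    Injectivity of v turns identities in L into identities in A, and makes [v x0] regular up to
    f-power torsion. *)
Lemma invertible_local : exists x0 : L,
  (forall x, exists c b, f ^+ c *: x = b *: x0) /\
  (forall y, v x0 * y = 0 -> exists c, f ^+ c * y = 0).
Proof.
have gZ a x : g (a *: x) = phi a * g x by rewrite linearZ.
have vZ a x : v (a *: x) = a * v x by rewrite linearZ.
have [x0 [N x0E]] : exists x0 N, g x0 = phi (f ^+ N).
  have: exists x N, phi (f ^+ N) * 1 = g x.
    elim: (base_change_span gbc 1) => [|y z _ [x [N E]] _ [x' [N' E']]|c _ _ [x _ <-]].
    - by exists 0, 0; rewrite mulr0 linear0.
    - exists (f ^+ N' *: x + f ^+ N *: x'), (N + N')%N.
      by rewrite linearD !gZ -E -E' exprD rmorphM; ring.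
    - have [N [b E]] := basic_frac phif c; exists (b *: x), N.
      by rewrite gZ -E -mulrA.
  by move=> [x0 [N E]]; exists x0, N; rewrite -E mulr1.
pose h0 x : Af^o := phi (v x).
have h0D x z : h0 (x + z) = h0 x + h0 z by rewrite /h0 linearD rmorphD.
have h0Z a x : h0 (a *: x) = phi a *: h0 x by rewrite /h0 vZ rmorphM.
have [[k kE] _] := gbc (mksemilin h0 h0D h0Z).
have vE x : phi (v x) = g x * k 1.
  by rewrite -[phi _]/(mksemilin h0 h0D h0Z x) -kE -{1}[g x]mulr1 -[RHS]linearZ.
exists x0; split=> [x|y vy].
  have [c [b E]] := basic_frac phif (g x).
  have /(basic_ker phif)[n] : phi (f ^+ N * (f ^+ c * v x) - b * v x0) = 0.
    by rewrite rmorphB !rmorphM !vE x0E -E; ring.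
  move=> H; exists (n + (N + c))%N, (f ^+ n * b); apply: vinj.
  by rewrite !vZ !exprD; apply/eqP; rewrite -subr_eq0 -[X in _ == X]H; apply/eqP; ring.
have: y *: x0 = 0 by apply: vinj; rewrite vZ linear0 mulrC.
move=> /(congr1 g); rewrite gZ x0E linear0 -rmorphM => /(basic_ker phif)[n E].
by exists (n + N)%N; rewrite exprD -mulrA [_ ^+ N * _]mulrC.
Qed.
End InvertibleLocal.

Section InvertibleIdeal.
Variables (A : comPzRingType) (L : lmodType A) (v : {linear L -> A^o}).
Hypotheses (Linv : invertible_module L) (vinj : injective v).

(** The local statements made uniform: on D(F_k) the ideal I is generated by a_k, and a_k is regular
    there. Replacing the cover by suitable powers turns each unspecified exponent into a single
    multiplication by F_k. *)
Lemma invertible_cover : exists n (F a u : 'I_n -> A),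
  [/\ \sum_k u k * F k = 1, forall k, range v (a k),
      forall k x, range v x -> exists b, F k * x = b * a k
    & forall k y, a k * y = 0 -> F k * y = 0].
Proof.
have vZ a x : v (a *: x) = a * v x by rewrite linearZ.
have [n [f [f1 floc]]] := Linv.
have {floc} /choice[x xP] k : exists x0 : L,
    (forall x, exists c b, f k ^+ c *: x = b *: x0) /\
    (forall y, v x0 * y = 0 -> exists c, f k ^+ c * y = 0).
  by have [Af [phi [phif [g gbc]]]] := floc k; exact: (invertible_local vinj phif gbc).
have xgen y : exists c : 'I_n -> A, y = \sum_k c k *: x k.
  pose J := [set s : A | exists c : 'I_n -> A, s *: y = \sum_k c k *: x k].
  suff: J 1 by move=> [c]; rewrite scale1r => E; exists c.
  apply: (ideal_gen_pow1 _ _ f1) => [|_ [k _ <-]]; first split.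
  - by exists (fun=> 0); rewrite scale0r big1 // => k _; rewrite scale0r.
  - move=> s t [c E] [d F]; exists (fun k => c k + d k).
    by rewrite scalerDl E F -big_split; apply: eq_bigr => k _; rewrite scalerDl.
  - move=> s t [c E]; exists (fun k => s * c k).
    by rewrite -scalerA E scaler_sumr; apply: eq_bigr => k _; rewrite scalerA.
  - have [/(_ y)[c [b E]] _] := xP k; exists c, (fun l => b *+ (l == k)).
    by rewrite E (bigD1 k) //= eqxx big1 ?addr0 // => l /negbTE ->; rewrite scale0r.
have /choice[N NP] k : exists N, forall l, exists b, f k ^+ N *: x l = b *: x k.
  apply: (@pow_uniform _ _ _ (fun l s => exists b, s *: x l = b *: x k)) => l.
    by move=> s t [b E]; exists (t * b); rewrite -scalerA E scalerA.
  by have [/(_ (x l))] := xP k.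
pose F k := f k ^+ N k.
have Fgen k y : exists b, F k *: y = b *: x k.
  have [c ->] := xgen y; have /choice[b bE] := NP k.
  exists (\sum_l c l * b l); rewrite scaler_sumr scaler_suml.
  by apply: eq_bigr => l _; rewrite scalerA mulrC -scalerA bE scalerA.
have [p [u [s [sF E]]]] : exists p (u s : 'I_p -> A),
    (forall k, range F (s k)) /\ 1 = \sum_k u k * s k.
  apply: ideal_gen_exists; apply: (ideal_gen_pow1 _ _ f1); first exact: ideal_gen_ideal.
  by move=> _ [k _ <-]; exists (N k); apply: ideal_gen_sub; exists k.
have /choice[j jE] k : exists j, s k = F j by have [j _ <-] := sF k; exists j.
exists p, (F \o j), (v \o x \o j), u; split.
- by rewrite E; apply: eq_bigr => k _; rewrite jE.
- by move=> k; exists (x (j k)).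
- move=> k _ [y _ <-]; have [b bE] := Fgen (j k) y.
  by exists b; rewrite -!vZ bE.
- move=> k y /= vy.
  (* F_(j k) * y is annihilated by the image of every x_l, hence by a power of every f_l, hence it
     is 0. *)
  have H l : v (x l) * (F (j k) * y) = 0.
    have [b bE] := Fgen (j k) (x l).
    by rewrite mulrA [v _ * _]mulrC -vZ bE vZ -mulrA vy mulr0.
  pose J := [set s | s * (F (j k) * y) = 0].
  suff: J 1 by rewrite /J /= mul1r.
  apply: (ideal_gen_pow1 _ _ f1) => [|_ [l _ <-]]; first split.
  + by rewrite /J /= mul0r.
  + by move=> a b; rewrite /J /= mulrDl => -> ->; rewrite addr0.
  + by move=> a b; rewrite /J /= -mulrA => ->; rewrite mulr0.
  + by have [_ /(_ _ (H l))] := xP l.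
Qed.
End InvertibleIdeal.

Section FractionalIdeals.
Variables (A A1 : comPzRingType) (iota : {rmorphism A -> A1}) (I : set A).

(* I is an invertible ideal with inverse inside A1, and A1 = A[1/I]. *)
Record invertible_ideal := InvertibleIdeal {
  inv_ideal : is_ideal I;
  inv_inj : injective iota;
  inv_unit : exists n (a : 'I_n -> A) (y : 'I_n -> A1),
    [/\ forall k, I (a k), forall k x, I x -> exists b, iota x * y k = iota b
      & \sum_k iota (a k) * y k = 1];
  inv_frac : forall x : A1, exists n,
    forall a, ideal_pow I n a -> exists b, iota a * x = iota b }.

End FractionalIdeals.

(** Locally I is generated by the regular element a_k, whose inverse exists in A[1/I]; a partition
    of unity glues these inverses into elements y_k of I^-1 with \sum_k a_k y_k = 1. *)
Lemma invertible_idealP (A : comPzRingType) (L : lmodType A)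
    (v : {linear L -> A^o}) (A1 : comPzRingType) (iota : {rmorphism A -> A1}) (I : set A) :
  invertible_module L -> injective v -> I = range v -> is_complement I iota ->
  invertible_ideal iota I.
Proof.
move=> Linv vinj IE A1E.
have iI : is_ideal I.
  rewrite IE; split=> [|_ _ [x _ <-] [y _ <-]|a _ [x _ <-]].
  - by exists 0; rewrite ?linear0.
  - by exists (x + y); rewrite ?linearD.
  - by exists (a *: x); rewrite ?linearZ.
have [n [F [a [u [uF Ia FI aF]]]]] := invertible_cover Linv vinj.
have {}Ia k : I (a k) by rewrite IE.
have {}FI k x : I x -> exists b, F k * x = b * a k by rewrite IE; exact: FI.
have Fgen : ideal_gen (range F) 1 by rewrite -uF; exact: ideal_gen_sum.
have inj : injective iota.
  suff ker y : iota y = 0 -> y = 0.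
    by move=> x y E; apply/eqP; rewrite -subr_eq0; apply/eqP/ker; rewrite rmorphB E subrr.
  move=> iy; pose J := [set s | s * y = 0].
  suff: J 1 by rewrite /J /= mul1r.
  apply: (ideal_gen_pow1 _ _ Fgen) => [|_ [l _ <-]]; first split.
  - by rewrite /J /= mul0r.
  - by move=> b c; rewrite /J /= mulrDl => -> ->; rewrite addr0.
  - by move=> b c; rewrite /J /= -mulrA => ->; rewrite mulr0.
  - have [N] := complement_ker A1E (ideal_gen_sub (Ia l)) iy.
    rewrite /J /=; elim: N y {J iy} => [|N IHN] y; first by exists 0.
    rewrite exprSr -mulrA => /IHN[p] E.
    have: a l * (F l ^+ p * y) = 0 by rewrite mulrCA E.
    by move=> /aF; rewrite mulrA -exprS => ?; exists p.+1.
(* Squares are needed: one factor F_k makes elements of I divisible by a_k, the other lets a_k be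
   cancelled. *)
have [w wF2] : exists w : 'I_n -> A, \sum_k w k * (F k * F k) = 1.
  have: ideal_gen (range (fun k => F k * F k)) 1.
    apply: (ideal_gen_pow1 _ _ Fgen); first exact: ideal_gen_ideal.
    by move=> _ [k _ <-]; exists 2; apply: ideal_gen_sub; exists k.
  suff H x : ideal_gen (range (fun k => F k * F k)) x ->
     exists w : 'I_n -> A, \sum_k w k * (F k * F k) = x by exact: H.
  move: x; apply: ideal_gen_min => [|_ [k _ <-]].
    split=> [|x z [c <-] [d <-]|b x [c <-]].
    - by exists (fun=> 0); rewrite big1 // => k _; rewrite mul0r.
    - by exists (fun k => c k + d k); rewrite -big_split; apply: eq_bigr => k _; rewrite mulrDl.
    - by exists (fun k => b * c k); rewrite mulr_sumr; apply: eq_bigr => k _; rewrite -mulrA.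
  exists (fun l => (l == k)%:R).
  by rewrite (bigD1 k) //= eqxx big1 ?addr0 ?mul1r // => l /negbTE ->; rewrite mul0r.
have [p [c [s [Is E]]]] := ideal_gen_exists A1E.1.
have /choice[b bP] l : exists b, I b /\ iota b = s l.
  by have [b Ib <-] := Is l; exists b.
have /choice[q qE] (kl : 'I_n * 'I_p) : exists q, F kl.1 * b kl.2 = q * a kl.1.
  by apply: FI; have [] := bP kl.2.
(* Since q(k,l) is F_k b_l / a_k and the c_l b_l sum to 1, this is w_k F_k^2 / a_k written without
   division. *)
pose y k := \sum_l c l * iota (w k * (F k * q (k, l))).
have yI k x : I x -> exists d, iota x * y k = iota d.
  move=> Ix; have [d dE] := FI k x Ix; exists (w k * (F k * d)).
  rewrite -[RHS]mulr1 E !mulr_sumr; apply: eq_bigr => l _.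
  have [Ib <-] := bP l; rewrite mulrCA [RHS]mulrCA; congr (_ * _).
  rewrite -!rmorphM; congr (iota _).
  have: a k * (x * q (k, l) - d * b l) = 0.
    transitivity (x * (q (k, l) * a k) - (d * a k) * b l); first by ring.
    by rewrite -dE -(qE (k, l)) /=; ring.
  move=> /aF H; apply/eqP; rewrite -subr_eq0; apply/eqP.
  transitivity (w k * (F k * (x * q (k, l) - d * b l))); first by ring.
  by rewrite H mulr0.
have y1 : \sum_k iota (a k) * y k = 1.
  rewrite E; under eq_bigr do rewrite mulr_sumr.
  rewrite exchange_big /=; apply: eq_bigr => l _; have [_ <-] := bP l.
  rewrite -[RHS]mulr1 -(rmorph1 iota) -wF2 rmorph_sum mulr_sumr; apply: eq_bigr => k _.
  rewrite mulrCA -mulrA; congr (_ * _); rewrite -!rmorphM; congr (iota _).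
  transitivity (w k * (F k * (q (k, l) * a k))); first by ring.
  by rewrite -(qE (k, l)) /=; ring.
split=> //; first by exists n, a, y; split.
(* The elements whose denominators are powers of I form a subring containing the y_k, which is all
   of [A1] by [complement_subring]. *)
pose S : {pred A1} := fun x => `[< exists n,
    forall a, ideal_pow I n a -> exists b, iota a * x = iota b >].
have Sring : subring_closed S.
  split.
  - by apply/asboolP; exists 0 => d _; exists d; rewrite mulr1.
  - move=> x z /asboolP[k Hk] /asboolP[l Hl]; apply/asboolP; exists (k + l)%N => d Id.
    have [d1 E1] := Hk d (ideal_pow_le (leq_addr l k) Id).
    have [d2 E2] := Hl d (ideal_pow_le (leq_addl k l) Id).
    by exists (d1 - d2); rewrite mulrBr E1 E2 rmorphB.
  - move=> x z /asboolP[k Hk] /asboolP[l Hl]; apply/asboolP; exists (k + l)%N => d Id.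
    have [d1 /Hk[e E2] E1] := fpow_absorb Hl Id.
    by exists e; rewrite mulrCA E1 mulrC.
move=> x; apply/asboolP.
apply: (complement_subring A1E Sring _ (s := y) (a := a)) => [d|k|k|].
- by apply/asboolP; exists 0 => e _; exists (e * d); rewrite rmorphM.
- apply/asboolP; exists 1; apply: ideal_gen_min; last by move=> d; exact: yI.
  split=> [|d e [d' Ed] [e' Ee]|d e [e' Ee]] /=.
  + by exists 0; rewrite rmorph0 mul0r.
  + by exists (d' + e'); rewrite !rmorphD mulrDl Ed Ee.
  + by exists (d * e'); rewrite !rmorphM -mulrA Ee.
- exact: Ia.
- by rewrite -[RHS]y1; apply: eq_bigr => k _; rewrite mulrC.
Qed.

(** * Fractional ideals and lattices *)

Lemma nat_bound (K : finType) (P : K -> nat -> Prop) :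
  (forall k m n, (m <= n)%N -> P k m -> P k n) ->
  (forall k, exists n, P k n) -> exists n, forall k, P k n.
Proof.
move=> Pm /choice[n Pn]; exists (\max_k n k) => k.
by apply: (Pm _ (n k)) => //; exact: leq_bigmax.
Qed.

Section DualBasis.
Variables (C : comPzRingType) (M : lmodType C).

Lemma finite_projective_dual : finite_projective M ->
  exists n (x : 'I_n -> M) (xi : 'I_n -> {linear M -> C^o}),
    forall y, y = \sum_k xi k y *: x k.
Proof.
move=> [n [i [p ip]]].
pose xi k x : C^o := i x k 0.
have iD k x y : xi k (x + y) = xi k x + xi k y by rewrite /xi linearD mxE.
have iZ k a x : xi k (a *: x) = a *: xi k x by rewrite /xi linearZ mxE.
exists n, (fun k => p (delta_mx k 0)), (fun k => mklin (xi k) (iD k) (iZ k)) => y.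
rewrite -{1}[y]ip {1}[i y]matrix_sum_delta linear_sum; apply: eq_bigr => k _.
by rewrite big_ord1 linearZ.
Qed.

Lemma dual_finite_projective (K : finType) (x : K -> M) (xi : K -> {linear M -> C^o}) :
  (forall y, y = \sum_k xi k y *: x k) -> finite_projective M.
Proof.
move=> E.
pose i y : 'cV[C]_#|K| := \col_k xi (enum_val k) y.
pose p (c : 'cV[C]_#|K|) := \sum_k c k 0 *: x (enum_val k).
have iD y z : i (y + z) = i y + i z by apply/colP => k; rewrite !mxE linearD.
have iZ a y : i (a *: y) = a *: i y by apply/colP => k; rewrite !mxE linearZ.
have pD c d : p (c + d) = p c + p d.
  by rewrite /p -big_split; apply: eq_bigr => k _; rewrite mxE scalerDl.
have pZ a c : p (a *: c) = a *: p c.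
  by rewrite /p scaler_sumr; apply: eq_bigr => k _; rewrite mxE scalerA.
exists #|K|, (mklin i iD iZ), (mklin p pD pZ) => y /=.
rewrite [RHS]E /p (reindex (@enum_val K predT)) /=; last exact: onW_bij (enum_val_bij K).
by apply: eq_bigr => k _; rewrite mxE.
Qed.
End DualBasis.

Section Fpow.
Variables (A A1 : comPzRingType) (iota : {rmorphism A -> A1}) (I : set A).
Hypothesis H : invertible_ideal iota I.
Notation F := (fpow iota I).

Lemma fpow_iota x : F 0 x <-> exists b, x = iota b.
Proof. by split=> [[b _ ->]|[b ->]]; exists b. Qed.

Lemma fpow_iota_in a : F 0 (iota a).
Proof. by apply/fpow_iota; exists a. Qed.

Lemma fpowN j x : F j x -> F j (- x).
Proof. by move=> Fx; rewrite -sub0r; apply: fpowB => //; exact: fpow0. Qed.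

Lemma fpowD j x y : F j x -> F j y -> F j (x + y).
Proof. by move=> Fx Fy; rewrite -[y]opprK; apply: fpowB => //; exact: fpowN. Qed.

Lemma fpow_sum j (K : Type) (r : seq K) (P : pred K) (x : K -> A1) :
  (forall k, P k -> F j (x k)) -> F j (\sum_(k <- r | P k) x k).
Proof.
by move=> Fx; elim/big_rec: _ => [|k y Pk Fy]; [exact: fpow0 | apply: fpowD => //; exact: Fx].
Qed.

Lemma fpowZ j a x : F j x -> F j (iota a * x).
Proof. by move=> Fx; rewrite -[j]add0r; apply: fpowM => //; exact: fpow_iota_in. Qed.

Lemma fpow_neg_iota (j : int) a : j <= 0 -> F j (iota a).
Proof.
case: j => [[|n]|n] // _; first exact: fpow_iota_in.
by move=> b _; exists (b * a); rewrite rmorphM.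
Qed.

Lemma fpow_le (i j : int) x : j <= i -> F i x -> F j x.
Proof.
move=> ji Fx; rewrite -[j](subrK i) -[x]mul1r; apply: fpowM => //.
by rewrite -(rmorph1 iota); apply: fpow_neg_iota; lia.
Qed.

Lemma fpow1P x : F 1 x <-> exists2 a, I a & x = iota a.
Proof.
have [iI _ _ _] := H; have [I0 ID IM] := iI; split=> -[a Ia ->]; exists a => //.
  exact: (ideal_gen_min iI (@subset_refl _ I) Ia).
by rewrite -[a]mulr1; apply: (@mulspanZ A A^o).
Qed.

Lemma fpow1E : [set iota a | a in I] = F 1.
Proof.
apply/seteqP; split=> [_ [a Ia <-]|x /fpow1P[a Ia ->]]; last by exists a.
by apply/fpow1P; exists a.
Qed.

Lemma fpow_I a : I a -> F 1 (iota a).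
Proof. by move=> Ia; apply/fpow1P; exists a. Qed.

Lemma fpow_inj a b : iota a = iota b -> a = b.
Proof. by have [_ inj _ _] := H; exact: inj. Qed.

Lemma fpow_tpow j a : F j (iota a) <-> tpow I j a.
Proof.
split; last by case: j => [n|n] Ta; [exists a | apply: fpow_neg_iota].
by case: j => [n|n] //= -[b Ib /fpow_inj ->].
Qed.

Lemma fpowN1P y : (forall x, I x -> exists b, iota x * y = iota b) -> F (- 1) y.
Proof.
move=> Iy; change (F (Negz 0) y) => d; apply:
  (@ideal_gen_min _ _ [set d | exists b, iota d * y = iota b]) => //.
split=> [|u v [u' Eu] [v' Ev]|u v [v' Ev]] /=.
- by exists 0; rewrite rmorph0 mul0r.
- by exists (u' + v'); rewrite !rmorphD mulrDl Eu Ev.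
- by exists (u * v'); rewrite !rmorphM -mulrA Ev.
Qed.

(** The product of n copies of \sum_k a_k y_k = 1. It says I^n I^(-n) = A and replaces division by
    z^n when I has no generator z. *)
Lemma fpow_unit_nat n : exists (K : finType) (a b : K -> A1),
  [/\ forall k, F n%:Z (a k), forall k, F (- n%:Z) (b k) & \sum_k a k * b k = 1].
Proof.
elim: n => [|n [K [a [b [Fa Fb E]]]]].
  exists unit, (fun=> 1), (fun=> 1); split=> [_|_|]; try exact: fpow1.
  by rewrite (bigD1 tt) //= big1 ?addr0 ?mulr1 // => -[].
have [_ _ [p [c [y [Ic Iy Ey]]]] _] := H.
exists (K * 'I_p)%type, (fun k => a k.1 * iota (c k.2)), (fun k => b k.1 * y k.2); split.
- move=> k; have -> : n.+1%:Z = n%:Z + 1 by lia.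
  by apply: fpowM => //; exact: fpow_I.
- move=> k; have -> : - n.+1%:Z = - n%:Z - 1 by lia.
  by apply: fpowM => //; apply: fpowN1P; exact: Iy.
- transitivity (\sum_k \sum_l a k * iota (c l) * (b k * y l)).
    by rewrite pair_bigA.
  rewrite -[RHS]E; apply: eq_bigr => k _; rewrite -[RHS]mulr1 -Ey mulr_sumr.
  by apply: eq_bigr => l _; ring.
Qed.

Lemma fpow_unit j : exists (K : finType) (a b : K -> A1),
  [/\ forall k, F j (a k), forall k, F (- j) (b k) & \sum_k a k * b k = 1].
Proof.
case: j => n; first exact: fpow_unit_nat.
have [K [a [b [Fa Fb E]]]] := fpow_unit_nat n.+1; exists K, b, a; split=> //.
by rewrite -E; apply: eq_bigr => k _; rewrite mulrC.
Qed.

(** Multiply x by the partition of 1 for I^i I^(-i). *)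
Lemma fpow_colon i j x : (forall c, F i c -> F (i + j) (c * x)) -> F j x.
Proof.
move=> Fx; have [K [a [b [Fa Fb E]]]] := fpow_unit i.
rewrite -[x]mul1r -E mulr_suml; apply: fpow_sum => k _.
rewrite mulrAC; have -> : j = (i + j) - i by lia.
by apply: fpowM => //; exact: Fx.
Qed.

Lemma fpow_frac x : exists n : nat, F (- n%:Z) x.
Proof.
have [_ _ _ /(_ x)[n Hn]] := H; exists n.
apply: (@fpow_colon n) => c [a Ia ->]; rewrite subrr; apply/fpow_iota.
exact: Hn.
Qed.

Lemma fpow_frac_fin (K : finType) (x : K -> A1) : exists n : nat, forall k, F (- n%:Z) (x k).
Proof.
apply: nat_bound => [k m n mn|k]; last exact: fpow_frac.
by apply: fpow_le; lia.
Qed.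

Section Submodules.
Variables (V : lmodType A1).
Implicit Types S : submodule iota V.

Lemma subm_sum S (K : Type) (r : seq K) (P : pred K) (x : K -> V) :
  (forall k, P k -> smem S (x k)) -> smem S (\sum_(k <- r | P k) x k).
Proof.
by move=> Sx; elim/big_rec: _ => [|k y Pk Sy]; [exact: smem0 | apply: smemD => //; exact: Sx].
Qed.

Lemma subm_fpow0 S c x : F 0 c -> smem S x -> smem S (c *: x).
Proof. by move=> /fpow_iota[a ->]; exact: smemZ. Qed.

Lemma subm_opp S x : smem S x -> smem S (- x).
Proof. by move=> Sx; rewrite -scaleN1r -(rmorph1 iota) -rmorphN; exact: smemZ. Qed.

Lemma fpow_split j x : exists (K : finType) (a b : K -> A1),
  [/\ forall k, F j (a k), forall k, F (- j) (b k) & x = \sum_k a k *: (b k *: x) :> V].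
Proof.
have [K [a [b [Fa Fb E]]]] := fpow_unit j; exists K, a, b; split=> //.
by rewrite -[LHS]scale1r -E scaler_suml; apply: eq_bigr => k _; rewrite scalerA.
Qed.

(** As I^j is invertible, I^j S is also the set of x with I^(-j) x inside S. This colon form is the
    one used for the lattices. *)
Lemma mulspan_fpow S j x :
  mulspan (F j) (smem S) x <-> (forall c, F (- j) c -> smem S (c *: x)).
Proof.
split.
  elim=> [c _|y z _ IHy _ IHz c Fc|d y Fd Sy c Fc].
  - by rewrite scaler0; exact: smem0.
  - by rewrite scalerDr; apply: smemD; [exact: IHy | exact: IHz].
  - by rewrite scalerA; apply: subm_fpow0 => //; rewrite -(addNr j); apply: fpowM.
move=> Sx; have [K [a [b [Fa Fb ->]]]] := fpow_split j x.
elim/big_rec: _ => [|k y _ IH]; first exact: mulspan0.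
by apply: mulspanD => //; apply: mulspanZ => //; exact: Sx.
Qed.

Lemma mulspan_I S x :
  mulspan [set iota a | a in I] (smem S) x <-> (forall c, F (- 1) c -> smem S (c *: x)).
Proof. by rewrite fpow1E; exact: mulspan_fpow. Qed.

(** S is a finite projective A-lattice spanning V over A[1/I]. The functionals live on V, not on S,
    so that different lattices can be compared. *)
Definition dualizable S := exists n (y : 'I_n -> V) (eta : 'I_n -> {linear V -> A1^o}),
  [/\ forall k, smem S (y k), forall k x, smem S x -> F 0 (eta k x)
    & forall x, x = \sum_k eta k x *: y k].

Lemma dualizable_absorb S (K : finType) (x : K -> V) : dualizable S ->
  exists n : nat, forall k c, F n%:Z c -> smem S (c *: x k).
Proof.
move=> [p [y [eta [Sy _ E]]]].
have [n Hn] := fpow_frac_fin (fun kl : K * 'I_p => eta kl.2 (x kl.1)).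
exists n => k c Fc; rewrite [x k]E scaler_sumr; apply: subm_sum => l _.
rewrite scalerA; apply: subm_fpow0 => //; rewrite -(subrr n%:Z).
by apply: fpowM => //; exact: (Hn (k, l)).
Qed.

Lemma dualizable_absorb_subm S S' : dualizable S -> dualizable S' ->
  exists n : nat, forall x c, smem S' x -> F n%:Z c -> smem S (c *: x).
Proof.
move=> dS [p [y [eta [Sy etaS E]]]].
have [n Hn] := dualizable_absorb y dS; exists n => x c S'x Fc.
rewrite [x]E scaler_sumr; apply: subm_sum => l _.
rewrite scalerA mulrC -scalerA; apply: subm_fpow0; first exact: etaS.
exact: Hn.
Qed.

End Submodules.

(* M_j x means that x lies in M_j = I^j S' :&: S. *)
Section Lattice.
Variables (V : lmodType A1) (S S' : submodule iota V).
Definition lat (j : int) (x : V) := smem S x /\ forall c, F (- j) c -> smem S' (c *: x).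

Fact lat0 j : lat j 0.
Proof. by split=> [|c _]; rewrite ?scaler0; exact: smem0. Qed.
Fact latD j x y : lat j x -> lat j y -> lat j (x + y).
Proof.
move=> [Sx S'x] [Sy S'y]; split=> [|c Fc]; first exact: smemD.
by rewrite scalerDr; apply: smemD; [exact: S'x | exact: S'y].
Qed.
Lemma lat_mul (i j : int) c x : 0 <= i -> F i c -> lat j x -> lat (i + j) (c *: x).
Proof.
move=> i0 Fc [Sx S'x]; split=> [|d Fd].
  by apply: subm_fpow0 => //; exact: fpow_le Fc.
have E : - j = - (i + j) + i by lia.
by rewrite scalerA; apply: S'x; rewrite E; apply: fpowM.
Qed.
Lemma latZ j a x : lat j x -> lat j (iota a *: x).
Proof. by move=> Mx; rewrite -[j]add0r; apply: lat_mul => //; exact: fpow_iota_in. Qed.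
Definition latm j := Submodule (lat0 j) (@latD j) (@latZ j).

Lemma lat_sum j (K : Type) (r : seq K) (P : pred K) (x : K -> V) :
  (forall k, P k -> lat j (x k)) -> lat j (\sum_(k <- r | P k) x k).
Proof. exact: (@subm_sum _ (latm j)). Qed.

Lemma lat_le (i j : int) x : j <= i -> lat i x -> lat j x.
Proof.
by move=> ji [Sx S'x]; split=> // c Fc; apply: S'x; apply: fpow_le Fc; lia.
Qed.

Lemma lat_fpow0 j c x : F 0 c -> lat j x -> lat j (c *: x).
Proof. by move=> /fpow_iota[a ->]; exact: latZ. Qed.

Hypotheses (dS : dualizable S) (dS' : dualizable S').

(** Bounded denominators put S inside I^(-m) S', so M_j = S for j <= -m. *)
Lemma lat_low : exists m : nat, forall j x, j <= - m%:Z -> smem S x -> lat j x.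
Proof.
have [m Hm] := dualizable_absorb_subm dS' dS; exists m => j x jm Sx; split=> // c Fc.
by apply: Hm => //; apply: fpow_le Fc; lia.
Qed.

(** Bounded denominators put I^m S' inside S, so M_j = I^j S' for j >= m. *)
Lemma lat_high : exists m : nat, forall j x, m%:Z <= j ->
  (forall c, F (- j) c -> smem S' (c *: x)) -> lat j x.
Proof.
have [m Hm] := dualizable_absorb_subm dS dS'; exists m => j x jm S'x; split=> //.
have [K [a [b [Fa Fb ->]]]] := fpow_split j x; apply: subm_sum => k _.
by apply: Hm; [exact: S'x | apply: fpow_le (Fa k)].
Qed.

Lemma lat_high_step : exists m : nat, forall j x, m%:Z <= j ->
  lat (j + 1) x <-> mulspan [set iota a | a in I] (smem (latm j)) x.
Proof.
have [m Hm] := lat_high; exists m => j x jm; split; last first.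
  move=> /mulspan_I Sx; have [K [a [b [Fa Fb ->]]]] := fpow_split 1 x.
  apply: lat_sum => k _; rewrite addrC; apply: lat_mul => //; exact: Sx.
move=> [Sx S'x]; apply/mulspan_I => c Fc; apply: Hm => // d Fd.
by rewrite scalerA; apply: S'x; rewrite opprD; apply: fpowM.
Qed.

End Lattice.
End Fpow.

(** * The two lattices of a triple (E, E', Phi) *)

Section Gluing.
Variables (A A1 : comPzRingType) (iota : {rmorphism A -> A1}) (I : set A).
Hypothesis H : invertible_ideal iota I.
Notation F := (fpow iota I).

Lemma base_change_dual (E : lmodType A) (E1 : lmodType A1)
    (loc : {linear E -> E1 | iota \; *:%R}) :
  finite_projective E -> base_change loc ->
  exists n (y : 'I_n -> E) (eta : 'I_n -> {linear E -> A^o})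
     (eta1 : 'I_n -> {linear E1 -> A1^o}),
    [/\ forall x, x = \sum_k eta k x *: y k, forall k x, eta1 k (loc x) = iota (eta k x)
      & forall x, x = \sum_k eta1 k x *: loc (y k)].
Proof.
move=> fpE bc; have [n [y [eta Ey]]] := finite_projective_dual fpE.
pose h k x : A1^o := iota (eta k x).
have hD k x z : h k (x + z) = h k x + h k z by rewrite /h linearD rmorphD.
have hZ k a x : h k (a *: x) = iota a *: h k x by rewrite /h linearZ rmorphM.
have /choice[eta1 eta1E] k : exists k1 : {linear E1 -> A1^o}, forall x,
    k1 (loc x) = iota (eta k x).
  by have [[k1 k1E] _] := bc _ (mksemilin (h k) (hD k) (hZ k)); exists k1.
exists n, y, eta, eta1; split=> // x.
elim: (base_change_span bc x) => [|u v _ {1}-> _ {1}->|c _ _ [e _ <-]].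
- by rewrite big1 // => k _; rewrite linear0 scale0r.
- by rewrite -big_split; apply: eq_bigr => k _; rewrite linearD scalerDl.
- rewrite {1}[e]Ey linear_sum scaler_sumr; apply: eq_bigr => k _.
  by rewrite [loc (_ *: _)]linearZ [eta1 k _]linearZ /= eta1E; exact: scalerA.
Qed.

Variable T : gluing iota.
Notation V := (gE1 T).

Fact Esub0 : range (gloc T) 0. Proof. by exists 0; rewrite ?linear0. Qed.
Fact EsubD x y : range (gloc T) x -> range (gloc T) y -> range (gloc T) (x + y).
Proof. by move=> [e _ <-] [d _ <-]; exists (e + d); rewrite ?linearD. Qed.
Fact EsubZ a x : range (gloc T) x -> range (gloc T) (iota a *: x).
Proof. by move=> [e _ <-]; exists (a *: e); rewrite ?linearZ. Qed.
Definition Esub : submodule iota V := Submodule Esub0 EsubD EsubZ.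

Definition E'set := [set x : V | exists e', gPhi T x = gloc' T e'].
Fact E'sub0 : E'set 0. Proof. by exists 0; rewrite !linear0. Qed.
Fact E'subD x y : E'set x -> E'set y -> E'set (x + y).
Proof. by move=> [e xe] [d yd]; exists (e + d); rewrite !linearD xe yd. Qed.
Fact E'subZ a x : E'set x -> E'set (iota a *: x).
Proof. by move=> [e xe]; exists (a *: e); rewrite !linearZ xe. Qed.
Definition E'sub : submodule iota V := Submodule E'sub0 E'subD E'subZ.

Lemma dualizable_E : dualizable I Esub.
Proof.
have [n [y [eta [eta1 [Ey Eeta Ey1]]]]] := base_change_dual (gE_fp T) (@gloc_bc _ _ _ T).
exists n, (gloc T \o y), eta1; split=> //= [k|k _ [e _ <-]]; first by exists (y k).
by rewrite Eeta; exact: fpow_iota_in.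
Qed.

Lemma Phi_inv : exists Psi : {linear gE1' T -> V}, cancel (gPhi T) Psi /\ cancel Psi (gPhi T).
Proof.
have [Psi PhiK PsiK] := gPhi_bij T.
have PsiD x y : Psi (x + y) = Psi x + Psi y.
  by rewrite -{1}[x]PsiK -{1}[y]PsiK -linearD PhiK.
have PsiZ a x : Psi (a *: x) = a *: Psi x by rewrite -{1}[x]PsiK -linearZ PhiK.
by exists (mklin Psi PsiD PsiZ).
Qed.

Lemma dualizable_E' : dualizable I E'sub.
Proof.
have [Psi [PhiK PsiK]] := Phi_inv.
have [n [y [eta [eta1 [Ey Eeta Ey1]]]]] := base_change_dual (gE'_fp T) (@gloc'_bc _ _ _ T).
pose h k x := eta1 k (gPhi T x).
have hD k x z : h k (x + z) = h k x + h k z by rewrite /h !linearD.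
have hZ k a x : h k (a *: x) = a *: h k x by rewrite /h !linearZ.
exists n, (fun k => Psi (gloc' T (y k))), (fun k => mklin (h k) (hD k) (hZ k)); split=> /=.
- by move=> k; exists (y k); rewrite PsiK.
- by move=> k x [e' xe]; rewrite /h xe Eeta; exact: fpow_iota_in.
- move=> x; apply: (can_inj PhiK); rewrite {1}[gPhi T x]Ey1 linear_sum.
  by apply: eq_bigr => k _; rewrite linearZ /= PsiK.
Qed.

(** Coordinates in a dual basis reduce this to the injectivity of A -> A[1/I]. *)
Lemma gloc_inj : injective (gloc T).
Proof.
have [n [y [eta [eta1 [Ey Eeta Ey1]]]]] := base_change_dual (gE_fp T) (@gloc_bc _ _ _ T).
move=> e d E; rewrite [e]Ey [d]Ey; apply: eq_bigr => k _; congr (_ *: _).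
by apply: (fpow_inj H); rewrite -!Eeta E.
Qed.

Lemma gloc'_inj : injective (gloc' T).
Proof.
have [n [y [eta [eta1 [Ey Eeta Ey1]]]]] := base_change_dual (gE'_fp T) (@gloc'_bc _ _ _ T).
move=> e d E; rewrite [e]Ey [d]Ey; apply: eq_bigr => k _; congr (_ *: _).
by apply: (fpow_inj H); rewrite -!Eeta E.
Qed.

Lemma latticeE j x : smem (lattice I T j) x <-> lat I Esub E'sub j x.
Proof.
split=> -[]; first by move=> /(mulspan_fpow H E'sub) S'x Sx; split.
by move=> Sx /(mulspan_fpow H E'sub) S'x; split.
Qed.

Lemma latticeP j : smem (lattice I T j) = lat I Esub E'sub j.
Proof. by apply/funext => x; apply/propext; exact: latticeE. Qed.

End Gluing.

(** * Graded dual bases *)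

Lemma subm_val_sum (A A1 : comPzRingType) (iota : {rmorphism A -> A1}) (V : lmodType A1)
  (S : submodule iota V) (K : Type) (r : seq K) (P : pred K) (x : K -> subm S) :
  subm_val (\sum_(k <- r | P k) x k) = \sum_(k <- r | P k) subm_val (x k).
Proof. by elim/big_rec2: _ => // k y z _ <-. Qed.

Section GradedDualBasis.
Variables (A A1 : comPzRingType) (iota : {rmorphism A -> A1}) (I : set A).
Hypothesis H : invertible_ideal iota I.
Notation F := (fpow iota I).

(** The preimage under [iota], with default 0 outside the image. *)
Definition aval (x : A1) : A := xget 0 [set b | iota b = x].

Lemma avalE x : F 0 x -> iota (aval x) = x.
Proof.
move=> /fpow_iota[b ->]; rewrite /aval.
exact: (@xgetPex _ 0 [set c | iota c = iota b] (ex_intro _ b erefl)).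
Qed.

Lemma avalK a : aval (iota a) = a.
Proof. by apply: (fpow_inj H); apply: avalE; exact: fpow_iota_in. Qed.

Section GDB.
Variables (V : lmodType A1) (S S' : submodule iota V).
Notation M := (lat I S S').

(* The xi k restrict to homomorphisms of graded modules from the sum of the *)
(* M j to B shifted by e k, so that s = 1 gives a graded dual basis.        *)
Definition gdb (s : A) := exists (K : finType) (e : K -> int) (x : K -> V)
    (xi : K -> {linear V -> A1^o}),
  [/\ forall k, M (e k) (x k), forall k y, smem S y -> F 0 (xi k y),
      forall k y, smem S' y -> F (- e k) (xi k y)
    & forall y, iota s *: y = \sum_k xi k y *: x k].

(** Sums are handled by joining the two families, multiples by scaling the vectors. This is what
    makes the existence of a graded dual basis a local question. *)
Lemma gdb_ideal : is_ideal gdb.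
Proof.
split.
- have f (k : void) : {linear V -> A1^o} by case: k.
  exists void, (fun=> 0), (fun=> 0), f; split; try by case.
  by move=> y; rewrite rmorph0 scale0r big1 // => -[].
- move=> s t [K [e [x [xi [Mx xS xS' E]]]]] [L [e' [x' [xi' [Mx' xS1 xS1' E']]]]].
  pose sm (T : Type) (f : K -> T) (g : L -> T) (k : K + L) :=
    match k with inl k => f k | inr k => g k end.
  exists (K + L)%type, (sm _ e e'), (sm _ x x'), (sm _ xi xi'); split.
  + by case.
  + by case.
  + by case.
  + by move=> y; rewrite big_sumType /= rmorphD scalerDl E E'.
- move=> a s [K [e [x [xi [Mx xS xS' E]]]]].
  exists K, e, (fun k => iota a *: x k), xi; split=> // [k|y]; first exact: latZ.
  rewrite rmorphM -scalerA E scaler_sumr; apply: eq_bigr => k _.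
  by rewrite !scalerA mulrC.
Qed.

(** M_j lies in I^j S', which xi maps into I^(j - e). *)
Lemma lat_linear j e y (xi : {linear V -> A1^o}) : (forall y, smem S' y -> F (- e) (xi y)) ->
  M j y -> F (j - e) (xi y).
Proof.
move=> xiS' [_ My]; have [K [a [b [Fa Fb ->]]]] := fpow_split H j y.
rewrite linear_sum; apply: fpow_sum => k _; rewrite linearZ; apply: fpowM => //.
by apply: xiS'; exact: My.
Qed.

End GDB.

Section Ungraded.
Variable T : gluing iota.
Notation V := (gE1 T).
Notation S := (Esub T).
Notation S' := (E'sub T).
Notation M := (lat I S S').

Variables (K : finType) (e : K -> int) (x : K -> V) (xi : K -> {linear V -> A1^o}).
Hypotheses (Mx : forall k, M (e k) (x k)) (xiS : forall k y, smem S y -> F 0 (xi k y))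
  (xiS' : forall k y, smem S' y -> F (- e k) (xi k y))
  (xE : forall y, y = \sum_k xi k y *: x k).

Lemma subm_lat j (y : subm (lattice I T j)) : M j (subm_val y).
Proof. by apply/(latticeE H); exact: submP. Qed.

(** The degree j part of the dual basis: M_j is generated by the I^(d_k) x_k, where I^(d_k) need not
    be free, so each x_k is split by a partition of 1 for I^(d_k) I^(- d_k). *)
Lemma lattice_fp j : finite_projective (subm (lattice I T j)).
Proof.
(* The part of B in degree j - e_k is I^(d_k), which is A when e_k >= j. *)
pose d k : int := Num.max 0 (j - e k).
have d0 k : 0 <= d k by rewrite /d; lia.
have dj k : j <= d k + e k by rewrite /d; lia.
have /choice[p HL] k : exists p : {L : finType & ((L -> A1) * (L -> A1))%type},
    [/\ forall l, F (d k) ((tagged p).1 l), forall l, F (- d k) ((tagged p).2 l)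
      & \sum_l (tagged p).1 l * (tagged p).2 l = 1].
  by have [L [a [b ?]]] := fpow_unit H (d k); exists (existT _ L (a, b)).
pose L k := tag (p k); pose a k : L k -> A1 := (tagged (p k)).1.
pose b k : L k -> A1 := (tagged (p k)).2.
pose X (kl : {k : K & L k}) := a (tag kl) (tagged kl) *: x (tag kl).
have MX kl : X kl \in in_subm (lattice I T j).
  apply/asboolP/(latticeE H); apply: (lat_le (dj (tag kl))).
  by have [Fa _ _] := HL (tag kl); apply: lat_mul => //; exact: Fa.
pose eta (kl : {k : K & L k}) (y : subm (lattice I T j)) : A^o :=
  aval (b (tag kl) (tagged kl) * xi (tag kl) (subm_val y)).
have etaE kl y : iota (eta kl y) = b (tag kl) (tagged kl) * xi (tag kl) (subm_val y).
  apply: avalE; have [_ Fb _] := HL (tag kl); rewrite -(addNr (d (tag kl))).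
  apply: fpowM; first exact: Fb.
  rewrite /d; case: (Order.TotalTheory.leP 0 (j - e (tag kl))) => _.
    by apply: (lat_linear (@xiS' _)); exact: subm_lat.
  by apply: xiS; have [] := subm_lat y.
have etaD kl y z : eta kl (y + z) = eta kl y + eta kl z.
  by apply: (fpow_inj H); rewrite rmorphD !etaE subm_valD linearD mulrDr.
have etaZ kl c y : eta kl (c *: y) = c *: eta kl y.
  by apply: (fpow_inj H); rewrite rmorphM !etaE subm_valZ linearZ /= mulrCA.
apply: (dual_finite_projective (K := {k : K & L k}) (x := fun kl => Subm (MX kl))
  (xi := fun kl => mklin (eta kl) (etaD kl) (etaZ kl))) => y.
apply: val_inj; rewrite /= subm_val_sum [LHS]xE.
pose G k l := (b k l * xi k (subm_val y)) *: (a k l *: x k).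
transitivity (\sum_k \sum_l G k l).
  apply: eq_bigr => k _; have [_ _ ab] := HL k.
  rewrite -[xi k _]mul1r -ab mulr_suml scaler_suml; apply: eq_bigr => l _.
  by rewrite /G scalerA /a /b; congr (_ *: _); ring.
rewrite sig_big_dep /=; apply: eq_bigr => kl _.
by rewrite /G -etaE.
Qed.
Lemma denomP j y : lattice_denom I T j y <-> exists u w,
  [/\ M (j + 1) u, mulspan [set iota a | a in I] (M (j - 1)) w & y = u + w].
Proof.
by split=> -[u [w Huw]]; exists u, w; rewrite !(latticeP H) in Huw *.
Qed.

Lemma denom_low j w :
  (forall c, F (- 1) c -> M (j - 1) (c *: w)) -> lattice_denom I T j w.
Proof.
move=> Mw; apply/denomP; exists 0, w; split; rewrite ?add0r //; first exact: lat0.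
exact/(mulspan_I H (latm I S S' (j - 1))).
Qed.

Lemma denom_high j u : M (j + 1) u -> lattice_denom I T j u.
Proof.
by move=> Mu; apply/denomP; exists u, 0; split; rewrite ?addr0 //; exact: mulspan0.
Qed.

Lemma denomD j y z :
  lattice_denom I T j y -> lattice_denom I T j z -> lattice_denom I T j (y + z).
Proof.
move=> /denomP[u [w [Mu Mw ->]]] /denomP[u' [w' [Mu' Mw' ->]]]; apply/denomP.
by exists (u + u'), (w + w'); split; [exact: latD | exact: mulspanD | rewrite addrACA].
Qed.

Lemma denom_sum j (L : finType) (P : pred L) (y : L -> V) :
  (forall l, P l -> lattice_denom I T j (y l)) ->
  lattice_denom I T j (\sum_(l | P l) y l).
Proof.
move=> Dy; elim/big_rec: _ => [|k z Pk Dz]; last by apply: denomD => //; exact: Dy.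
by apply: denom_high; exact: lat0.
Qed.

Lemma denom_I j a y : I a -> M j y -> lattice_denom I T j (iota a *: y).
Proof.
move=> Ia My; apply: denom_low => c Fc; rewrite scalerA.
apply: (@lat_le _ _ _ _ _ _ _ j); first by lia.
by apply: lat_fpow0 => //; rewrite -(addNr 1); apply: fpowM => //; apply/(fpow_I H).
Qed.

(** In the expansion of y, terms with e_k > j lie in M_(j+1). Terms with e_k < j have coefficients
    in I^(j - e_k), hence lie in I M_(j-1). *)
Lemma denom_residue j y : M j y ->
  lattice_denom I T j (y - \sum_(k | e k == j) xi k y *: x k).
Proof.
move=> My; rewrite {1}[y]xE (bigID (fun k => e k == j)) /= [X in X - _]addrC addrK.
apply: denom_sum => k ej; have [jlt|ltj] : e k < j \/ j < e k by lia.
  apply: denom_low => c Fc; rewrite scalerA.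
  have -> : j - 1 = (j - e k - 1) + e k by lia.
  apply: lat_mul; [by lia| |exact: Mx].
  by rewrite mulrC; apply: fpowM => //; exact: (lat_linear (@xiS' k) My).
apply: denom_high; apply: (@lat_le _ _ _ _ _ _ _ (e k)); first by lia.
by apply: lat_fpow0 => //; apply: xiS; case: My.
Qed.

(** The converse of [denom_residue]: on M_(j+1) the functional gains one power of I from S', on I
    M_(j-1) from S. *)
Lemma denom_coef j k y : e k = j -> lattice_denom I T j y -> F 1 (xi k y).
Proof.
move=> ej /denomP[u [w [Mu Mw ->]]]; rewrite linearD; apply: fpowD.
  have -> : 1 = (j + 1) - e k by rewrite ej; lia.
  exact: (lat_linear (@xiS' k) Mu).
apply: (@fpow_colon _ _ _ _ H (- 1)) => c Fc; rewrite addNr -[c * _]linearZ.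
by apply: xiS; have /(mulspan_I H (latm I S S' (j - 1)))/(_ _ Fc)[] := Mw.
Qed.

Section Residue.
Variables (R : comPzRingType) (pi : {rmorphism A -> R}).
Hypotheses (pi_surj : forall r, exists a, pi a = r) (pi_ker : forall a, pi a = 0 <-> I a).

(** The quotient map records xi_k(y) modulo I for e_k = j; the two previous lemmas compute its
    kernel. Its image is an R-module because [pi] is onto, and the x_k of degree j give a dual basis
    of it. *)
Lemma lattice_fp_quotient j : finite_projective_quotient pi
  [set y : subm (lattice I T j) | lattice_denom I T j (subm_val y)].
Proof.
pose N := subm (lattice I T j).
have xiA k (y : N) : F 0 (xi k (subm_val y)) by apply: xiS; have [] := subm_lat y.
pose q0 (y : N) : 'cV[R]_#|K| := \col_k
   (if e (enum_val k) == j then pi (aval (xi (enum_val k) (subm_val y))) else 0).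
have avalD u w : F 0 u -> F 0 w -> aval (u + w) = aval u + aval w.
  by move=> Fu Fw; apply: (fpow_inj H); rewrite rmorphD !avalE //; exact: fpowD.
have q0D y z : q0 (y + z) = q0 y + q0 z.
  apply/colP => k; rewrite !mxE; case: ifP => _; rewrite ?addr0 //.
  by rewrite -rmorphD -avalD // subm_valD linearD.
have q0Z a y : q0 (a *: y) = pi a *: q0 y.
  apply/colP => k; rewrite !mxE; case: ifP => _; rewrite ?mulr0 // -rmorphM; congr (pi _).
  apply: (fpow_inj H); rewrite rmorphM !avalE // subm_valZ linearZ //.
have Q0 : range q0 0 by exists 0; rewrite // -[0 in LHS](scale0r 0) q0Z rmorph0 scale0r.
have QD u w : range q0 u -> range q0 w -> range q0 (u + w).
  by move=> [y _ <-] [z _ <-]; exists (y + z).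
have QZ r u : range q0 u -> range q0 ((idfun : {rmorphism R -> R}) r *: u).
  by move=> [y _ <-]; have [a <-] := pi_surj r; exists (a *: y).
pose Q := subm (Submodule Q0 QD QZ).
have q0Q y : q0 y \in in_subm (Submodule Q0 QD QZ) by apply/asboolP; exists y.
pose q y : Q := Subm (q0Q y).
have qD y z : q (y + z) = q y + q z by apply: val_inj; rewrite /= q0D.
have qZ a y : q (a *: y) = pi a *: q y by apply: val_inj; rewrite /= q0Z.
have qker y : q y = 0 <-> lattice_denom I T j (subm_val y).
  split=> [/(congr1 (@subm_val _ _ _ _ _))/= qy|Dy].
    rewrite -[subm_val y](subrK (\sum_(k | e k == j) xi k (subm_val y) *: x k)).
    apply: denomD; first exact/denom_residue/subm_lat.
    apply: denom_sum => k ek; rewrite -(avalE (xiA k y)); apply: denom_I.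
      have /colP/(_ (enum_rank k)) := qy.
      by rewrite !mxE enum_rankK ek => /pi_ker.
    by rewrite -(eqP ek).
  apply: val_inj; apply/colP => k; rewrite !mxE; case: ifP => // /eqP ek.
  have /(fpow1P H)[a Ia ->] := denom_coef ek Dy.
  by rewrite avalK; apply/pi_ker.
exists Q, (mksemilin q qD qZ); split=> //.
  move=> [u uQ]; have /asboolP[y _ yu] := uQ.
  by exists y; apply: val_inj.
(* x_k is an element of M_j when e_k = j; for other k the coordinate [c k] vanishes and the default
   0 is harmless. *)
pose X k : N := if pselect (e k = j) is left ek then
   Subm (introT (asboolP _) (iffRL (latticeE H _ _) (eq_ind _ (fun j => M j (x k)) (Mx k) _ ek)))
   else 0.
pose c k (u : Q) : R^o := subm_val u (enum_rank k) 0.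
have cD k u w : c k (u + w) = c k u + c k w by rewrite /c subm_valD mxE.
have cZ k r u : c k (r *: u) = r *: c k u by rewrite /c subm_valZ mxE.
apply: (dual_finite_projective (K := K) (x := q \o X) (xi := fun k => mklin (c k) (cD k) (cZ k))).
move=> [u uQ]; have /asboolP[y _ yu] := uQ.
have {yu uQ} -> : Subm uQ = q y by apply: val_inj.
have qsum (y' : K -> N) : q (\sum_k y' k) = \sum_k q (y' k).
  exact: (linear_sum (mksemilin q qD qZ)).
have XE k : e k = j -> subm_val (X k) = x k by rewrite /X; case: pselect.
pose y' := \sum_k aval (xi k (subm_val y)) *: X k.
transitivity (q y').
  apply/eqP; rewrite -subr_eq0; apply/eqP.
  have -> : q y - q y' = q (y + (-1) *: y') by rewrite qD qZ rmorphN1 scaleN1r.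
  apply/qker; rewrite subm_valD subm_valZ rmorphN1 scaleN1r.
  have := denom_residue (subm_lat y); congr (lattice_denom _ _ _ (_ - _)).
  rewrite subm_val_sum big_mkcond /=; apply: eq_bigr => k _.
  rewrite ?subm_valZ avalE //; case: eqP => ek; first by rewrite XE.
  by rewrite /X; case: pselect => //= _; rewrite scaler0.
rewrite qsum; apply: eq_bigr => k _; rewrite qZ /= /c /= mxE enum_rankK.
case: eqP => // ek; rewrite /X; case: pselect => // _.
have -> : q 0 = 0 by exact: (linear0 (mksemilin q qD qZ)).
by rewrite !scaler0.
Qed.
End Residue.
End Ungraded.
End GradedDualBasis.

(** * Laurent monomials and images of idempotents *)

Section LaurentMono.
Variable C : comPzRingType.
Implicit Types (f : laurent C).

Definition lmono (j : int) (c : C) : laurent C :=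
  lmk [fset j]%fset (fun i => if i == j then c else 0).

Lemma coef_lmono j c k : coef (lmono j c) k = if k == j then c else 0.
Proof. by apply: lmkE; rewrite in_fset1 => /negbTE ->. Qed.

Lemma coef_lmonoM j c f k : coef (lmono j c * f) k = c * coef f (k - j).
Proof.
rewrite -[_ * f]/(lmul _ _) (@lmulwE _ [fset j]%fset) ?big_seq_fset1 ?coef_lmono ?eqxx //.
exact: finsupp_sub.
Qed.

Lemma lmonoM i a j b : lmono i a * lmono j b = lmono (i + j) (a * b).
Proof.
apply: laurentP => k; rewrite coef_lmonoM !coef_lmono subr_eq [j + i]addrC.
by case: ifP => // _; rewrite mulr0.
Qed.

Lemma lcoef_sum (K : Type) (r : seq K) (P : pred K) (f : K -> laurent C) j :
  coef (\sum_(k <- r | P k) f k) j = \sum_(k <- r | P k) coef (f k) j.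
Proof.
by apply: (big_morph (fun f => coef f j)) => [g h|]; [exact: Defs.coefD | exact: Defs.coef0].
Qed.

Lemma lmonoD j a b : lmono j (a + b) = lmono j a + lmono j b.
Proof.
by apply: laurentP => k; rewrite Defs.coefD !coef_lmono; case: ifP; rewrite ?addr0.
Qed.

Lemma lmono0 j : lmono j 0 = 0.
Proof. by apply: laurentP => k; rewrite Defs.coef0 coef_lmono if_same. Qed.

Lemma lmono_sum j (K : Type) (r : seq K) (P : pred K) (a : K -> C) :
  lmono j (\sum_(k <- r | P k) a k) = \sum_(k <- r | P k) lmono j (a k).
Proof. by apply: (big_morph (lmono j)); [exact: lmonoD | exact: lmono0]. Qed.

Lemma lconst_lmono c : lconst c = lmono 0 c.
Proof. by []. Qed.

Lemma lmonoZ j a c : lmono j (a * c) = lconst a * lmono j c.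
Proof. by rewrite lconst_lmono lmonoM add0r. Qed.

Lemma homog_lmono j c : homog j (lmono j c).
Proof. by move=> k /negbTE kj; rewrite coef_lmono kj. Qed.

Lemma homogE j f : homog j f -> f = lmono j (coef f j).
Proof.
move=> hf; apply: laurentP => k; rewrite coef_lmono.
by case: eqP => [->//|/eqP/hf].
Qed.

Lemma homogM i j f g : homog i f -> homog j g -> homog (i + j) (f * g).
Proof. by move=> /homogE -> /homogE ->; rewrite lmonoM; exact: homog_lmono. Qed.

Lemma homogB j f g : homog j f -> homog j g -> homog j (f - g).
Proof. by move=> hf hg k kj; rewrite Defs.coefD Defs.coefN hf ?hg // subr0. Qed.

Lemma homog0 j : homog j (0 : laurent C).
Proof. by move=> k _; rewrite Defs.coef0. Qed.

Lemma lmono_inj j : injective (lmono j).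
Proof.
by move=> a b /(congr1 (fun f => coef f j)); rewrite !coef_lmono eqxx.
Qed.

End LaurentMono.

Lemma lmap_lmono (C D : comPzRingType) (phi : {rmorphism C -> D}) j c :
  lmap phi (lmono j c) = lmono j (phi c).
Proof.
by apply: laurentP => k; rewrite lmapE !coef_lmono; case: ifP; rewrite ?rmorph0.
Qed.

Lemma lmap_inj (C D : comPzRingType) (phi : {rmorphism C -> D}) :
  injective phi -> injective (lmap phi).
Proof.
by move=> inj f g E; apply: laurentP => k; apply: inj; rewrite -!lmapE E.
Qed.

Section IdemImage.
Variables (C : comPzRingType) (n : nat) (P : 'M[C]_n).

Fact fixed0 : P *m (0 : 'cV_n) = 0. Proof. exact: mulmx0. Qed.
Fact fixedD (u v : 'cV_n) : P *m u = u -> P *m v = v -> P *m (u + v) = u + v.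
Proof. by rewrite mulmxDr => -> ->. Qed.
Fact fixedZ a (u : 'cV_n) : P *m u = u ->
  P *m ((idfun : {rmorphism C -> C}) a *: u) = (idfun : {rmorphism C -> C}) a *: u.
Proof. by rewrite -scalemxAr => ->. Qed.

(* For an idempotent P this is the image of P. *)
Definition fixed_sub : submodule (idfun : {rmorphism C -> C}) 'cV[C]_n :=
  @Submodule _ _ _ _ [set u | P *m u = u] fixed0 fixedD fixedZ.
Definition fixed : lmodType C := subm fixed_sub.

Lemma fixedP (u : fixed) : P *m subm_val u = subm_val u.
Proof. exact: (submP u). Qed.

Definition mkfixed (u : 'cV_n) (Pu : P *m u = u) : fixed :=
  @Subm _ _ _ _ fixed_sub u (introT (asboolP _) Pu).

Hypothesis PP : P *m P = P.

Lemma mul_idem m (u : 'M_(n, m)) : P *m (P *m u) = P *m u.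
Proof. by rewrite mulmxA PP. Qed.

Definition idem_col k : fixed := mkfixed (mul_idem (delta_mx k 0)).

Lemma idem_colE k i : subm_val (idem_col k) i 0 = P i k.
Proof. by rewrite /= -colE mxE. Qed.

Lemma fixed_col (u : fixed) : u = \sum_k subm_val u k 0 *: idem_col k.
Proof.
apply: val_inj; rewrite /= subm_val_sum; apply/colP => i.
rewrite -{1}(fixedP u) mxE summxE; apply: eq_bigr => k _.
by rewrite subm_valZ [RHS]mxE idem_colE mulrC.
Qed.

Lemma fixed_fp : finite_projective fixed.
Proof.
pose c k (u : fixed) : C^o := subm_val u k 0.
have cD k u v : c k (u + v) = c k u + c k v by rewrite /c subm_valD mxE.
have cZ k a u : c k (a *: u) = a *: c k u by rewrite /c subm_valZ mxE.
apply: (dual_finite_projective (x := idem_col) (xi := fun k => mklin (c k) (cD k) (cZ k))) => u.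
exact: fixed_col.
Qed.
End IdemImage.

Section FixedMap.
Variables (C D : comPzRingType) (phi : {rmorphism C -> D}) (n : nat).
Variables (P : 'M[C]_n) (Q : 'M[D]_n).
Hypothesis PQ : map_mx phi P = Q.

Fact fixed_map_subproof (u : fixed P) : Q *m map_mx phi (subm_val u) = map_mx phi (subm_val u).
Proof. by rewrite -PQ -map_mxM fixedP. Qed.
Definition fixed_mapf (u : fixed P) : fixed Q := mkfixed (fixed_map_subproof u).
Fact fixed_mapD u v : fixed_mapf (u + v) = fixed_mapf u + fixed_mapf v.
Proof. by apply: val_inj; rewrite /= map_mxD. Qed.
Fact fixed_mapZ a u : fixed_mapf (a *: u) = phi a *: fixed_mapf u.
Proof. by apply: val_inj; rewrite /= map_mxZ. Qed.
Definition fixed_map := mksemilin fixed_mapf fixed_mapD fixed_mapZ.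

Lemma fixed_mapE u : subm_val (fixed_map u) = map_mx phi (subm_val u).
Proof. by []. Qed.

Hypothesis PP : P *m P = P.

(** The columns of P generate its image with the coordinates as coefficients, and they map to the
    columns of Q. *)
Lemma fixed_map_bc : base_change fixed_map.
Proof.
have QQ : Q *m Q = Q by rewrite -PQ -map_mxM PP.
move=> W h; pose k0 (u : fixed Q) : W := \sum_l subm_val u l 0 *: h (idem_col PP l).
have k0D u v : k0 (u + v) = k0 u + k0 v.
  by rewrite /k0 -big_split; apply: eq_bigr => l _; rewrite subm_valD mxE scalerDl.
have k0Z a u : k0 (a *: u) = a *: k0 u.
  by rewrite /k0 scaler_sumr; apply: eq_bigr => l _; rewrite subm_valZ mxE scalerA.
split.
  exists (mklin k0 k0D k0Z) => u /=; rewrite {2}(fixed_col PP u) linear_sum.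
  by apply: eq_bigr => l _; rewrite linearZ /= mxE.
move=> k1 k2 E u; rewrite (fixed_col QQ u) !linear_sum; apply: eq_bigr => l _.
rewrite !linearZ; congr (_ *: _).
have -> : idem_col QQ l = fixed_map (idem_col PP l); last exact: E.
by apply: val_inj; apply/colP => i; rewrite idem_colE mxE idem_colE -PQ mxE.
Qed.
End FixedMap.

Lemma deg0_sum (D : comPzRingType) (homD : int -> set D) (N : Type)
    (grN : int -> set N) (P : lmodType D) (rho : N -> P) (K : Type) (r : seq K) (p : K -> P) :
  (forall k, deg0 homD grN rho (p k)) -> deg0 homD grN rho (\sum_(k <- r) p k).
Proof.
by move=> Dp; elim/big_rec: _ => [|k x _ Dx]; [exact: deg0_0 | exact: deg0_D].
Qed.

(** * From a graded dual basis to a vector bundle on Re(A,v) *)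

Section ReesMono.
Variables (C : comPzRingType) (G : filtration C).

Fact rees_mono_subproof j c (Gc : G j c) : lmono j c \in in_rees G.
Proof.
apply/asboolP => i; rewrite coef_lmono; case: eqP => [->|_] //; exact: fil0.
Qed.
Definition rees_mono j c (Gc : G j c) : rees G := Rees (rees_mono_subproof Gc).

Lemma rees_coef (b : rees G) j : G j (coef (rees_val b) j).
Proof. by case: b => f bf; have /asboolP := bf; apply. Qed.

Lemma rees_val_sum (K : Type) (r : seq K) (P : pred K) (x : K -> rees G) :
  rees_val (\sum_(k <- r | P k) x k) = \sum_(k <- r | P k) rees_val (x k).
Proof. exact: (raddf_sum (@rees_val C G)). Qed.
End ReesMono.

Section BuildModule.
Variables (A A1 : comPzRingType) (iota : {rmorphism A -> A1}) (I : set A).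
Hypothesis H : invertible_ideal iota I.
Notation F := (fpow iota I).
Notation ringB := (rees (tpow_fil I)).
Variable V : lmodType A1.
Variables (n : nat) (e : 'I_n -> int) (x : 'I_n -> V) (xi : 'I_n -> {linear V -> A1^o}).
Hypothesis xi_x : forall i k, F 0 (xi i (x k)) /\ F (e k - e i) (xi i (x k)).
Hypothesis xE : forall y, y = \sum_k xi k y *: x k.

Let p i k := aval iota (xi i (x k)).
Let pE i k : iota (p i k) = xi i (x k). Proof. by apply: (@avalE _ _ _ I); case: (xi_x i k). Qed.

Lemma xi_idem i y : \sum_k xi i (x k) * xi k y = xi i y.
Proof.
rewrite [in RHS](xE y) linear_sum; apply: eq_bigr => k _.
by rewrite linearZ mulrC.
Qed.

Fact pB_subproof i k : tpow_fil I (e k - e i) (p i k).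
Proof. by apply/(fpow_tpow H); rewrite pE; case: (xi_x i k). Qed.
(** The idempotent xi_i(x_k) of the dual basis. An entry lies in A and in I^(e_k - e_i), hence in
    the part of B of that degree. *)
Definition pB : 'M[ringB]_n := \matrix_(i, k) rees_mono (pB_subproof i k).

Lemma pB_val i k : rees_val (pB i k) = lmono (e k - e i) (p i k).
Proof. by rewrite mxE. Qed.

Lemma pB_idem : pB *m pB = pB.
Proof.
apply/matrixP => i l; apply: val_inj => /=; rewrite mxE pB_val rees_val_sum.
under eq_bigr => k _ do rewrite rmorphM /= !pB_val lmonoM addrC addrA subrK.
rewrite -lmono_sum; congr lmono; apply: (fpow_inj H).
by rewrite rmorph_sum pE -(xi_idem i); apply: eq_bigr => k _; rewrite rmorphM !pE.
Qed.

Notation N := (fixed pB).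
Notation fval u := (@subm_val _ _ _ 'cV[_]_n _ u).

(** The i-th basis vector of the ambient free module has degree e_i. *)
Definition grN_set (j : int) : set N :=
  [set u | forall i, homog (j - e i) (rees_val (fval u i 0))].

Fact grN0 j : grN_set j 0.
Proof. by move=> i; rewrite mxE; exact: homog0. Qed.
Fact grNB j u w : grN_set j u -> grN_set j w -> grN_set j (u - w).
Proof.
move=> hu hw i; rewrite -[- w]scaleN1r subm_valD subm_valZ !mxE rmorphN1 mulN1r.
exact: homogB.
Qed.
Fact grN_act i j b u :
  @rees_homog _ (tpow_fil I) i b -> grN_set j u -> grN_set (i + j) (b *: u).
Proof.
move=> hb hu l; rewrite subm_valZ mxE rmorphM -addrA; apply: homogM => //.
Qed.

Fact grN_comp_subproof j (u : N) i : tpow_fil I (j - e i) (coef (rees_val (fval u i 0)) (j - e i)).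
Proof. exact: rees_coef. Qed.
Definition grN_comp j (u : N) : 'cV[ringB]_n := \col_i rees_mono (grN_comp_subproof j u i).

(** The entries of [pB] are homogeneous, so multiplication by it respects the shifted degrees. *)
Lemma grN_comp_fixed j u : pB *m grN_comp j u = grN_comp j u.
Proof.
apply/colP => i; apply: val_inj => /=; rewrite [in RHS]mxE mxE rees_val_sum.
under eq_bigr => k _ do rewrite rmorphM /= pB_val mxE /= lmonoM.
rewrite /= -{2}(fixedP u) mxE rees_val_sum lcoef_sum lmono_sum; apply: eq_bigr => k _.
rewrite rmorphM /= pB_val coef_lmonoM.
by congr (lmono _ (_ * coef _ _)); lia.
Qed.

Fact grN_sum u : exists (s : {fset int}) (c : int -> N),
  (forall j, grN_set j (c j)) /\ u = \sum_(j <- s) c j.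
Proof.
pose h i := rees_val (fval u i 0).
pose r := [seq (k + e i)%R | i <- enum 'I_n, k <- finsupp (h i)].
pose s : {fset int} := [fset k in r]%fset.
exists s, (fun j => mkfixed (grN_comp_fixed j u)); split.
  by move=> j i; rewrite /= !mxE; exact: homog_lmono.
apply: val_inj; rewrite /= subm_val_sum; apply/colP => i; apply: val_inj => /=.
rewrite summxE rees_val_sum /=.
under eq_bigr => j _ do rewrite mxE.
apply: laurentP => k; rewrite lcoef_sum /= -/(h i).
have [ks|ks] := boolP (k + e i \in s).
  rewrite (big_fsetD1 (k + e i)) //= coef_lmono addrK eqxx big_seq big1 ?addr0 // => j.
  rewrite in_fsetD1 => /andP[jk _]; rewrite coef_lmono; case: eqP => // E.
  by rewrite E subrK eqxx in jk.
rewrite coef_out; last first.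
  apply: contra ks => kh; rewrite /s in_fset /r /=.
  by apply/allpairsPdep; exists i, k; rewrite mem_enum.
rewrite big_seq big1 // => j js; rewrite coef_lmono; case: eqP => // E.
by rewrite E subrK js in ks.
Qed.

Fact grN_direct (s : {fset int}) (c : int -> N) :
  (forall j, grN_set j (c j)) -> \sum_(j <- s) c j = 0 ->
  forall j, j \in s -> c j = 0.
Proof.
move=> hc c0 j js; apply: val_inj; apply/colP => i; apply: val_inj.
rewrite /= [in RHS]mxE (homogE (hc j i)).
have := congr1 (fun u : N => coef (rees_val (fval u i 0)) (j - e i)) c0.
rewrite /= subm_val_sum summxE rees_val_sum lcoef_sum (big_fsetD1 j) //=.
rewrite big_seq big1 ?addr0.
  by move=> ->; rewrite mxE Defs.coef0 lmono0.
move=> k; rewrite in_fsetD1 => /andP[kj _]; apply: hc.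
by apply: contra kj => /eqP/addIr ->.
Qed.

Definition grN : grading N := Grading grN0 grNB grN_act grN_sum grN_direct.

Lemma idem_col_homog k : grN (e k) (idem_col pB_idem k).
Proof. by move=> i; rewrite idem_colE pB_val; exact: homog_lmono. Qed.

(* The restriction to the two loci at once: D is A[t, t^-1] or B', seen inside *)
(* A1[t, t^-1], and U is E or E', seen inside V.                               *)
Section Locus.
Variables (D : comPzRingType) (emb : {rmorphism D -> laurent A1}).
Variables (toD : {rmorphism ringB -> D}) (chi : {rmorphism A -> D}).
Variables (homD : int -> set D) (G : int -> set A1).
Hypotheses (valI : injective emb)
  (val_toD : forall b, emb (toD b) = toA1t iota I b)
  (val_chi : forall a, emb (chi a) = lconst (iota a))
  (homDE : forall j d, homD j d <-> homog j (emb d))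
  (GE : forall j c, G j c <-> exists d, emb d = lmono j c).
Variables (U : lmodType A) (g : {linear U -> V | iota \; *:%R}).
Hypotheses (gI : injective g)
  (gxi : forall k u, G (- e k) (xi k (g u)))
  (gx : forall k c, G (- e k) c -> exists u, g u = c *: x k).

Let Q := map_mx toD pB.
Let Q1 := map_mx (toA1t iota I : {rmorphism ringB -> laurent A1}) pB.

Lemma map_Q : map_mx emb Q = Q1.
Proof. by apply/matrixP => i k; rewrite !mxE. Qed.

Lemma Q1E i k : Q1 i k = lmono (e k - e i) (xi i (x k)).
Proof. by rewrite mxE /= /toA1t /toAt /= pB_val lmap_lmono pE. Qed.

(** This puts y in degree 0, given the shifts by e_i. *)
Definition coords (y : V) : 'cV[laurent A1]_n := \col_i lmono (- e i) (xi i y).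

Lemma coords_fixed y : Q1 *m coords y = coords y.
Proof.
apply/colP => i; rewrite !mxE.
under eq_bigr => k _ do rewrite Q1E mxE lmonoM.
rewrite -(xi_idem i y) lmono_sum; apply: eq_bigr => k _.
by congr (lmono _ _); lia.
Qed.

Definition b1f (y : V) : fixed Q1 := mkfixed (coords_fixed y).

Lemma b1fD y z : b1f (y + z) = b1f y + b1f z.
Proof.
by apply: val_inj; apply/colP => i; rewrite /= !mxE linearD lmonoD.
Qed.
Lemma b1fZ a y : b1f (a *: y) = lconst a *: b1f y.
Proof.
by apply: val_inj; apply/colP => i; rewrite /= !mxE linearZ lmonoZ.
Qed.

Definition b1map := mksemilin (phi := @lconst A1) b1f b1fD b1fZ.

Definition rmap := fixed_map (erefl Q).
Definition smap := fixed_map map_Q.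

(** A degree 0 element has coordinates c_i in degree - e_i with c_i in [G (- e i)]; the vector
    \sum_i c_i x_i comes from U and gives the element back. Conversely u in U is the combination of
    the generators of degree e_k with coefficients xi_k(u) in degree - e_k. *)
Lemma locus_restriction : exists a : {linear U -> fixed Q | chi \; *:%R},
  [/\ injective a, range a = deg0 homD grN rmap & forall u, b1map (g u) = smap (a u)].
Proof.
have /choice[d dE] (ku : 'I_n * U) : exists d, emb d = lmono (- e ku.1) (xi ku.1 (g ku.2)).
  by apply/GE.
pose a0 u : 'cV[D]_n := \col_k d (k, u).
have a0E u : map_mx emb (a0 u) = coords (g u).
  by apply/colP => k; rewrite !mxE dE.
have mapI m (M1 M2 : 'M[D]_(n, m)) : map_mx emb M1 = map_mx emb M2 -> M1 = M2.
  by move=> /matrixP E; apply/matrixP => i k; apply: valI; have := E i k; rewrite !mxE.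
have a0_fixed u : Q *m a0 u = a0 u.
  by apply: mapI; rewrite map_mxM map_Q a0E coords_fixed.
pose a u : fixed Q := mkfixed (a0_fixed u).
have aD u w : a (u + w) = a u + a w.
  apply: val_inj; apply: mapI; rewrite /= map_mxD !a0E.
  by apply/colP => i; rewrite !mxE !linearD lmonoD.
have aZ c u : a (c *: u) = chi c *: a u.
  apply: val_inj; apply: mapI; rewrite /= map_mxZ val_chi !a0E.
  by apply/colP => i; rewrite !mxE !linearZ lmonoZ.
exists (mksemilin a aD aZ); split => [u w /(congr1 (fun v => map_mx emb (fval v)))||u] /=.
- rewrite !a0E => E; apply: gI; rewrite [LHS]xE [RHS]xE; apply: eq_bigr => k _.
  congr (_ *: _); have /colP/(_ k) := E; rewrite !mxE; exact: lmono_inj.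
- apply/seteqP; split=> [_ [u _ <-]|w].
    have -> : a u = \sum_k d (k, u) *: rmap (idem_col pB_idem k).
      apply: val_inj; rewrite /= subm_val_sum; apply/colP => i.
      rewrite -{1}a0_fixed mxE summxE; apply: eq_bigr => k _.
      rewrite subm_valZ [RHS]mxE fixed_mapE [in RHS]mxE idem_colE [a0 u k 0]mxE.
      by rewrite [Q i k]mxE mulrC.
    apply: deg0_sum => k; apply: (@deg0_M _ _ _ _ _ _ (e k)); last exact: idem_col_homog.
    by apply/homDE; rewrite dE; exact: homog_lmono.
  (* Once the coordinates of w are known to be homogeneous, each is a single monomial, and the
     element of U can be read off. *)
  suff hom : deg0 homD grN rmap w -> forall i, homog (- e i) (emb (fval w i 0)).
    move=> /hom hw; pose al i := coef (emb (fval w i 0)) (- e i).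
    have wE i : emb (fval w i 0) = lmono (- e i) (al i) by exact: homogE.
    have /choice[u uE] i : exists u, g u = al i *: x i by apply: gx; apply/GE; exists (fval w i 0).
    exists (\sum_i u i) => //; apply: val_inj; apply: mapI; rewrite /= a0E.
    apply/colP => k; rewrite !mxE wE; congr (lmono _ _).
    apply: (@lmono_inj _ (- e k)); rewrite -wE -(fixedP w) mxE rmorph_sum !linear_sum lmono_sum.
    apply: eq_bigr => i _; rewrite uE linearZ rmorphM wE.
    have := Q1E k i; rewrite -map_Q mxE => ->; rewrite lmonoM mulrC.
    by congr (lmono _ _); lia.
  elim=> [i|u v _ hu _ hv i|j c u hc hu i].
  - by rewrite mxE rmorph0; exact: homog0.
  - rewrite subm_valD mxE rmorphD -[X in _ + X]opprK; apply: homogB => //.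
    by rewrite -sub0r; apply: homogB => //; exact: homog0.
  - rewrite subm_valZ mxE rmorphM fixed_mapE mxE val_toD.
    have -> : - e i = - j + (j - e i) by lia.
    apply: homogM; first exact/homDE.
    by rewrite /toA1t /toAt /= (homogE (hu i)) lmap_lmono; exact: homog_lmono.
- by apply: val_inj; rewrite /= a0E.
Qed.
End Locus.
End BuildModule.

Lemma gdb_ord (A A1 : comPzRingType) (iota : {rmorphism A -> A1}) (I : set A)
    (V : lmodType A1) (S S' : submodule iota V) (s : A) :
  gdb I S S' s -> exists n (e : 'I_n -> int) (x : 'I_n -> V) (xi : 'I_n -> {linear V -> A1^o}),
  [/\ forall k, lat I S S' (e k) (x k), forall k y, smem S y -> fpow iota I 0 (xi k y),
      forall k y, smem S' y -> fpow iota I (- e k) (xi k y)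
    & forall y, iota s *: y = \sum_k xi k y *: x k].
Proof.
move=> [K [e [x [xi [Mx xS xS' E]]]]].
exists #|K|, (e \o enum_val), (x \o enum_val), (xi \o enum_val); split=> [k|k|k|y] /=.
- exact: Mx.
- exact: xS.
- exact: xS'.
- by rewrite E (reindex (@enum_val K predT)) //=; exact: onW_bij (enum_val_bij K).
Qed.

Section GDBtoImage.
Variables (A A1 : comPzRingType) (iota : {rmorphism A -> A1}) (I : set A).
Hypothesis H : invertible_ideal iota I.
Notation F := (fpow iota I).
Variable T : gluing iota.

(** [locus_restriction] is applied twice: to A[t, t^-1], whose coefficients lie in A in every
    degree, with S; and to B', whose coefficients in degree j lie in I^j, with S'. *)
Lemma gdb_essential_image : gdb I (Esub T) (E'sub T) 1 -> in_essential_image I T.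
Proof.
move=> /gdb_ord[n [e [x [xi [Mx xiS xiS' E]]]]].
have xE y : y = \sum_k xi k y *: x k by rewrite -E rmorph1 scale1r.
have xi_x i k : F 0 (xi i (x k)) /\ F (e k - e i) (xi i (x k)).
  split; first by apply: xiS; have [] := Mx k.
  exact: (lat_linear H (@xiS' i) (Mx k)).
have [Psi [PhiK PsiK]] := Phi_inv T.
pose g1 := gloc T.
pose g2f (u : gE' T) := Psi (gloc' T u).
have g2D u w : g2f (u + w) = g2f u + g2f w by rewrite /g2f !linearD.
have g2Z a u : g2f (a *: u) = iota a *: g2f u by rewrite /g2f !linearZ.
pose g2 := mksemilin g2f g2D g2Z.
have GE1 j c : F 0 c <-> exists d, lmap iota d = lmono j c.
  split=> [/fpow_iota[b ->]|[d /(congr1 (fun f => coef f j))]].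
    by exists (lmono j b); rewrite lmap_lmono.
  by rewrite lmapE coef_lmono eqxx => <-; exact: fpow_iota_in.
have GE2 j c : F j c <-> exists d, B'toA1t iota I d = lmono j c.
  split=> [Fc|[d dE]]; first by exists (@rees_mono A1 (fpow_fil iota I) j c Fc).
  have := rees_coef d j; rewrite -[rees_val d]/(B'toA1t iota I d) dE coef_lmono eqxx //.
have hom1 j d : homog j d <-> homog j (lmap iota d).
  split=> hd k kj; first by rewrite lmapE hd // rmorph0.
  by apply: (fpow_inj H); rewrite -lmapE hd // rmorph0.
have gxi1 k (u : gE T) : F 0 (xi k (gloc T u)) by apply: xiS; exists u.
have gx1 k c : F 0 c -> exists u, gloc T u = c *: x k.
  move=> Fc; have [Sx _] := Mx k.
  by have [u _ uE] := @subm_fpow0 _ _ _ I _ (Esub T) _ _ Fc Sx; exists u.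
have gxi2 k u : F (- e k) (xi k (g2 u)) by apply: xiS'; exists u; rewrite PsiK.
have gx2 k c : F (- e k) c -> exists u, g2 u = c *: x k.
  move=> Fc; have [_ S'x] := Mx k; have [u uE] := S'x _ Fc.
  by exists u; rewrite /= /g2f -uE PhiK.
have g2I : injective g2.
  by move=> u w /(congr1 (gPhi T)); rewrite /= /g2f !PsiK => /(gloc'_inj H).
have emb2I : injective (B'toA1t iota I) by exact: val_inj.
have toD1 b : lmap iota (toAt I b) = toA1t iota I b by [].
have toD2 b : B'toA1t iota I (toB' iota I b) = toA1t iota I b by [].
have chi1 a : lmap iota (lconst a) = lconst (iota a) by exact: lmap_lmono.
have chi2 a : B'toA1t iota I (AtoB' iota I a) = lconst (iota a) by [].
have hom2 j d : @rees_homog _ (fpow_fil iota I) j d <-> homog j (B'toA1t iota I d) by [].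
have [a1 [a1I a1R a1b]] := locus_restriction H xi_x xE
  (lmap_inj (fpow_inj H)) toD1 chi1 hom1 GE1 (@gloc_inj _ _ _ _ H T) gxi1 gx1.
have [a2 [a2I a2R a2b]] := locus_restriction H xi_x xE
  emb2I toD2 chi2 hom2 GE2 g2I gxi2 gx2.
pose b1 := b1map H xi_x xE.
pose b2f u := b1 (Psi u).
have b2D u w : b2f (u + w) = b2f u + b2f w by rewrite /b2f !linearD.
have b2Z a u : b2f (a *: u) = lconst a *: b2f u by rewrite /b2f !linearZ.
exists (fixed (pB H xi_x)), (grN H xi_x); split.
  exact: (fixed_fp (pB_idem H xi_x xE)).
pose mB := pB H xi_x.
exists (fixed (map_mx (toAt I) mB)), (fixed (map_mx (toB' iota I) mB)),
  (fixed (map_mx (toA1t iota I) mB)), (rmap H xi_x (toAt I)), (rmap H xi_x (toB' iota I)),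
  (rmap H xi_x (toA1t iota I)), (smap H xi_x toD1), (smap H xi_x toD2),
  a1, a2, b1, (mksemilin (phi := @lconst A1) b2f b2D b2Z).
split=> //.
- by split; apply: fixed_map_bc; exact: pB_idem.
- by split=> u; apply: val_inj; rewrite /= -map_mx_comp; apply/matrixP => i k; rewrite !mxE.
- split=> [u|u|y]; first exact: a1b.
    by rewrite -a2b.
  by rewrite -[RHS]/(b1 y) -[y in RHS]PhiK.
Qed.
End GDBtoImage.

(** * From a vector bundle on Re(A,v) to a graded dual basis *)

Section GradedProjective.
Variables (C : comPzRingType) (G : filtration C) (N : lmodType (rees G)) (grN : grading N).

Definition rees_comp (j : int) (b : rees G) : rees G := rees_mono (rees_coef b j).

Lemma rees_comp_sum (W : {fset int}) (d : int) (b : rees G) :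
  (forall i, i \in finsupp (rees_val b) -> i + d \in W) ->
  b = \sum_(j <- W) rees_comp (j - d) b.
Proof.
move=> bW; apply: val_inj; rewrite /= rees_val_sum; apply: laurentP => k.
rewrite lcoef_sum; have [kW|kW] := boolP (k + d \in W).
  rewrite (big_fsetD1 (k + d)) //= coef_lmono addrK eqxx big_seq big1 ?addr0 // => j.
  rewrite in_fsetD1 => /andP[jk _]; rewrite coef_lmono; case: eqP => // E.
  by rewrite E subrK eqxx in jk.
rewrite coef_out; last by apply: contra kW; exact: bW.
rewrite big_seq big1 // => j js; rewrite coef_lmono; case: eqP => // E.
by rewrite E subrK js in kW.
Qed.

Lemma gr_sum_closed j (K : Type) (r : seq K) (y : K -> N) :
  (forall k, grN j (y k)) -> grN j (\sum_(k <- r) y k).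
Proof.
move=> gy; elim/big_rec: _ => [|k x _ gx]; first exact: gr0.
rewrite -[x]opprK; apply: grB => //; rewrite -[- x]sub0r.
by apply: grB => //; exact: gr0.
Qed.

(** The homogeneous components of the members of any dual basis are taken as generators, each
    keeping the functional of its parent. On homogeneous y, comparing degrees shows that the
    components of the functionals of matching degree suffice. *)
Lemma graded_dual_basis : finite_projective N ->
  exists (K : finType) (e : K -> int) (x : K -> N) (xi : K -> {linear N -> (rees G)^o}),
  [/\ forall k, grN (e k) (x k), forall y, y = \sum_k xi k y *: x k
    & forall j y, grN j y -> y = \sum_k rees_comp (j - e k) (xi k y) *: x k].
Proof.
move=> /finite_projective_dual[r [y0 [eta Ey]]].
have /choice[s sP] l := gr_sum grN (y0 l).
have /choice[c {}sP] l := sP l.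
pose K : finType := {l : 'I_r & s l}.
pose e (k : K) : int := \val (tagged k); pose x (k : K) := c (tag k) (e k).
pose xi (k : K) := eta (tag k).
have gx k : grN (e k) (x k) by have [] := sP (tag k).
have xE y : y = \sum_k xi k y *: x k.
  rewrite {1}[y]Ey; transitivity (\sum_l \sum_(j : s l) eta l y *: c l (val j)).
    apply: eq_bigr => l _; have [_ ->] := sP l.
    by rewrite big_seq_fsetE scaler_sumr.
  by rewrite sig_big_dep.
exists K, e, x, xi; split=> // j y gy.
pose r' := j :: [seq (i + e k)%R | k <- enum K, i <- finsupp (rees_val (xi k y))].
pose W : {fset int} := [fset d in r']%fset.
have WP k i : i \in finsupp (rees_val (xi k y)) -> i + e k \in W.
  move=> iy; rewrite /W in_fset inE; apply/orP; right.
  by apply/allpairsPdep; exists k, i; rewrite mem_enum.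
pose z d := \sum_k rees_comp (d - e k) (xi k y) *: x k.
have gz d : grN d (z d).
  apply: gr_sum_closed => k; rewrite -[d in grN d](subrK (e k)); apply: gr_act => //.
  exact: homog_lmono.
have zE : \sum_(d <- W) z d = y.
  rewrite exchange_big /= [RHS]xE; apply: eq_bigr => k _.
  by rewrite -scaler_suml -rees_comp_sum // => i; exact: WP.
(* The differences [z' d] are homogeneous of distinct degrees and sum to 0 over [W], so each
   vanishes. *)
pose z' d := z d - (if d == j then y else 0).
have jW : j \in W by rewrite /W in_fset inE eqxx.
have z0 : z' j = 0.
  apply: (gr_direct (g := grN) (s := W)) => //.
    by move=> d; apply: grB => //; case: eqP => [->|_] //; exact: gr0.
  rewrite sumrB zE; apply/eqP; rewrite subr_eq0; apply/eqP.
  rewrite (big_fsetD1 j) //= eqxx big_seq big1 ?addr0 // => d.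
  by rewrite in_fsetD1 => /andP[/negbTE ->].
by apply/esym/eqP; rewrite -subr_eq0; move: z0; rewrite /z' eqxx => ->.
Qed.
End GradedProjective.

Lemma base_change_functional (C D : comPzRingType) (phi : {rmorphism C -> D})
    (N : lmodType C) (P : lmodType D) (rho : {linear N -> P | phi \; *:%R})
    (xi : {linear N -> C^o}) : base_change rho ->
  exists xi1 : {linear P -> D^o}, forall y, xi1 (rho y) = phi (xi y).
Proof.
move=> bc; pose h y : D^o := phi (xi y).
have hD y z : h (y + z) = h y + h z by rewrite /h linearD rmorphD.
have hZ a y : h (a *: y) = phi a *: h y by rewrite /h linearZ rmorphM.
by have [[k kE] _] := bc _ (mksemilin h hD hZ); exists k.
Qed.

Section ImageToGDB.
Variables (A A1 : comPzRingType) (iota : {rmorphism A -> A1}) (I : set A).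
Hypothesis H : invertible_ideal iota I.
Notation F := (fpow iota I).
Variable T : gluing iota.

(** Over A[t, t^-1] every homogeneous generator can be moved to degree 0 by a power of t, where it
    becomes a vector of E; over B' its multiples by I^(- e_k) in degree - e_k land in E'. These are
    the two memberships defining M_(e_k). *)
Lemma essential_image_gdb : in_essential_image I T -> gdb I (Esub T) (E'sub T) 1.
Proof.
move=> [N [grN [fpN]]]; have [K [e [x [xi [gx xE xgr]]]]] := graded_dual_basis grN fpN.
move=> [P1 [P2 [P12 [r1 [r2 [r12 [s1 [s2 [a1 [a2 [b1 [b2 [[bc1 bc2 bc12]]]]]]]]]]]]]].
move=> [s1r s2r] [a1I a1R] [a2I a2R] [b1g b2g b2Phi].
have /choice[xi1 xi1E] k := base_change_functional (xi k) bc1.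
have /choice[xi2 xi2E] k := base_change_functional (xi k) bc2.
have /choice[xi12 xi12E] k := base_change_functional (xi k) bc12.
have xi12s1 k p : xi12 k (s1 p) = lmap iota (xi1 k p).
  elim: (base_change_span bc1 p) => [|u v _ fu _ fv|c _ _ [y _ <-]].
  - by rewrite !linear0 rmorph0.
  - by rewrite !linearD rmorphD fu fv.
  - rewrite [s1 _]linearZ [LHS]linearZ [xi1 _ _]linearZ rmorphM /= s1r xi12E xi1E.
    by [].
have xi12s2 k p : xi12 k (s2 p) = B'toA1t iota I (xi2 k p).
  elim: (base_change_span bc2 p) => [|u v _ fu _ fv|c _ _ [y _ <-]].
  - by rewrite !linear0 rmorph0.
  - by rewrite !linearD rmorphD fu fv.
  - rewrite [s2 _]linearZ [LHS]linearZ [xi2 _ _]linearZ rmorphM /= s2r xi12E xi2E.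
    by [].
have s1I p : s1 p = 0 -> p = 0.
  move=> sp; have pE q : q = \sum_k xi1 k q *: r1 (x k).
    elim: (base_change_span bc1 q) => [|u v _ {1}-> _ {1}->|c _ _ [y _ <-]].
    - by rewrite big1 // => k _; rewrite linear0 scale0r.
    - by rewrite -big_split; apply: eq_bigr => k _; rewrite linearD scalerDl.
    - rewrite {1}[y]xE linear_sum scaler_sumr; apply: eq_bigr => k _.
      by rewrite [r1 (_ *: _)]linearZ [xi1 k _]linearZ /= xi1E; exact: scalerA.
  rewrite [p]pE big1 // => k _; have -> : xi1 k p = 0; last by rewrite scale0r.
  by apply: (lmap_inj (fpow_inj H)); rewrite -xi12s1 sp linear0 rmorph0.
have b1I y z : b1 y = b1 z -> y = z.
  move=> byz; apply/eqP; rewrite -subr_eq0; apply/eqP.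
  have {byz} : b1 (y - z) = 0 by rewrite linearB byz subrr.
  move: (y - z) => {y}{}z bz.
  (* Multiples of z by I^n lie in E, where [a1] and [s1] are injective; I^n I^(-n) = A recovers
     z. *)
  have [n nz] := dualizable_absorb H (fun _ : unit => z) (dualizable_E I T).
  have [L [c [d [Fc Fd ->]]]] := fpow_split H (- n%:Z) z.
  rewrite big1 // => l _; have [|u _ uE] := nz tt (d l); first by rewrite -[n%:Z]opprK.
  rewrite /= in uE; rewrite -uE (_ : u = 0) ?linear0 ?scaler0 //.
  apply: a1I; rewrite linear0; apply: s1I.
  by rewrite -b1g uE linearZ /= bz scaler0.
have b2I y z : b2 y = b2 z -> y = z.
  have [Psi [PhiK PsiK]] := Phi_inv T.
  by rewrite -[y]PsiK -[z]PsiK !b2Phi => /b1I ->.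
have /choice[X XE] k : exists u, a1 u = lmono (- e k) 1 *: r1 (x k).
  have : deg0 (@homog A) grN r1 (lmono (- e k) 1 *: r1 (x k)).
    by apply: deg0_M (gx k); exact: homog_lmono.
  by rewrite -a1R => -[u _ <-]; exists u.
have b1X k : b1 (gloc T (X k)) = lmono (- e k) 1 *: r12 (x k).
  by rewrite b1g XE [LHS]linearZ /= lmap_lmono rmorph1 s1r.
(* The functional need not be homogeneous; on elements of degree 0 only its component of degree -
   e_k is kept. *)
pose Xi k (y : gE1 T) : A1^o := coef (xi12 k (b1 y)) (- e k).
have XiD k y z : Xi k (y + z) = Xi k y + Xi k z by rewrite /Xi !linearD Defs.coefD.
have XiZ k a y : Xi k (a *: y) = a *: Xi k y.
  rewrite /Xi [b1 _]linearZ /= [xi12 _ _]linearZ lconst_lmono [LHS]coef_lmonoM subr0.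
  by [].
exists K, e, (fun k => gloc T (X k)), (fun k => mklin (Xi k) (XiD k) (XiZ k)).
split=> [k|k _ [u _ <-]|k y [e' yE]|y] /=.
- split; first by exists (X k).
  move=> c Fc; have : deg0 (@rees_homog A1 _) grN r2
      (@rees_mono A1 (fpow_fil iota I) (- e k) c Fc *: r2 (x k)).
    by apply: deg0_M (gx k); exact: homog_lmono.
  rewrite -a2R => -[e' _ e'E]; exists e'; apply: b2I.
  rewrite b2Phi [LHS]linearZ /= b1X b2g e'E [RHS]linearZ /= s2r scalerA.
  by rewrite lconst_lmono lmonoM add0r mulr1.
- by rewrite /Xi b1g xi12s1 lmapE; exact: fpow_iota_in.
- rewrite /Xi -b2Phi yE b2g xi12s2; exact: rees_coef.
rewrite rmorph1 scale1r.
elim: (base_change_span (@gloc_bc _ _ _ T) y) => [|u v _ {1}-> _ {1}->|a _ _ [u _ <-]].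
- by rewrite big1 // => k _; rewrite /Xi !linear0 Defs.coef0 scale0r.
- by rewrite -big_split; apply: eq_bigr => k _; rewrite XiD scalerDl.
suff {1}-> : gloc T u = \sum_k Xi k (gloc T u) *: gloc T (X k).
  by rewrite scaler_sumr; apply: eq_bigr => k _; rewrite XiZ scalerA.
apply: b1I; rewrite linear_sum.
under eq_bigr => k _ do rewrite linearZ /= b1X scalerA -lmonoZ mulr1 /Xi b1g.
(* Elements of E are the degree 0 part of the restriction, so the identity may be checked on
   products c *: r1 z with z homogeneous, where the homogeneous expansion of z applies. *)
rewrite b1g; have : range a1 (a1 u) by exists u.
rewrite a1R; elim=> [|p q _ hp _ hq|j c z hc gz].
- by rewrite linear0 big1 // => k _; rewrite linear0 Defs.coef0 lmono0 scale0r.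
- rewrite linearD {1}hp {1}hq -big_split; apply: eq_bigr => k _.
  by rewrite linearD Defs.coefD lmonoD scalerDl.
rewrite [s1 _]linearZ /= s1r (homogE hc) lmap_lmono {1}(xgr _ _ gz) linear_sum scaler_sumr.
apply: eq_bigr => k _; rewrite [r12 (_ *: _)]linearZ [xi12 k _]linearZ /= xi12E scalerA.
rewrite /toA1t /toAt /= lmap_lmono lmonoM coef_lmonoM lmapE opprK.
by congr (lmono _ (_ * iota (coef _ _)) *: _); lia.
Qed.
End ImageToGDB.

(** * From local diagonal form to a graded dual basis *)

Section Zpow.
Variables (C : comPzRingType) (z w : C).
Hypothesis zw : z * w = 1.

Lemma zpowVn n : z ^+ n * w ^+ n = 1.
Proof. by rewrite -exprMn zw expr1n. Qed.

Lemma zpow_opp e : zpow z w e * zpow z w (- e) = 1.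
Proof.
case: e => [[|n]|n]; first exact: mulr1; first exact: (zpowVn n.+1).
by rewrite mulrC; exact: (zpowVn n.+1).
Qed.
End Zpow.

Section LocalComparison.
Variables (A A1 : comPzRingType) (iota : {rmorphism A -> A1}) (I : set A).
Hypothesis H : invertible_ideal iota I.
Notation F := (fpow iota I).
Variables (f : A) (Af : comPzRingType) (phi : {rmorphism A -> Af}).
Hypothesis phif : is_complement [set f] phi.
Variables (Af1 : comPzRingType) (psi : {rmorphism Af -> Af1}) (phi1 : {rmorphism A1 -> Af1}).
Hypotheses (psiI : is_complement [set phi x | x in I] psi)
  (phi1E : forall x, phi1 (iota x) = psi (phi x)).
Variables (z : Af) (w : Af1).
Hypotheses (Iz : ideal_gen [set phi x | x in I] = ideal_gen [set z])
  (zw : psi z * w = 1).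
Notation zp := (zpow (psi z) w).

Lemma gen_z u : ideal_gen [set z] u -> exists c, u = c * z.
Proof.
apply: (@ideal_gen_min _ _ [set u | exists c, u = c * z]);
  last by move=> _ ->; exists 1; rewrite mul1r.
split=> [|x y [c ->] [d ->]|a x [c ->]].
- by exists 0; rewrite mul0r.
- by exists (c + d); rewrite mulrDl.
- by exists (a * c); rewrite mulrA.
Qed.

Lemma phi_I a : I a -> exists c, phi a = c * z.
Proof. by move=> Ia; apply: gen_z; rewrite -Iz; apply: ideal_gen_sub; exists a. Qed.

(** After clearing denominators, an element killed by z is killed by I up to a power of f, and I is
    invertible. *)
Lemma z_regular y : z * y = 0 -> y = 0.
Proof.
move=> zy; have [c [y' yE]] := basic_frac phif y.
have [_ _ [p [a [v [Ia _ av]]]] _] := H.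
have [n fn] : exists n, forall k, f ^+ n * (a k * y') = 0.
  apply: (@pow_uniform _ _ _ (fun k s => s * (a k * y') = 0)) => [k s t E|k].
    by rewrite -mulrA E mulr0.
  apply: (basic_ker phif); rewrite rmorphM -yE.
  have [d ->] := phi_I (Ia k).
  transitivity (d * phi (f ^+ c) * (z * y)); first by ring.
  by rewrite zy mulr0.
have fy : f ^+ n * y' = 0.
  apply: (fpow_inj H); rewrite rmorph0 -[iota _]mulr1 -av mulr_sumr big1 // => k _.
  by rewrite mulrA -rmorphM -mulrA [y' * _]mulrC fn rmorph0 mul0r.
have [u fu] := basic_powunit phif (n + c).
have Ey : phi (f ^+ (n + c)) * y = 0 by rewrite exprD rmorphM -mulrA yE -rmorphM fy rmorph0.
by rewrite -[y]mul1r -fu mulrAC Ey mul0r.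
Qed.

Lemma psi_inj : injective psi.
Proof.
move=> x y E; apply/eqP; rewrite -subr_eq0; apply/eqP.
have {E} : psi (x - y) = 0 by rewrite rmorphB E subrr.
move: (x - y) => {x}{}y psy.
have [|n] := @complement_ker _ _ _ _ psiI z y _ psy.
  by rewrite Iz; exact: ideal_gen_sub.
by elim: n => [|n IHn]; rewrite ?mul1r // exprS -mulrA => /z_regular.
Qed.

(** A[1/I] -> Af[1/I] behaves as the localization at f: this and the next lemma bring statements
    over D(f) back to A at the cost of a power of f. *)
Lemma phi1_ker x : phi1 x = 0 -> exists n, iota (f ^+ n) * x = 0.
Proof.
move=> px; have [m Fx] := fpow_frac H x.
have [K [a [b [Fa Fb ab]]]] := fpow_unit H m%:Z.
have /choice[u uE] k : exists u, a k * x = iota u.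
  by apply/(fpow_iota iota I); rewrite -(subrr m%:Z); exact: fpowM.
have [n fn] : exists n, forall k, f ^+ n * u k = 0.
  apply: (@pow_uniform _ _ _ (fun k s => s * u k = 0)) => [k s t E|k].
    by rewrite -mulrA E mulr0.
  apply: (basic_ker phif); apply: psi_inj.
  by rewrite -phi1E -uE rmorphM px mulr0 rmorph0.
exists n; rewrite -[x]mul1r -ab mulr_suml mulr_sumr big1 // => k _.
by rewrite mulrAC uE mulrA -rmorphM fn rmorph0 mul0r.
Qed.

Lemma phi1_frac x y : phi1 x = psi y -> exists n, F 0 (iota (f ^+ n) * x).
Proof.
move=> pxy; have [n [a aE]] := basic_frac phif y.
have [|m E] := @phi1_ker (iota (f ^+ n) * x - iota a).
  by rewrite rmorphB rmorphM !phi1E pxy -rmorphM aE subrr.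
exists (m + n)%N; apply/fpow_iota; exists (f ^+ m * a).
by apply/eqP; rewrite -subr_eq0 exprD !rmorphM -mulrA -mulrBr E.
Qed.

Lemma phi1_frac_fin (K : finType) (x : K -> A1) :
  (forall k, exists y, phi1 (x k) = psi y) -> exists n, forall k, F 0 (iota (f ^+ n) * x k).
Proof.
move=> xP; apply: (@pow_uniform _ _ _ (fun k s => F 0 (iota s * x k))) => [k s t E|k].
  by rewrite rmorphM -mulrA; apply: fpowZ.
by have [y] := xP k; exact: phi1_frac.
Qed.

Lemma phi_ideal_pow n b : ideal_pow I n b -> exists c, phi b = z ^+ n * c.
Proof.
elim: n b => [|n IHn] b /=; first by exists (phi b); rewrite mul1r.
elim=> [|x y _ [c E] _ [d E']|c s Ic /IHn[d E]].
- by exists 0; rewrite rmorph0 mulr0.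
- by exists (c + d); rewrite rmorphD mulrDr E E'.
- have [c' E'] := phi_I Ic; exists (c' * d).
  by rewrite -[c *: s]/(c * s) rmorphM E E' exprS; ring.
Qed.

(** Over Af the fractional ideal I^j becomes z^j Af. For j < 0, multiply by z once at a time,
    writing z as a combination of elements of I. *)
Lemma phi1_fpow j x : F j x -> exists y, phi1 x = zp j * psi y.
Proof.
case: j => n.
  move=> [b Ib ->]; have [c E] := phi_ideal_pow Ib.
  by exists c; rewrite phi1E E rmorphM rmorphXn.
suff zn : forall x, F (- n.+1%:Z) x -> exists y, psi (z ^+ n.+1) * phi1 x = psi y.
  move=> /zn[y E]; exists y; rewrite -E mulrA rmorphXn /=.
  by rewrite [w ^+ _ * _]mulrC zpowVn // mul1r.
elim: n.+1 => {n x} [|n IHn] x Fx.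
  have /fpow_iota[b ->] : F 0 x by [].
  by exists (phi b); rewrite rmorph1 mul1r.
have : ideal_gen [set phi x | x in I] z by rewrite Iz; exact: ideal_gen_sub.
move=> zI; rewrite exprSr rmorphM -mulrA.
suff H' u : ideal_gen [set phi x | x in I] u -> exists y, psi (z ^+ n) * (psi u * phi1 x) = psi y.
  exact: H'.
move: u {zI}; apply: ideal_gen_min => [|_ [d Id <-]].
  split=> [|u v [y E] [y' E']|u v [y E]] /=.
  - by exists 0; rewrite !rmorph0 mul0r mulr0.
  - by exists (y + y'); rewrite !rmorphD mulrDl mulrDr E E'.
  - by exists (u * y); rewrite !rmorphM -mulrA mulrCA E.
have [|y E] := IHn (iota d * x).
  have -> : - n%:Z = 1 - n.+1%:Z by lia.
  by apply: fpowM => //; exact: fpow_I.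
by exists y; rewrite -E rmorphM phi1E.
Qed.

Section BaseChangedModule.
Variables (E : lmodType A) (n : nat) (a : {linear E -> 'cV[Af]_n | phi \; *:%R}).
Hypothesis (Efp : finite_projective E) (abc : base_change a).

Lemma basic_bc_ker u : a u = 0 -> exists c, f ^+ c *: u = 0.
Proof.
move=> au; have [r [y [eta Ey]]] := finite_projective_dual Efp.
have /choice[eta1 eta1E] l := base_change_functional (eta l) abc.
have [c fc] : exists c, forall l, f ^+ c * eta l u = 0.
  apply: (@pow_uniform _ _ _ (fun l s => s * eta l u = 0)) => [l s t Es|l].
    by rewrite -mulrA Es mulr0.
  by apply: (basic_ker phif); rewrite -eta1E au linear0.
exists c; rewrite [u]Ey scaler_sumr big1 // => l _.
by rewrite scalerA fc scale0r.
Qed.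

Lemma basic_bc_frac q : exists c u, phi (f ^+ c) *: q = a u.
Proof.
elim: (base_change_span abc q) => [|u v _ [c [x Ex]] _ [d [y Ey]]|b _ _ [x _ <-]].
- by exists 0, 0; rewrite linear0 scaler0.
- exists (c + d)%N, (f ^+ d *: x + f ^+ c *: y).
  by rewrite [RHS]linearD 2!linearZ /= -Ex -Ey scalerDr !scalerA -!rmorphM -!exprD [(d + c)%N]addnC.
- have [c [b' Eb]] := basic_frac phif b.
  by exists c, (b' *: x); rewrite scalerA Eb linearZ.
Qed.
End BaseChangedModule.
End LocalComparison.

Lemma functionalZ (C : comPzRingType) (V : lmodType C) (xi : {linear V -> C^o}) a y :
  xi (a *: y) = a * xi y.
Proof. exact: linearZ. Qed.

Lemma linear_scaled (C : comPzRingType) (V : lmodType C) (xi : {linear V -> C^o}) (a : C) :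
  exists xi' : {linear V -> C^o}, forall y, xi' y = a * xi y :> C.
Proof.
pose g y : C^o := a * xi y.
have gD y z : g (y + z) = g y + g z by rewrite /g linearD mulrDr.
have gZ b y : g (b *: y) = b *: g y by rewrite /g linearZ /= mulrCA.
by exists (mklin g gD gZ).
Qed.

Section DiagonalToGDB.
Variables (A A1 : comPzRingType) (iota : {rmorphism A -> A1}) (I : set A).
Hypothesis H : invertible_ideal iota I.
Notation F := (fpow iota I).
Variable T : gluing iota.
Notation S := (Esub T).
Notation S' := (E'sub T).

(** Over D(f), S' is the sum of the z^(- e_i) Af, so the standard basis has degrees e_i and, with
    its coordinates, is a graded dual basis. It remains to clear denominators. *)
Lemma diagonal_gdb (f : A) (Af : comPzRingType) (phi : {rmorphism A -> Af}) :
  is_complement [set f] phi -> diagonal_over I T phi -> exists c, gdb I S S' (f ^+ c).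
Proof.
move=> phif [Af1 [psi [phi1 [z [w [n [e [a [a' [b [b' [[psiI phi1E] [Iz zw]]]]]]]]]]]]].
move=> _ [abc a'bc] [bE b'E b'Phi].
pose zp := zpow (psi z) w.
have psiinj := psi_inj H phif psiI Iz.
have ffrac := phi1_frac_fin H phif psiI phi1E Iz.
(* Exponents of f are collected in turn: [c0] for the basis vectors, [c1] for the coordinates, [c2]
   for the dual basis identity, [c3] for I^(- e_i) x_i in S', [c4] for xi_i(S') in I^(- e_i). *)
have [c0 /choice[x xE]] : exists c, forall i : 'I_n, exists u, a u = phi (f ^+ c) *: delta_mx i 0.
  apply: (@pow_uniform _ _ _ (fun i s => exists u, a u = phi s *: delta_mx i 0)) => [i s t [u E]|i].
    by exists (t *: u); rewrite linearZ /= E scalerA -rmorphM.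
  by have [c [u E]] := basic_bc_frac phif abc (delta_mx i 0); exists c, u.
have [r [y [eta [eta1 [Ey eta1E Ey1]]]]] := base_change_dual (gE_fp T) (@gloc_bc _ _ _ T).
have [c1 [al alE]] := basic_frac_fin phif (fun il : 'I_n * 'I_r => a (y il.2) il.1 0).
have /choice[Xi XiE] i : exists X : {linear gE1 T -> A1^o},
    forall v, X v = \sum_l iota (al (i, l)) * eta1 l v.
  pose g v : A1^o := \sum_l iota (al (i, l)) * eta1 l v.
  have gD u v : g (u + v) = g u + g v.
    by rewrite /g -big_split; apply: eq_bigr => l _; rewrite linearD mulrDr.
  have gZ d v : g (d *: v) = d *: g v.
    by rewrite /g scaler_sumr; apply: eq_bigr => l _; rewrite linearZ /= mulrCA.
  by exists (mklin g gD gZ).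
have phi1Xi i v : phi1 (Xi i v) = psi (phi (f ^+ c1)) * b v i 0.
  rewrite {2}[v]Ey1 linear_sum summxE XiE rmorph_sum mulr_sumr; apply: eq_bigr => l _.
  rewrite linearZ mxE bE mxE rmorphM phi1E -(alE (i, l)) rmorphM /=; ring.
have XiS i u : F 0 (Xi i (gloc T u)).
  by rewrite XiE; apply: fpow_sum => l _; rewrite eta1E -rmorphM; exact: fpow_iota_in.
have [c2 c2E] : exists c2, forall v,
    iota (f ^+ (c2 + (c1 + c0))) *: v = \sum_i (iota (f ^+ c2) * Xi i v) *: gloc T (x i).
  have [c2 c2E] : exists c2, forall l : 'I_r,
      iota (f ^+ c2) *: (iota (f ^+ (c1 + c0)) *: gloc T (y l)) =
      iota (f ^+ c2) *: \sum_i Xi i (gloc T (y l)) *: gloc T (x i).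
    apply: (@pow_uniform _ _ _ (fun l s => iota s *: (iota (f ^+ (c1 + c0)) *: gloc T (y l)) =
      iota s *: \sum_i Xi i (gloc T (y l)) *: gloc T (x i))) => [l s t E|l].
      by rewrite rmorphM -!scalerA E.
    have /choice[t tE] i : exists t, Xi i (gloc T (y l)) = iota t.
      by apply/(fpow_iota iota I); exact: XiS.
    have [|c cE] := basic_bc_ker phif (gE_fp T) abc
        (u := f ^+ (c1 + c0) *: y l - \sum_i t i *: x i).
      rewrite linearB linear_sum; apply/eqP; rewrite subr_eq0; apply/eqP/colP => k.
      rewrite linearZ mxE summxE (bigD1 k) //= big1 ?addr0.
        rewrite linearZ xE !mxE !eqxx mulr1 /= exprD rmorphM.
        have -> : phi (t k) = phi (f ^+ c1) * a (y l) k 0.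
          by apply: psiinj; rewrite -phi1E -tE phi1Xi bE mxE rmorphM.
        by ring.
      by move=> i /negbTE ik; rewrite linearZ xE !mxE eq_sym ik /= !mulr0.
    exists c; apply/eqP; rewrite -subr_eq0 -scalerBr; apply/eqP.
    rewrite -[RHS](linear0 (gloc T)) -cE [RHS]linearZ /=; congr (_ *: _).
    rewrite [RHS]linearB [gloc T (_ *: y l)]linearZ [in RHS]linear_sum /=; congr (_ - _).
    by apply: eq_bigr => i _; rewrite [RHS]linearZ /= tE.
  exists c2 => v; rewrite {1}[v]Ey1 scaler_sumr.
  under eq_bigr => l _ do rewrite exprD rmorphM scalerA mulrC -!scalerA c2E.
  transitivity (\sum_l \sum_i (eta1 l v * iota (f ^+ c2) * Xi i (gloc T (y l))) *: gloc T (x i)).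
    by apply: eq_bigr => l _; rewrite scalerA scaler_sumr; apply: eq_bigr => i _; rewrite scalerA.
  rewrite exchange_big; apply: eq_bigr => i _; rewrite -scaler_suml; congr (_ *: _).
  rewrite {2}[v]Ey1 linear_sum mulr_sumr; apply: eq_bigr => l _.
  by rewrite functionalZ; ring.
have b'ker v : b' v = 0 -> exists c, iota (f ^+ c) *: v = 0.
  move=> bv; have [Psi [PhiK PsiK]] := Phi_inv T.
  have [m Hm] := dualizable_absorb H (fun _ : unit => Psi v) (dualizable_E' I T).
  have [K [d [h [Fd Fh E]]]] := fpow_split H (- m%:Z) v.
  have /choice[u uE] k : exists u, h k *: v = gloc' T u.
    have [|u uE] := Hm tt (h k); first by rewrite -[m%:Z]opprK.
    by exists u; rewrite -uE linearZ /= PsiK.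
  have [c cE] : exists c, forall k, f ^+ c *: u k = 0.
    apply: (@pow_uniform _ _ _ (fun k s => s *: u k = 0)) => [k s t Es|k].
      by rewrite -scalerA Es scaler0.
    apply: (basic_bc_ker phif (gE'_fp T) a'bc); apply/colP => i; apply: psiinj.
    have := b'E (u k); rewrite -uE linearZ /= bv scaler0 => /colP/(_ i).
    by rewrite !mxE => <-; rewrite rmorph0.
  exists c; rewrite E scaler_sumr big1 // => k _.
  by rewrite uE scalerA mulrC -scalerA -[iota _ *: _]linearZ cE linear0 scaler0.
have S'loc v : (exists q, b' (gPhi T v) = map_mx psi q) -> exists c, smem S' (iota (f ^+ c) *: v).
  move=> [q qE]; have [c [u uE]] := basic_bc_frac phif a'bc q.
  have [|d dE] := b'ker (gPhi T (iota (f ^+ c) *: v) - gloc' T u).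
    rewrite linearB [gPhi T _]linearZ linearZ /= qE b'E -uE map_mxZ -phi1E.
    by rewrite subrr.
  exists (d + c)%N, (f ^+ d *: u); rewrite exprD rmorphM -scalerA [LHS]linearZ [RHS]linearZ /=.
  by apply/eqP; rewrite -subr_eq0 -scalerBr dE.
(* The partition of 1 for I^(e_i) I^(- e_i) reduces the last two conditions to finitely many
   elements. *)
have /choice[p pP] i : exists p : {L : finType & ((L -> A1) * (L -> A1))%type},
    [/\ forall l, F (e i) ((tagged p).1 l), forall l, F (- e i) ((tagged p).2 l)
      & \sum_l (tagged p).1 l * (tagged p).2 l = 1].
  by have [L [d [h ?]]] := fpow_unit H (e i); exists (existT _ L (d, h)).
have [c3 c3E] : exists c, forall k : {i : 'I_n & tag (p i)},
    smem S' (iota (f ^+ c) *: ((tagged (p (tag k))).2 (tagged k) *: gloc T (x (tag k)))).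
  apply: (@pow_uniform _ _ _ (fun k s =>
    smem S' (iota s *: ((tagged (p (tag k))).2 (tagged k) *: gloc T (x (tag k)))))) =>
    [k s t E|[i l] /=].
    by rewrite rmorphM -scalerA; exact: smemZ.
  apply: S'loc; have [_ Fh _] := pP i.
  have [q qE] := phi1_fpow H phi1E Iz zw (Fh l).
  exists ((q * phi (f ^+ c0)) *: delta_mx i 0).
  rewrite b'Phi linearZ bE xE /= qE; apply/colP => k.
  rewrite mul_diag_mx !mxE !mulr_natr; case: eqP => [->|_];
    rewrite /= ?mulr0n ?mulr1n ?rmorph0 ?mulr0 //.
  by rewrite mulrA mulrA zpow_opp // mul1r rmorphM.
have [s [y' [eta' [S'y' eta'S' Ey']]]] := dualizable_E' I T.
have [c4 c4E] : exists c, forall k : {i : 'I_n & tag (p i)} * 'I_s,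
    F 0 (iota (f ^+ c) * ((tagged (p (tag k.1))).1 (tagged k.1) * Xi (tag k.1) (y' k.2))).
  apply: ffrac => -[[i l] m] /=; have [Fd _ _] := pP i.
  have [q qE] := phi1_fpow H phi1E Iz zw (Fd l).
  have [u uE] := S'y' m; have := b'E u; rewrite -uE b'Phi => /colP/(_ i).
  rewrite mul_diag_mx !mxE => E; exists (q * phi (f ^+ c1) * a' u i 0).
  by rewrite rmorphM qE phi1Xi !rmorphM -E; ring.
have /choice[xi xiE] i := linear_scaled (Xi i) (iota (f ^+ (c4 + c2))).
exists (c4 + c3 + (c2 + (c1 + c0)))%N, 'I_n, e, (fun i => iota (f ^+ c3) *: gloc T (x i)), xi.
split=> [i|i _ [u _ <-]|i v S'v|v] /=.
- split; first by exists (f ^+ c3 *: x i); rewrite // linearZ.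
  move=> d Fd; have [Fg Fh gh] := pP i; rewrite -[d]mulr1 -gh mulr_sumr scaler_suml.
  apply: subm_sum => l _; rewrite scalerA.
  have -> : d * ((tagged (p i)).1 l * (tagged (p i)).2 l) * iota (f ^+ c3) =
    (d * (tagged (p i)).1 l) * (iota (f ^+ c3) * (tagged (p i)).2 l) by ring.
  rewrite -scalerA; apply: (@subm_fpow0 _ _ iota I).
    by rewrite -(addNr (e i)); apply: fpowM.
  by rewrite -scalerA; exact: (c3E (existT _ i l)).
- by apply/(fpow_iota iota I); rewrite xiE; apply/(fpow_iota iota I); apply: fpowZ; exact: XiS.
- rewrite xiE [v]Ey' linear_sum mulr_sumr; apply: fpow_sum => m _.
  rewrite functionalZ mulrCA -[- e i]add0r; apply: fpowM; first exact: eta'S'.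
  have [Fg Fh gh] := pP i; rewrite -[_ * _]mul1r -gh mulr_suml; apply: fpow_sum => l _.
  rewrite exprD rmorphM.
  have -> : (tagged (p i)).1 l * (tagged (p i)).2 l *
     (iota (f ^+ c4) * iota (f ^+ c2) * Xi i (y' m)) =
     iota (f ^+ c2) * ((iota (f ^+ c4) * ((tagged (p i)).1 l * Xi i (y' m))) *
       (tagged (p i)).2 l) by ring.
  apply: fpowZ; rewrite -[- e i]add0r; apply: fpowM => //.
  exact: (c4E (existT _ i l, m)).
- rewrite exprD rmorphM -scalerA c2E scaler_sumr; apply: eq_bigr => i _.
  by rewrite !scalerA xiE !exprD !rmorphM; congr (_ *: _); ring.
Qed.

Lemma zariski_diagonal_gdb : zariski_locally (diagonal_over I T) -> gdb I S S' 1.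
Proof.
move=> [m [f [f1 fP]]]; apply: (ideal_gen_pow1 (gdb_ideal I S S') _ f1) => _ [k _ <-].
by have [Af [phi [phif dia]]] := fP k; exact: diagonal_gdb dia.
Qed.
End DiagonalToGDB.

(** * Adapted bases at a prime *)

Section LocallyFree.
Variables (C : comPzRingType) (M : lmodType C) (m : set C).
Hypothesis pm : is_prime m.

Lemma linear_comb (K : finType) (c : K -> C) (xi : K -> {linear M -> C^o}) :
  exists xi' : {linear M -> C^o}, forall y, xi' y = \sum_k c k * xi k y.
Proof.
pose g y : C^o := \sum_k c k * xi k y.
have gD y z : g (y + z) = g y + g z.
  by rewrite /g -big_split; apply: eq_bigr => k _; rewrite linearD mulrDr.
have gZ b y : g (b *: y) = b *: g y.
  by rewrite /g scaler_sumr; apply: eq_bigr => k _; rewrite functionalZ mulrCA.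
by exists (mklin g gD gZ).
Qed.

(** The matrix P of the xi_i(x_k) has determinant outside m, and s xi = P xi by the dual basis
    identity. Replacing xi by s adj(P) xi therefore makes the pairing exactly diagonal, with s' = s
    det P. *)
Lemma dual_normalize_ord (s : C) n (x : 'I_n -> M) (xi : 'I_n -> {linear M -> C^o}) :
  ~ m s -> (forall y, s *: y = \sum_k xi k y *: x k) ->
  (forall i k, m (xi i (x k) - s *+ (i == k))) ->
  exists (s' : C) (xi' : 'I_n -> {linear M -> C^o}),
  [/\ ~ m s', forall y, s' *: y = \sum_k xi' k y *: x k
    & forall i k, xi' i (x k) = s' *+ (i == k)].
Proof.
move=> Ns E mP; pose P := \matrix_(i, k) (xi i (x k) : C).
have NP : ~ m (\det P) by apply: (prime_det pm Ns) => i k; rewrite mxE.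
have /choice[xi' xi'E] i := linear_comb (fun l => s * (\adj P) i l) xi.
have sxi i y : s * xi i y = \sum_k P i k * xi k y.
  rewrite -functionalZ E linear_sum; apply: eq_bigr => k _.
  by rewrite functionalZ mulrC mxE.
have det_comb i (g : 'I_n -> C) : \sum_l (\adj P) i l * (\sum_k P l k * g k) = \det P * g i.
  have := congr1 (fun B : 'M_n => (B *m \col_k g k) i 0) (mul_adj_mx P).
  rewrite /= -mulmxA mul_scalar_mx !mxE => <-; apply: eq_bigr => l _; congr (_ * _).
  by rewrite mxE; apply: eq_bigr => k _; rewrite !mxE.
exists (s * \det P), xi'; split=> [|y|i k].
- exact: prime_notM.
- rewrite mulrC -scalerA E scaler_sumr; apply: eq_bigr => i _; rewrite scalerA; congr (_ *: _).
  rewrite xi'E; have /= <- := det_comb i (fun k => xi k y).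
  by apply: eq_bigr => l _; rewrite -sxi; ring.
- rewrite xi'E -mulrnAr -[in RHS](mulr_natr (\det P)).
  have /= <- := det_comb i (fun q => (q == k)%:R); rewrite mulr_sumr.
  apply: eq_bigr => l _; rewrite -mulrA; congr (_ * (_ * _)).
  rewrite (bigD1 k) //= eqxx mulr1 big1 ?addr0 ?mxE // => q /negbTE qk.
  by rewrite qk mulr0.
Qed.

(* A dual basis of s with as few elements as possible is free away from m: a *)
(* nonzero entry mod m of the relation matrix would eliminate one generator. *)
Lemma dual_locally_free n (s : C) (x : 'I_n -> M) (xi : 'I_n -> {linear M -> C^o}) :
  ~ m s -> (forall y, s *: y = \sum_k xi k y *: x k) ->
  exists n' (s' : C) (x' : 'I_n' -> M) (xi' : 'I_n' -> {linear M -> C^o}),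
  [/\ ~ m s', forall y, s' *: y = \sum_k xi' k y *: x' k
    & forall i k, xi' i (x' k) = s' *+ (i == k)].
Proof.
elim: n s x xi => [|n IHn] s x xi Ns E.
  have [|s' [xi' H]] := dual_normalize_ord Ns E; first by case.
  by exists 0, s', x, xi'.
have [all_m|] := pselect (forall i k, m (xi i (x k) - s *+ (i == k))).
  have [s' [xi' H]] := dual_normalize_ord Ns E all_m.
  by exists n.+1, s', x, xi'.
move=> /existsNP[i /existsNP[k Nu]].
pose u l := xi l (x k) - s *+ (l == k).
have rel : \sum_l u l *: x l = 0.
  under eq_bigr => l _ do rewrite scalerBl.
  rewrite sumrB -E (bigD1 k) //= eqxx big1 ?addr0 ?subrr // => l /negbTE ->.
  by rewrite scale0r.
have /choice[xi' xi'E] (l : 'I_n) : exists xi' : {linear M -> C^o}, forall y,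
    xi' y = u i * xi (lift i l) y - u (lift i l) * xi i y.
  have [g gE] := linear_comb (fun b : bool => if b then u i else - u (lift i l))
                   (fun b => if b then xi (lift i l) else xi i).
  by exists g => y; rewrite gE big_bool /= mulNr.
apply: (IHn (u i * s) (fun l => x (lift i l)) xi'); first exact: prime_notM.
move=> y; rewrite -scalerA E scaler_sumr (bigD1_ord i) //=.
under [RHS]eq_bigr => l _ do rewrite
  xi'E scalerBl -scalerA [u (lift i l) * _]mulrC -[(xi i y * _) *: _]scalerA.
rewrite sumrB -scaler_sumr addrC; congr (_ + _).
have := rel; rewrite (bigD1_ord i) //= => /eqP; rewrite addr_eq0 => /eqP ux.
by rewrite scalerA mulrC -scalerA ux scalerN scaler_sumr.
Qed.

Lemma finite_projective_locally_free : finite_projective M ->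
  exists n (s : C) (x : 'I_n -> M) (xi : 'I_n -> {linear M -> C^o}),
  [/\ ~ m s, forall y, s *: y = \sum_k xi k y *: x k
    & forall i k, xi i (x k) = s *+ (i == k)].
Proof.
move=> /finite_projective_dual[n [x [xi E]]]; apply: (@dual_locally_free n 1 x xi).
  by case: pm.
by move=> y; rewrite scale1r.
Qed.

Lemma dual_normalize (K : finType) (s : C) (x : K -> M) (xi : K -> {linear M -> C^o}) :
  ~ m s -> (forall y, s *: y = \sum_k xi k y *: x k) ->
  (forall i k, m (xi i (x k) - s *+ (i == k))) ->
  exists (s' : C) (xi' : K -> {linear M -> C^o}),
  [/\ ~ m s', forall y, s' *: y = \sum_k xi' k y *: x k
    & forall i k, xi' i (x k) = s' *+ (i == k)].
Proof.
move=> Ns E mP.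
have [|i k|s' [xi' [Ns' E' del]]] :=
    @dual_normalize_ord s #|K| (x \o enum_val) (xi \o enum_val) Ns.
- by move=> y; rewrite E (reindex (@enum_val K predT)) //=; exact: onW_bij (enum_val_bij K).
- by rewrite /= -(inj_eq enum_val_inj); exact: mP.
exists s', (xi' \o enum_rank); split=> // [y|i k] /=.
  rewrite E' [RHS](reindex (@enum_val K predT)) /=; last exact: onW_bij (enum_val_bij K).
  by apply: eq_bigr => i _; rewrite enum_valK.
by have := del (enum_rank i) (enum_rank k); rewrite /= enum_rankK (inj_eq enum_rank_inj).
Qed.
End LocallyFree.

Section AdaptedBasis.
Variables (A A1 : comPzRingType) (iota : {rmorphism A -> A1}) (I : set A).
Hypothesis H : invertible_ideal iota I.
Notation F := (fpow iota I).
Variable T : gluing iota.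
Notation V := (gE1 T).
Notation S := (Esub T).
Notation S' := (E'sub T).
Notation M := (lat I S S').

(* Over D(f): the x k form a basis of E with dual basis xi k / f, the        *)
(* z0^(- e k) *: x k form a basis of Phi^-1(E'), and z0 generates I.          *)
Definition adapted (f : A) := exists (K : finType) (e : K -> int) (x : K -> V)
    (xi : K -> {linear V -> A1^o}),
  [/\ [/\ forall k, M (e k) (x k), forall k y, smem S y -> F 0 (xi k y),
      forall k y, smem S' y -> F (- e k) (xi k y)
    & forall y, iota f *: y = \sum_k xi k y *: x k],
    forall i k, xi i (x k) = iota f *+ (i == k)
  & exists2 z0, I z0 & forall a, I a -> exists b, f * a = b * z0].

Lemma adapted_gdb f : adapted f -> gdb I S S' f.
Proof. by move=> [K [e [x [xi [? _ _]]]]]; exists K, e, x, xi. Qed.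

Variable m : set A.
Hypothesis pm : is_prime m.
Let im : is_ideal m. Proof. by case: pm. Qed.

Lemma glocE y : smem S y -> exists u, gloc T u = y.
Proof. by case=> u _ <-; exists u. Qed.

(** For z0 in I outside m, inverting z0 makes both lattices equal to V, so a basis of E near m is
    adapted with all degrees 0. *)
Lemma adapted_away : ~ (I `<=` m) -> exists2 f, ~ m f & adapted f.
Proof.
move=> /existsNP[z0 /not_implyP[Iz Nz]].
have [n [s [x [xi [Ns E del]]]]] := finite_projective_locally_free pm (gE_fp T).
have /choice[Xi XiE] k := base_change_functional (xi k) (@gloc_bc _ _ _ T).
have [p Hp] := dualizable_absorb H (fun k => gloc T (x k)) (dualizable_E' I T).
have [q Hq] := dualizable_absorb_subm H (dualizable_E I T) (dualizable_E' I T).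
(* z0^r moves the vectors into S' and makes the functionals integral on S'. The extra 1 makes f
   divisible by z0. *)
pose r := (p + q).+1.
have Fr (i : nat) : (i <= r)%N -> F i%:Z (iota (z0 ^+ r)).
  move=> ir; apply: (@fpow_le _ _ _ _ r); first by lia.
  apply/(fpow_tpow H) => /=; elim: (r) => [//|j IHj].
  by rewrite exprS; apply: (@mulspanZ A A^o).
have Fp : F p%:Z (iota (z0 ^+ r)) by apply: Fr; rewrite /r; lia.
have Fq : F q%:Z (iota (z0 ^+ r)) by apply: Fr; rewrite /r; lia.
have /choice[Xi' Xi'E] k := linear_scaled (Xi k) (iota (z0 ^+ r)).
exists (s * (z0 ^+ r * z0 ^+ r)).
  by apply: prime_notM => //; apply: prime_notM => //; apply: prime_notX.
exists 'I_n, (fun=> 0), (fun k => iota (z0 ^+ r) *: gloc T (x k)), Xi'; split.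
- split=> [k|k y [u _ <-]|k y S'y|y].
  + split; first by apply: smemZ; exists (x k).
    move=> c; rewrite oppr0 => Fc; apply: (subm_fpow0 Fc); exact: Hp.
  + by rewrite Xi'E XiE; apply: fpowZ; exact: fpow_iota_in.
  + rewrite oppr0 Xi'E -functionalZ.
    by have [u _ <-] := Hq _ _ S'y Fq; rewrite XiE; exact: fpow_iota_in.
  + have Es : iota s *: y = \sum_k Xi k y *: gloc T (x k).
      elim: (base_change_span (@gloc_bc _ _ _ T) y) => [|u v _ IHu _ IHv|a _ _ [u _ <-]].
      * by rewrite scaler0 big1 // => k _; rewrite linear0 scale0r.
      * by rewrite scalerDr IHu IHv -big_split; apply: eq_bigr => k _; rewrite linearD scalerDl.
      * rewrite scalerA mulrC -scalerA -[iota s *: _]linearZ /= E [gloc T _]linear_sum scaler_sumr.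
        by apply: eq_bigr => k _; rewrite [gloc T _]linearZ functionalZ XiE scalerA.
    have -> : iota (s * (z0 ^+ r * z0 ^+ r)) = iota (z0 ^+ r) * (iota (z0 ^+ r) * iota s).
      by rewrite !rmorphM; ring.
    rewrite -!scalerA Es.
    rewrite !scaler_sumr; apply: eq_bigr => k _; rewrite Xi'E !scalerA; congr (_ *: _); ring.
- move=> i k; rewrite Xi'E functionalZ XiE del !rmorphMn !rmorphM.
  by rewrite mulrnAr mulrnAr; congr (_ *+ _); ring.
- exists z0 => // a Ia; exists (s * (z0 ^+ r * z0 ^+ (p + q)) * a).
  by rewrite /r exprS; ring.
Qed.

End AdaptedBasis.

(** * Adapted bases at primes containing I *)

Section AdaptedAt.
Variables (A A1 : comPzRingType) (iota : {rmorphism A -> A1}) (I : set A).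
Hypothesis H : invertible_ideal iota I.
Notation F := (fpow iota I).
Variable T : gluing iota.
Notation V := (gE1 T).
Notation S := (Esub T).
Notation S' := (E'sub T).
Notation M := (lat I S S').
Variable m : set A.
Hypotheses (pm : is_prime m) (Im : I `<=` m).
Let im : is_ideal m. Proof. by case: pm. Qed.

Lemma image_prime (R : comPzRingType) (pi : {rmorphism A -> R}) :
  (forall r, exists a, pi a = r) -> (forall a, pi a = 0 <-> I a) ->
  is_prime [set r | forall a, pi a = r -> m a].
Proof.
move=> pi_surj pi_ker; have [m0 mD mM] := im.
have mE a b : pi a = pi b -> m b -> m a.
  move=> E mb; rewrite -[a](subrK b); apply: mD => //.
  by apply: Im; apply/pi_ker; rewrite rmorphB E subrr.
split; first split=> /=.
- by move=> a /pi_ker /Im.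
- move=> r r' mr mr' a E; have [[b bE] [b' b'E]] := (pi_surj r, pi_surj r').
  apply: (mE _ (b + b')); first by rewrite rmorphD bE b'E.
  by apply: mD; [apply: mr | apply: mr'].
- move=> r r' mr' a E; have [[b bE] [b' b'E]] := (pi_surj r, pi_surj r').
  apply: (mE _ (b * b')); first by rewrite rmorphM bE b'E.
  by apply: mM; apply: mr'.
- by have [_ N1 _] := pm; move=> /(_ 1 (rmorph1 pi)).
- move=> r r' /= mrr; have [[b bE] [b' b'E]] := (pi_surj r, pi_surj r').
  have /mrr : pi (b * b') = r * r' by rewrite rmorphM bE b'E.
  have [_ _ mP] := pm; move=> /mP[mb|mb]; [left | right] => a E.
    by apply: (mE _ b) => //; rewrite bE.
  by apply: (mE _ b') => //; rewrite b'E.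
Qed.

(* x lifts a basis of M_j / (M_(j+1) + I M_(j-1)) near m. *)
Definition residue_basis (j : int) (s : A) n (x : 'I_n -> V) :=
  [/\ forall i, M j (x i),
      forall y, M j y -> exists c : 'I_n -> A,
        lattice_denom I T j (iota s *: y - \sum_i iota (c i) *: x i)
    & forall c : 'I_n -> A, lattice_denom I T j (\sum_i iota (c i) *: x i) ->
        forall i, I (s * c i)].

(** A finite projective R-module is free near the image of m in R; lift a basis and its coordinates
    along [q] and [pi]. *)
Lemma residue_basisP (R : comPzRingType) (pi : {rmorphism A -> R}) j :
  (forall r, exists a, pi a = r) -> (forall a, pi a = 0 <-> I a) ->
  finite_projective_quotient pi
    [set y : subm (lattice I T j) | lattice_denom I T j (subm_val y)] ->
  exists (s : A) n (x : 'I_n -> V), ~ m s /\ residue_basis j s x.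
Proof.
move=> pi_surj pi_ker [Q [q [q_surj q_ker Qfp]]].
have [n [sR [xR [xi [Ns E del]]]]] :=
  finite_projective_locally_free (image_prime pi_surj pi_ker) Qfp.
have [s sE] := pi_surj sR.
have /choice[x xE] i := q_surj (xR i).
have q_ker' y : q y = 0 <-> lattice_denom I T j (subm_val y) by exact: q_ker.
have comb_val (y : 'I_n -> subm (lattice I T j)) (c : 'I_n -> A) :
    subm_val (\sum_i c i *: y i) = \sum_i iota (c i) *: subm_val (y i).
  by rewrite subm_val_sum; apply: eq_bigr => i _; rewrite subm_valZ.
exists s, n, (fun i => subm_val (x i)); split.
  move=> ms; apply: Ns => a aE; have [_ mD _] := im.
  rewrite -[a](subrK s); apply: mD => //; apply: Im; apply/pi_ker.
  by rewrite rmorphB aE sE subrr.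
split=> [i|y My|c Dc i].
- by apply/(latticeE H); exact: submP.
- have My' : y \in in_subm (lattice I T j) by apply/asboolP/(latticeE H).
  have /choice[c cE] i := pi_surj (xi i (q (Subm My'))).
  exists c; rewrite -(comb_val x c).
  have -> : iota s *: y - subm_val (\sum_i c i *: x i) =
     subm_val (s *: Subm My' + (-1) *: \sum_i c i *: x i).
    by rewrite subm_valD !subm_valZ rmorphN1 scaleN1r.
  apply/q_ker'; rewrite linearD !linearZ /= rmorphN1 scaleN1r sE E linear_sum.
  apply/eqP; rewrite subr_eq0; apply/eqP/eq_bigr => i _.
  by rewrite linearZ /= cE xE.
- move: Dc; rewrite -(comb_val x c) => /q_ker' /(congr1 (xi i)).
  rewrite linear0 !linear_sum (bigD1 i) //= big1 ?addr0.
    by rewrite linearZ functionalZ /= xE del eqxx mulrC -sE -rmorphM => /pi_ker.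
  by move=> k /negbTE ki; rewrite linearZ functionalZ /= xE del eq_sym ki mulr0.
Qed.

(** * Generation by the lifted bases and independence near m *)

Section Combine.
Variables (K : finType) (e : K -> int) (x : K -> V) (s : A) (m0 : nat).
Hypotheses (Ns : ~ m s) (Mx : forall k, M (e k) (x k)).
Hypothesis e_bound : forall k, - m0%:Z <= e k <= m0%:Z.
Hypotheses (low : forall j y, j <= - m0%:Z -> smem S y -> M j y)
  (high : forall j y, m0%:Z <= j -> (forall c, F (- j) c -> smem S' (c *: y)) -> M j y).
Hypothesis gen : forall j y, M j y -> exists c : K -> A,
  lattice_denom I T j (iota s *: y - \sum_(k | e k == j) iota (c k) *: x k).
Hypothesis indep : forall j (c : K -> A),
  lattice_denom I T j (\sum_(k | e k == j) iota (c k) *: x k) ->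
  forall k, e k = j -> I (s * c k).
Variables (g a0 : A).
Hypotheses (Ng : ~ m g) (Ia0 : I a0) (gI : forall a, I a -> exists b, g * a = b * a0).

(* The degree j part of the graded submodule spanned by the x k. *)
Definition graded_span (j : int) (y : V) := exists c : K -> A1,
  (forall k, F 0 (c k) /\ F (j - e k) (c k)) /\ y = \sum_k c k *: x k.
Notation G := graded_span.

(** This is I M_j in colon form. *)
Definition I_lat (j : int) (y : V) := forall c, F (- 1) c -> M j (c *: y).

Lemma graded_span0 j : G j 0.
Proof.
exists (fun=> 0); split; first by split; exact: fpow0.
by rewrite big1 // => k _; rewrite scale0r.
Qed.

Lemma graded_spanD j y z : G j y -> G j z -> G j (y + z).
Proof.
move=> [c [Fc ->]] [d [Fd ->]]; exists (fun k => c k + d k); split.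
  by move=> k; have [[? ?] [? ?]] := (Fc k, Fd k); split; apply: fpowD.
by rewrite -big_split; apply: eq_bigr => k _; rewrite scalerDl.
Qed.

Lemma graded_span_mul i j c y : 0 <= i -> F i c -> G j y -> G (i + j) (c *: y).
Proof.
move=> i0 Fc [d [Fd ->]]; exists (fun k => c * d k); split; last first.
  by rewrite scaler_sumr; apply: eq_bigr => k _; rewrite scalerA.
move=> k; have [F0 Fj] := Fd k; split; last by rewrite -addrA; apply: fpowM.
by rewrite -[0]addr0; apply: fpowM => //; exact: fpow_le Fc.
Qed.

Lemma graded_spanZ j a y : G j y -> G j (iota a *: y).
Proof.
by move=> Gy; rewrite -[j]add0r; apply: graded_span_mul => //; exact: fpow_iota_in.
Qed.

Lemma graded_span_le (i j : int) y : j <= i -> G i y -> G j y.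
Proof.
move=> ji [c [Fc ->]]; exists c; split=> // k; have [? Fi] := Fc k; split=> //.
by apply: fpow_le Fi; lia.
Qed.

Lemma graded_span_colon j y : (forall c, F (- 1) c -> G j (c *: y)) -> G (j + 1) y.
Proof.
move=> Gy; have [L [c [d [Fc Fd ->]]]] := fpow_split H 1 y.
elim/big_rec: _ => [|l z _ Gz]; first exact: graded_span0.
by apply: graded_spanD => //; rewrite addrC; apply: graded_span_mul => //; exact: Gy.
Qed.

Lemma I_lat_le (i j : int) y : j <= i -> I_lat i y -> I_lat j y.
Proof. by move=> ji Iy c Fc; apply: (lat_le ji); exact: Iy. Qed.

Lemma I_latD j y z : I_lat j y -> I_lat j z -> I_lat j (y + z).
Proof.
by move=> Iy Iz c Fc; rewrite scalerDr; apply: latD; [exact: Iy | exact: Iz].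
Qed.

Lemma I_latZ j a y : I_lat j y -> I_lat j (iota a *: y).
Proof.
by move=> Iy c Fc; rewrite scalerA mulrC -scalerA; apply: latZ; exact: Iy.
Qed.

Lemma denom_split j y : lattice_denom I T j y <->
  exists u v, [/\ M (j + 1) u, I_lat (j - 1) v & y = u + v].
Proof.
split=> [/(denomP H)|] [u [v [Mu Iv ->]]].
  by exists u, v; split=> //; apply/(mulspan_I H (latm I S S' (j - 1))).
apply/(denomP H); exists u, v; split=> //.
by apply/(mulspan_I H (latm I S S' (j - 1))).
Qed.

Lemma gen_split j y : M j y ->
  exists w u v, [/\ G j w, M (j + 1) u, I_lat (j - 1) v & iota s *: y = w + (u + v)].
Proof.
move=> /gen[c /denom_split[u [v [Mu Iv E]]]].
exists (\sum_(k | e k == j) iota (c k) *: x k), u, v; split=> //; last first.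
  by rewrite -E addrC subrK.
exists (fun k => if e k == j then iota (c k) else 0); split; last first.
  by rewrite big_mkcond; apply: eq_bigr => k _; case: ifP; rewrite ?scale0r.
move=> k; case: eqP => [->|_]; rewrite ?subrr; last by split; exact: fpow0.
by split; exact: fpow_iota_in.
Qed.

(** Iterating [gen_split] on the error term in M_(j+i) raises its degree, while the other errors
    stay inside I M_(j-1). *)
Lemma gen_push n j y : M j y -> exists w u v,
  [/\ G j w, M (j + n%:Z) u, I_lat (j - 1) v & iota (s ^+ n) *: y = w + (u + v)].
Proof.
move=> My; elim: n => [|n [w [u [v [Gw Mu Iv E]]]]].
  exists 0, y, 0; rewrite !addr0 add0r rmorph1 scale1r; split=> //.
    exact: graded_span0.
  by move=> c _; rewrite scaler0; exact: lat0.
have [w' [u' [v' [Gw' Mu' Iv' E']]]] := gen_split Mu.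
exists (iota s *: w + w'), u', (v' + iota s *: v); split.
- by apply: graded_spanD; [exact: graded_spanZ | apply: graded_span_le Gw'; lia].
- by have -> : j + n.+1%:Z = j + n%:Z + 1 by lia.
- by apply: I_latD; [apply: I_lat_le Iv'; lia | exact: I_latZ].
- by rewrite exprS rmorphM -scalerA E !scalerDr E' !addrA.
Qed.

Lemma high_I_lat j y : m0%:Z <= j -> M (j + 1) y -> I_lat j y.
Proof.
move=> mj [Sy S'y] c Fc; apply: high => // d Fd; rewrite scalerA.
by apply: S'y; rewrite opprD; apply: fpowM.
Qed.

(** From a degree at least -m0, this many steps lead above m0, where M_(i+1) lies in I M_i and the
    remaining error joins I M_(j-1). *)
Let t := s ^+ (m0 + m0).+1.

Lemma gen_lift j y : - m0%:Z <= j -> M j y ->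
  exists w v, [/\ G j w, I_lat (j - 1) v & iota t *: y = w + v].
Proof.
move=> mj My; have [w [u [v [Gw Mu Iv E]]]] := gen_push (m0 + m0).+1 My.
exists w, (u + v); split=> //; apply: I_latD => //.
apply: (@I_lat_le (j + (m0 + m0)%N%:Z)); first by lia.
by apply: high_I_lat; [lia | have -> : j + (m0 + m0)%N%:Z + 1 = j + (m0 + m0).+1%:Z by lia].
Qed.

(** Away from g the ideal I is generated by [a0], so I U is a0 U. *)
Lemma divide_a0 (U : submodule iota V) v : (forall c, F (- 1) c -> smem U (c *: v)) ->
  exists2 v', smem U v' & iota g *: v = iota a0 *: v'.
Proof.
move=> Uv; have [L [c [d [Fc Fd E]]]] := fpow_split H 1 v.
have /choice[b bE] l : exists b, iota g * c l = iota a0 * iota b.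
  have /(fpow1P H)[a Ia ->] := Fc l; have [b E'] := gI Ia.
  by exists b; rewrite -!rmorphM E' mulrC.
exists (\sum_l iota (b l) *: (d l *: v)).
  by apply: subm_sum => l _; apply: smemZ; exact: Uv.
by rewrite {1}E !scaler_sumr; apply: eq_bigr => l _; rewrite !scalerA bE.
Qed.

Lemma lat_bottom y : smem S y -> M (- m0%:Z) y.
Proof. exact: low. Qed.

Lemma Nt : ~ m t. Proof. exact: prime_notX. Qed.

(* Nakayama for E modulo the span of the x k. *)
Lemma span_bottom : exists2 d, ~ m d & forall y, M (- m0%:Z) y -> G (- m0%:Z) (iota d *: y).
Proof.
have [r [y [eta [Sy etaS Ey]]]] := dualizable_E I T.
have /choice[w wP] l : exists w, exists2 v', smem S v' &
    G (- m0%:Z) w /\ iota (g * t) *: y l = w + iota a0 *: v'.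
  have [||w [v [Gw Iv E]]] := @gen_lift (- m0%:Z) (y l) _; [by []|exact: lat_bottom|].
  have [|v' Sv' E'] := @divide_a0 S v; first by move=> c /Iv[].
  exists (iota g *: w), v' => //; split; first exact: graded_spanZ.
  by rewrite rmorphM -scalerA E scalerDr E'.
have {wP} /choice[v' wP] l : exists v', [/\ smem S v', G (- m0%:Z) (w l) &
    iota (g * t) *: y l = w l + iota a0 *: v'].
  by have [v' ? [? ?]] := wP l; exists v'.
pose N (l l' : 'I_r) := aval iota (eta l' (v' l)).
have NE l l' : iota (N l l') = eta l' (v' l).
  by apply: (avalE (I := I)); apply: etaS; have [] := wP l.
(* The relations g t y_l = w_l + a0 v'_l read B y = w. Modulo m the matrix is the scalar g t, so det
   B is outside m, and the adjugate puts det B * y_l in the span. *)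
pose B := \matrix_(l, l') ((g * t) *+ (l == l') - a0 * N l l').
have Bw l : \sum_l' iota (B l l') *: y l' = w l.
  have [Sv' _ E] := wP l.
  have -> : w l = iota (g * t) *: y l - iota a0 *: v' l by rewrite E addrK.
  rewrite {1}[v' l]Ey scaler_sumr.
  under eq_bigr => l' _ do rewrite mxE rmorphB rmorphM NE scalerBl.
  rewrite sumrB (bigD1 l) //= eqxx big1 ?addr0.
    by congr (_ - _); apply: eq_bigr => l' _; rewrite scalerA.
  by move=> l' /negbTE ll'; rewrite eq_sym ll' rmorph0 scale0r.
exists (\det B).
  apply: (prime_det pm (prime_notM pm Ng Nt)) => i k; rewrite mxE addrAC subrr add0r.
  by apply: ideal_opp => //; apply: ideal_mulr => //; exact: Im.
move=> z [Sz _]; rewrite [z]Ey scaler_sumr.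
have adjE l l' : \sum_k (\adj B) l k * B k l' = \det B *+ (l == l').
  by have /matrixP/(_ l l') := mul_adj_mx B; rewrite mxE [RHS]mxE.
have Gdet l : G (- m0%:Z) (iota (\det B) *: y l).
  have -> : iota (\det B) *: y l = \sum_k iota ((\adj B) l k) *: w k.
    transitivity (\sum_k \sum_l' (iota ((\adj B) l k) * iota (B k l')) *: y l').
      rewrite exchange_big /= (bigD1 l) //= [X in _ + X]big1 ?addr0.
        rewrite -scaler_suml; congr (_ *: _).
        have := adjE l l; rewrite eqxx mulr1n => <-; rewrite rmorph_sum.
        by apply: eq_bigr => k _; rewrite rmorphM.
      move=> l' /negbTE ll'; rewrite -scaler_suml.
      have := adjE l l'; rewrite eq_sym ll' mulr0n => /(congr1 iota) adj0.
      suff -> : \sum_k iota ((\adj B) l k) * iota (B k l') = 0 by rewrite scale0r.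
      rewrite rmorph0 rmorph_sum in adj0; rewrite -[RHS]adj0.
      by apply: eq_bigr => k _; rewrite rmorphM.
    by apply: eq_bigr => k _; rewrite -Bw scaler_sumr; apply: eq_bigr => l' _; rewrite scalerA.
  elim/big_rec: _ => [|k u _ Gu]; first exact: graded_span0.
  by apply: graded_spanD => //; apply: graded_spanZ; have [] := wP k.
elim/big_rec: _ => [|l u _ Gu]; first exact: graded_span0.
apply: graded_spanD => //; rewrite scalerA mulrC -scalerA -[- m0%:Z]add0r.
by apply: graded_span_mul => //; exact: etaS.
Qed.

(** Induction on the degree: t M_(j+1) lies in G_(j+1) + I M_j, and d I M_j lies in I G_j, hence in
    G_(j+1). *)
Lemma span_top : exists2 d, ~ m d & forall y, M m0%:Z y -> G m0%:Z (iota d *: y).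
Proof.
suff H' n : exists2 d, ~ m d & forall y, M (n%:Z - m0%:Z) y -> G (n%:Z - m0%:Z) (iota d *: y).
  by have := H' (m0 + m0)%N; have -> : (m0 + m0)%N%:Z - m0%:Z = m0%:Z by lia.
elim: n => [|n [d Nd Hd]]; first by rewrite add0r; exact: span_bottom.
exists (d * t); first by apply: prime_notM => //; exact: Nt.
have -> : n.+1%:Z - m0%:Z = n%:Z - m0%:Z + 1 by lia.
move=> y My; have [|w [v [Gw Iv E]]] := gen_lift _ My; first by lia.
rewrite rmorphM -scalerA E scalerDr; apply: graded_spanD; first exact: graded_spanZ.
apply: graded_span_colon => c Fc; rewrite scalerA mulrC -scalerA; apply: Hd.
by have := Iv c Fc; rewrite addrK.
Qed.

(* In a relation between the x k the coefficients of degree < j are divisible *)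
(* by a0, which puts the terms of degree j into M_(j+1) + I M_(j-1).          *)
Lemma relation_in_m (a : K -> A) : \sum_k iota (a k) *: x k = 0 -> forall k, m (a k).
Proof.
suff H' n : exists2 d, ~ m d & forall a : K -> A, \sum_k iota (a k) *: x k = 0 ->
    forall k, e k < n%:Z - m0%:Z -> I (d * a k).
  have [d Nd Hd] := H' (m0 + m0).+1; move=> a0' k.
  have [_ _ mP] := pm; have /Im/mP[] // : I (d * a k).
  by apply: Hd => //; have := e_bound k; lia.
elim: n a => [|n IHn] _.
  exists 1; first by case: pm.
  by move=> a _ k; have := e_bound k; lia.
have [|d Nd Hd] := IHn; first exact: (fun=> 0).
set j := n%:Z - m0%:Z in Hd; exists (s * (g * (g * d))).
  by do 3?[apply: prime_notM => //].
have [iI _ _ _] := H; have [I0 ID IM] := iI.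
move=> a rel; have /choice[b bE] k : exists b, e k < j -> g * (d * a k) = b * a0.
  have [kj|kj] := boolP (e k < j); last by exists 0.
  by have [b E] := gI (Hd _ rel _ kj); exists b.
(* The terms of degree below j, times g d and divided by [a0]. *)
pose w := \sum_(k | e k < j) iota (b k) *: x k.
have Sw : smem S w by apply: subm_sum => k _; apply: smemZ; have [] := Mx k.
have a0w : iota a0 *: w = - \sum_(k | ~~ (e k < j)) iota (g * (d * a k)) *: x k.
  have := congr1 (fun y => iota (g * d) *: y) rel.
  rewrite /= scaler0 (bigID (fun k => e k < j)) /= scalerDr => /eqP; rewrite addr_eq0 => /eqP E.
  transitivity (iota (g * d) *: \sum_(k | e k < j) iota (a k) *: x k).
    rewrite /w !scaler_sumr; apply: eq_bigr => k kj.
    by rewrite !scalerA -!rmorphM -mulrA bE // mulrC.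
  rewrite E scaler_sumr; congr (- _); apply: eq_bigr => k _.
  by rewrite scalerA -rmorphM mulrA.
(* w lies in S and, by the relation, a0 w lies in M_j; dividing by the local generator a0 lowers the
   degree by one. *)
have Mgw : M (j - 1) (iota g *: w).
  split; first exact: smemZ.
  have Ma0w : M j (iota a0 *: w).
    rewrite a0w; apply: (@subm_opp _ _ _ _ (latm I S S' j)); apply: lat_sum => k kj.
    by apply: latZ; apply: (lat_le _ (Mx k)); lia.
  move=> c Fc; have [L [p [q [Fp Fq pq]]]] := fpow_unit H 1.
  have /choice[b' b'E] l : exists b', iota g * p l = iota a0 * iota b'.
    have /(fpow1P H)[p' Ip ->] := Fp l; have [b' E'] := gI Ip.
    by exists b'; rewrite -!rmorphM E' mulrC.
  have -> : c *: (iota g *: w) = \sum_l iota (b' l) *: ((c * q l) *: (iota a0 *: w)).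
    rewrite scalerA -{1}[c]mulr1 -pq !mulr_sumr mulr_suml scaler_suml.
    apply: eq_bigr => l _; rewrite !scalerA; congr (_ *: _).
    transitivity ((c * q l) * (iota g * p l)); first by ring.
    by rewrite b'E; ring.
  apply: subm_sum => l _; apply: smemZ; have [_] := Ma0w; apply.
  have Ej : - j = - (j - 1) - 1 by lia.
  by rewrite Ej; apply: fpowM.
suff D : lattice_denom I T j (\sum_(k | e k == j) iota (g * (g * d) * a k) *: x k).
  move=> k; have [kj _|kj kj'] := boolP (e k < j).
    have -> : s * (g * (g * d)) * a k = (s * g * g) * (d * a k) by ring.
    by apply: IM; apply: Hd.
  have ej : e k = j by rewrite /j in kj *; lia.
  by rewrite -mulrA; exact: (indep D ej).
(* The terms of degree j are minus those of higher degree, which lie in M_(j+1), minus a0 (g w),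
   which lies in I M_(j-1). *)
apply/denom_split; exists (- \sum_(k | j < e k) iota (g * (g * d) * a k) *: x k),
   (- (iota a0 *: (iota g *: w))); split.
- apply: (@subm_opp _ _ _ _ (latm I S S' (j + 1))); apply: lat_sum => k kj.
  by apply: latZ; apply: (lat_le _ (Mx k)); lia.
- move=> c Fc; rewrite scalerN; apply: (@subm_opp _ _ _ _ (latm I S S' (j - 1))).
  have Fca : F 0 (c * iota a0) by rewrite -(addNr 1); apply: fpowM => //; exact: fpow_I.
  by rewrite [c *: _]scalerA; exact: (lat_fpow0 Fca Mgw).
- have -> : iota a0 *: (iota g *: w) = iota g *: (iota a0 *: w) by rewrite !scalerA mulrC.
  rewrite a0w scalerN opprK scaler_sumr.
  apply/eqP; rewrite addrC -subr_eq opprK; apply/eqP.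
  rewrite [RHS](bigID (fun k => e k == j)) /=; congr (_ + _); apply: eq_big => k; try lia.
    by move=> _; rewrite scalerA -rmorphM !mulrA.
  by move=> _; rewrite scalerA -rmorphM !mulrA.
Qed.

(** The x_k generate E near m by [span_bottom], and [relation_in_m] with [dual_normalize] makes them
    a basis there. [span_top] then bounds the coordinates on S'. *)
Lemma combine_adapted : exists2 f, ~ m f & adapted I T f.
Proof.
have [d Nd Hd] := span_bottom; have [D ND HD] := span_top.
have [r [y [eta [eta1 [Ey eta1E Ey1]]]]] := base_change_dual (gE_fp T) (@gloc_bc _ _ _ T).
have /choice[X XE] k : exists u, gloc T u = x k by apply: glocE; have [] := Mx k.
have /choice[c cE] l : exists c : K -> A, iota d *: gloc T (y l) = \sum_k iota (c k) *: x k.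
  have [|c [Fc E]] := Hd (gloc T (y l)); first by apply: lat_bottom; exists (y l).
  exists (fun k => aval iota (c k)); rewrite E; apply: eq_bigr => k _.
  by rewrite (avalE (I := I)) //; have [] := Fc k.
have /choice[xi xiE] k := linear_comb (fun l => c l k) eta.
have dE u : d *: u = \sum_k xi k u *: X k.
  apply: (gloc_inj H); rewrite linear_sum [gloc T _]linearZ /= {1}[u]Ey linear_sum scaler_sumr.
  transitivity (\sum_l \sum_k iota (c l k * eta l u) *: x k).
    apply: eq_bigr => l _; rewrite [gloc T _]linearZ /= scalerA mulrC -scalerA cE scaler_sumr.
    by apply: eq_bigr => k _; rewrite scalerA -rmorphM mulrC.
  rewrite exchange_big; apply: eq_bigr => k _; rewrite linearZ /= XE xiE rmorph_sum scaler_suml.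
  by [].
have [|s' [xi' [Ns' s'E del]]] := dual_normalize pm Nd dE.
  move=> i k; apply: (relation_in_m (a := fun i => xi i (X k) - d *+ (i == k))).
  under eq_bigr => l _ do rewrite rmorphB scalerBl -XE.
  rewrite sumrB; apply/eqP; rewrite subr_eq0; apply/eqP.
  transitivity (gloc T (d *: X k)).
    by rewrite dE linear_sum; apply: eq_bigr => l _; rewrite [RHS]linearZ.
  rewrite (bigD1 k) //= eqxx big1 ?addr0 ?linearZ // => l /negbTE ->.
  by rewrite rmorph0 scale0r.
have /choice[Xi XiE] k := base_change_functional (xi' k) (@gloc_bc _ _ _ T).
have Es' z : iota s' *: z = \sum_k Xi k z *: x k.
  elim: (base_change_span (@gloc_bc _ _ _ T) z) => [|u v _ IHu _ IHv|a _ _ [u _ <-]].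
  - by rewrite scaler0 big1 // => k _; rewrite linear0 scale0r.
  - by rewrite scalerDr IHu IHv -big_split; apply: eq_bigr => k _; rewrite linearD scalerDl.
  - rewrite scalerA mulrC -scalerA -[iota s' *: _]linearZ /= s'E [gloc T _]linear_sum scaler_sumr.
    by apply: eq_bigr => k _; rewrite [gloc T _]linearZ functionalZ XiE scalerA XE.
have Xidel i k : Xi i (x k) = iota s' *+ (i == k) by rewrite -XE XiE del rmorphMn.
have /choice[Xi' Xi'E] k := linear_scaled (Xi k) (iota (g * D)).
exists (g * D * s'); first by do 2?[apply: prime_notM => //].
exists K, e, x, Xi'; split.
- split=> // [k z [u _ <-]|k z S'z|z].
  + by rewrite Xi'E XiE; apply: fpowZ; exact: fpow_iota_in.
  + rewrite Xi'E rmorphM -mulrA; apply: fpowZ.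
    (* After multiplication by I^m0, an element of S' lies in M_m0, where [span_top] puts its k-th
       coordinate in I^(m0 - e_k). *)
    apply: (@fpow_colon _ _ _ _ H m0%:Z) => b Fb.
    have : M m0%:Z (b *: z).
      apply: high => // b' Fb'; rewrite scalerA; apply: (subm_fpow0 (I := I)) => //.
      by rewrite -(addNr m0%:Z); apply: fpowM.
    move=> /HD[p [Fp E]]; rewrite mulrCA -functionalZ -functionalZ E linear_sum.
    apply: fpow_sum => l _; rewrite functionalZ Xidel mulrnAr.
    case: eqP => [->|_]; last by rewrite mulr0n; exact: fpow0.
    by rewrite mulr1n mulrC; apply: fpowZ; have [] := Fp l.
  + rewrite rmorphM -scalerA Es' scaler_sumr; apply: eq_bigr => k _.
    by rewrite Xi'E scalerA.
- by move=> i k; rewrite Xi'E Xidel mulrnAr -rmorphM.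
- exists a0 => // a Ia; have [b E] := gI Ia; exists (D * s' * b).
  have -> : g * D * s' * a = D * s' * (g * a) by ring.
  by rewrite E; ring.
Qed.
End Combine.
End AdaptedAt.

Section AdaptedAtPrime.
Variables (A A1 : comPzRingType) (iota : {rmorphism A -> A1}) (I : set A).
Hypothesis H : invertible_ideal iota I.
Notation F := (fpow iota I).
Variable T : gluing iota.
Notation V := (gE1 T).
Notation S := (Esub T).
Notation S' := (E'sub T).
Notation M := (lat I S S').

Lemma denomZ j a y : lattice_denom I T j y -> lattice_denom I T j (iota a *: y).
Proof.
move=> /(denom_split H)[u [v [Mu Iv ->]]]; apply/(denom_split H).
exists (iota a *: u), (iota a *: v); split; [exact: latZ | exact: I_latZ |].
by rewrite scalerDr.
Qed.

(** Only degrees between -m0 and m0 contribute, so finitely many residue bases are combined, with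
    the product of their denominators. *)
Lemma adapted_at (m : set A) (R : comPzRingType) (pi : {rmorphism A -> R}) :
  is_prime m -> I `<=` m ->
  (forall r, exists a, pi a = r) -> (forall a, pi a = 0 <-> I a) ->
  (forall j : int, finite_projective_quotient pi
    [set y : subm (lattice I T j) | lattice_denom I T j (subm_val y)]) ->
  exists2 f, ~ m f & adapted I T f.
Proof.
move=> pm Im pi_surj pi_ker Mfp.
have [m1 low] := lat_low H (dualizable_E I T) (dualizable_E' I T).
have [m2 high] := lat_high H (dualizable_E I T) (dualizable_E' I T).
pose m0 := maxn m1 m2.
have {}low j y : j <= - m0%:Z -> smem S y -> M j y by move=> jm; apply: low; lia.
have {}high j y : m0%:Z <= j -> (forall c, F (- j) c -> smem S' (c *: y)) -> M j y.
  by move=> mj; apply: high; lia.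
pose deg (i : 'I_(m0 + m0).+1) : int := i%:Z - m0%:Z.
have /choice[p pP] i : exists p : {n : nat & (A * ('I_n -> V))%type},
    ~ m (tagged p).1 /\ residue_basis I (deg i) (tagged p).1 (tagged p).2.
  have [s [n [x [Ns bx]]]] := residue_basisP H pm Im pi_surj pi_ker (Mfp (deg i)).
  by exists (existT _ n (s, x)).
pose n i := tag (p i); pose s i := (tagged (p i)).1; pose x i := (tagged (p i)).2.
pose K : finType := {i : 'I_(m0 + m0).+1 & 'I_(n i)}.
pose e (k : K) := deg (tag k).
pose sp := \prod_i s i.
have sumK i (c : K -> A) : \sum_(k | e k == deg i) iota (c k) *: x (tag k) (tagged k) =
    \sum_l iota (c (Tagged (fun i => 'I_(n i)) l)) *: x i l.
  transitivity (\sum_(i' | deg i' == deg i) \sum_l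
      iota (c (Tagged (fun i => 'I_(n i)) (l : 'I_(n i')))) *: x i' l).
    rewrite sig_big_dep /=; apply: eq_big => [k|[i' l] _] //=.
    by rewrite andbT.
  rewrite (big_pred1 i) // => i' /=.
  by apply/eqP/eqP => [|->//]; rewrite /deg => E; apply: val_inj => /=; lia.
(* The products a_k y_k lie in A and sum to 1, so one of them is outside m; away from it a_k
   generates I. *)
have [g0 Ng [a0 Ia0 gI]] : exists2 g, ~ m g &
    exists2 a0, I a0 & forall a, I a -> exists b, g * a = b * a0.
  have [_ _ [q [a [y [Ia Iy ay]]]] _] := H.
  have /choice[g gE] k : exists g, iota (a k) * y k = iota g by exact: Iy.
  have g1 : \sum_k g k = 1.
    by apply: (fpow_inj H); rewrite rmorph_sum rmorph1 -ay; apply: eq_bigr => k _; rewrite gE.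
  have [k Nk] : exists k, ~ m (g k).
    apply: contrapT => /forallNP Nm; have [im N1 _] := pm; apply: N1; rewrite -g1.
    by apply: ideal_sum => // k _; apply: contrapT; exact: Nm.
  exists (g k) => //; exists (a k) => // b Ib; have [c cE] := Iy k b Ib.
  by exists c; apply: (fpow_inj H); rewrite !rmorphM -gE -cE; ring.
apply: (@combine_adapted _ _ _ _ H T m pm Im K e (fun k => x (tag k) (tagged k)) sp m0
   _ _ _ low high _ _ g0 a0 Ng Ia0 gI).
- by apply: prime_notprod => // i _; have [] := pP i.
- by move=> k; have [_ [Mx _ _]] := pP (tag k); exact: Mx.
- by move=> k; have := ltn_ord (tag k); rewrite /e /deg; lia.
- move=> j y My; have [jb|jb] := boolP ((- m0%:Z <= j) && (j <= m0%:Z)); last first.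
    (* Outside the range the quotient vanishes: M_j = M_(j+1) below it and M_j = I M_(j-1) above
       it. *)
    exists (fun=> 0); rewrite big1 ?subr0; last by move=> k _; rewrite rmorph0 scale0r.
    apply: denomZ; have [jl|jh] : j + 1 <= - m0%:Z \/ m0%:Z + 1 <= j by lia.
      by apply: (denom_high H); apply: low => //; case: My.
    apply: (denom_low H) => c Fc; apply: (high_I_lat high) => //; first by lia.
    by rewrite subrK.
  have [i jE] : exists i, j = deg i.
    have ilt : (absz (j + m0%:Z)%R < (m0 + m0).+1)%N by lia.
    by exists (Ordinal ilt); rewrite /deg /=; lia.
  rewrite jE in My *; have [_ [_ /(_ y My)[c Dc] _]] := pP i.
  pose r := \prod_(i' | i' != i) s i'.
  have spE : sp = r * s i by rewrite /sp (bigD1 i) //= mulrC.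
  (* Coefficients on the single fibre i are extended to all fibres through natural numbers, which
     avoids casts between the types ['I_(n i)]. *)
  have /choice[d dE] i' : exists d : nat -> A, i' = i -> forall l : 'I_(n i), d l = r * c l.
    exists (fun q => if insub q is Some l then r * c l else 0) => _ l.
    by rewrite valK.
  exists (fun k : K => d (tag k) (nat_of_ord (tagged k : 'I_(n (tag k))))); rewrite sumK /=.
  have := denomZ r Dc; rewrite scalerBr scalerA -rmorphM -spE scaler_sumr.
  congr (lattice_denom _ _ _ (_ - _)); apply: eq_bigr => l _.
  by rewrite scalerA -rmorphM (dE i).
- move=> j c Dc [i l] ij; rewrite -ij /e /= sumK in Dc.
  have [_ [_ _ /(_ _ Dc l)]] := pP i.
  rewrite -/(s i) /sp (bigD1 i) //= => Isc.
  rewrite [s i * _]mulrC -mulrA; have [[_ _ IM] _ _ _] := H; exact: IM.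
Qed.
End AdaptedAtPrime.

Section BaseChangeFree.
Variables (A Af : comPzRingType) (f : A) (phi : {rmorphism A -> Af}).
Hypothesis phif : is_complement [set f] phi.
Variables (E : lmodType A) (n : nat) (a : {linear E -> 'cV[Af]_n | phi \; *:%R}).
Variables (x : 'I_n -> E) (u w : 'I_n -> Af).
Hypotheses (uw : forall i, u i * w i = 1) (ax : forall i, a (x i) = u i *: delta_mx i 0)
  (aker : forall y, a y = 0 -> exists c, f ^+ c *: y = 0).

(** A map out of Af^n is prescribed on the unit multiples a(x_i) of the standard basis. It agrees
    with h because y is a combination of the x_i up to f-power torsion and f is a unit in Af. *)
Lemma base_change_free : base_change a.
Proof.
move=> Q h; pose k0 (q : 'cV[Af]_n) : Q := \sum_i (q i 0 * w i) *: h (x i).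
have k0D p q : k0 (p + q) = k0 p + k0 q.
  by rewrite /k0 -big_split; apply: eq_bigr => i _; rewrite mxE mulrDl scalerDl.
have k0Z b q : k0 (b *: q) = b *: k0 q.
  by rewrite /k0 scaler_sumr; apply: eq_bigr => i _; rewrite mxE scalerA mulrA.
split.
  exists (mklin k0 k0D k0Z) => y /=.
  have [c [al alE]] := basic_frac_fin phif (fun i => a y i 0 * w i).
  have [|d dE] := aker (y := f ^+ c *: y - \sum_i al i *: x i).
    rewrite linearB linear_sum; apply/eqP; rewrite subr_eq0; apply/eqP/colP => l.
    rewrite linearZ mxE summxE (bigD1 l) //= big1 ?addr0.
      rewrite linearZ ax !mxE !eqxx mulr1 /= -alE -!mulrA [w l * _]mulrC uw mulr1.
      by [].
    by move=> i /negbTE il; rewrite linearZ ax !mxE eq_sym il /= !mulr0.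
  have [v fv] := basic_powunit phif (d + c).
  have E0 : phi (f ^+ d) *: (phi (f ^+ c) *: h y - \sum_i phi (al i) *: h (x i)) = 0.
    rewrite -[RHS](linear0 h) -dE [RHS]linearZ /=; congr (_ *: _).
    rewrite [RHS]linearB [h (_ *: y)]linearZ [in RHS]linear_sum /=; congr (_ - _).
    by apply: eq_bigr => i _; rewrite [RHS]linearZ.
  apply: (can_inj (g := fun q => v *: q) (f := fun q => phi (f ^+ (d + c)) *: q)).
    by move=> q; rewrite scalerA mulrC fv scale1r.
  rewrite exprD rmorphM -!scalerA.
  move: E0 => /eqP; rewrite scalerBr subr_eq0 => /eqP ->; congr (_ *: _).
  by rewrite /k0 scaler_sumr; apply: eq_bigr => i _; rewrite scalerA alE.
move=> k1 k2 kE q.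
have -> : q = \sum_i (q i 0 * w i) *: a (x i).
  apply/colP => l; rewrite summxE (bigD1 l) //= big1 ?addr0.
    by rewrite ax !mxE !eqxx mulr1 -mulrA [w l * _]mulrC uw mulr1.
  by move=> i /negbTE il; rewrite ax !mxE eq_sym il /= !mulr0.
by rewrite !linear_sum; apply: eq_bigr => i _; rewrite !linearZ kE.
Qed.
End BaseChangeFree.

Lemma sorted_enum (K : finType) (e : K -> int) : exists (sg : 'I_#|K| -> K),
  bijective sg /\ forall i k : 'I_#|K|, (i <= k)%N -> e (sg k) <= e (sg i).
Proof.
pose le k l := e l <= e k.
have le_total : total le by move=> k l; rewrite /le; lia.
have le_trans : transitive le by move=> a b c; rewrite /le; lia.
have le_refl : reflexive le by move=> a; rewrite /le.
pose r := sort le (enum K).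
have sz : size r = #|K| by rewrite size_sort cardE.
have rt : size r == #|K| by rewrite sz.
exists (tnth (Tuple rt)); split.
  apply: inj_card_bij; last by rewrite card_ord.
  move=> i k; rewrite /tnth (set_nth_default (tnth_default (Tuple rt) i)) ?size_tuple // => /eqP.
  rewrite nth_uniq ?sz //; first by move=> /eqP/val_inj.
  by rewrite sort_uniq enum_uniq.
move=> i k ik; have /= := sorted_leq_nth le_trans le_refl
  (tnth_default (Tuple rt) i) (sort_sorted le_total (enum K)).
move=> /(_ i k); rewrite !inE -/r sz !ltn_ord => /(_ isT isT ik); rewrite /le /tnth /=.
by rewrite [nth _ _ k](set_nth_default (tnth_default (Tuple rt) k)) ?sz.
Qed.

(** * Adapted bases give local diagonal form *)

Section AdaptedDiagonal.
Variables (A A1 : comPzRingType) (iota : {rmorphism A -> A1}) (I : set A).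
Hypotheses (H : invertible_ideal iota I) (A1E : is_complement I iota).
Notation F := (fpow iota I).
Variable T : gluing iota.
Notation V := (gE1 T).
Notation S := (Esub T).
Notation S' := (E'sub T).
Notation M := (lat I S S').

(** Over A[1/f] the generator z of I is the image of z0. The xi_i are coordinates on E up to the
    unit f, and z^(e_i) xi_i are coordinates on E', which makes Phi diagonal. *)
Lemma adapted_diagonal f : adapted I T f -> diagonal_over I T (toloc f).
Proof.
move=> [K [e0 [x0 [xi0 [[Mx0 xiS0 xiS'0 E0] del0 [z0 Iz0 fI]]]]]].
have [sg [sg_bij e_sorted]] := sorted_enum e0.
pose n := #|K|; pose e i := e0 (sg i); pose x i := x0 (sg i); pose xi i := xi0 (sg i).
have Mx i : M (e i) (x i) by exact: Mx0.
have xE y : iota f *: y = \sum_i xi i y *: x i.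
  by rewrite E0 (reindex sg) //; exact: onW_bij.
have del i k : xi i (x k) = iota f *+ (i == k) by rewrite /xi /x del0 (bij_eq sg_bij).
have [Psi [PhiK PsiK]] := Phi_inv T.
pose phi := toloc f; pose z := phi z0; pose psi := toloc z; pose w := lfrac z 1 1.
have zw : psi z * w = 1 by exact: toloc_unit.
have phif : is_complement [set f] phi by exact: loc_complement.
have [wf fwf] := basic_unit phif.
have phi_gen : ideal_gen [set phi a | a in I] = ideal_gen [set z].
  apply/seteqP; split; apply: ideal_gen_min; try exact: ideal_gen_ideal.
    move=> _ [a Ia <-]; have [b fab] := fI a Ia.
    have -> : phi a = (wf * phi b) * z.
      by rewrite -mulrA -rmorphM -fab rmorphM mulrA [wf * _]mulrC fwf mul1r.
    by apply: ideal_genM; exact: ideal_gen_sub.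
  by move=> _ ->; apply: ideal_gen_sub; exists z0.
have psiI : is_complement [set phi a | a in I] psi by exact: loc_complement.
have [phi1 phi1E] : exists phi1 : {rmorphism A1 -> loc z}, forall a, phi1 (iota a) = psi (phi a).
  have [_ univ] := A1E; have [] // := univ _ (psi \o phi : {rmorphism A -> loc z}).
  rewrite -zw mulrC; apply: ideal_genM; apply: ideal_gen_sub; by exists z0.
have psiinj := psi_inj H phif psiI phi_gen.
have phi1ker := phi1_ker H phif psiI phi1E phi_gen.
pose zp := zpow (psi z) w.
(* th is the quotient f / z0. *)
have [th Fth zth] : exists2 th, F (- 1) th & iota z0 * th = iota f.
  have [_ _ [p [a [y [Ia Iy ay]]]] _] := H.
  have /choice[b bE] k := fI (a k) (Ia k).
  exists (\sum_k iota (b k) * y k).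
    by apply: fpow_sum => k _; apply: fpowZ; apply: fpowN1P; exact: Iy.
  rewrite -[RHS]mulr1 -ay !mulr_sumr; apply: eq_bigr => k _.
  by rewrite mulrA -rmorphM mulrC [z0 * _]mulrC -bE rmorphM; ring.
(* [eta i] stands for z0^(- e_i), up to a power of f that keeps it in I^(- e_i). The eta_i x_i then
   lie in S' and serve as a basis of E' over D(f). *)
have [eta [etaF etaE]] : exists eta : 'I_n -> A1, (forall i, F (- e i) (eta i)) /\
    forall i, exists q, phi1 (eta i) * zp (e i) = psi (phi (f ^+ q)).
  have /choice[eta etaP] i : exists c, F (- e i) c /\
      exists q, phi1 c * zp (e i) = psi (phi (f ^+ q)).
    case: (e i) => p.
      exists (th ^+ p); split.
        elim: p => [|p IHp]; first exact: fpow1.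
        have -> : - p.+1%:Z = - 1 - p%:Z by lia.
        by rewrite exprS; apply: fpowM.
      exists p; rewrite rmorphXn /zp /zpow -exprMn /psi -phi1E -rmorphM mulrC zth.
      by rewrite phi1E !rmorphXn.
    exists (iota (z0 ^+ p.+1)); split.
      apply/(fpow_tpow H) => /=; elim: p => [|p IHp].
        by rewrite expr1 -[z0]mulr1; apply: (@mulspanZ A A^o).
      by rewrite exprS; apply: (@mulspanZ A A^o).
    exists 0; rewrite expr0 !rmorph1 phi1E /zp /zpow !rmorphXn; exact: zpowVn.
  by exists eta; split=> i; have [] := etaP i.
have [r [y [ey [ey1 [Ey ey1E Ey1]]]]] := base_change_dual (gE_fp T) (@gloc_bc _ _ _ T).
have xiA i u : F 0 (xi i (gloc T u)) by apply: xiS0; exists u.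
pose b0 (v : V) : 'cV[loc z]_n := \col_i phi1 (xi i v).
have b0D u v : b0 (u + v) = b0 u + b0 v.
  by apply/colP => i; rewrite !mxE linearD rmorphD.
have b0Z c v : b0 (c *: v) = phi1 c *: b0 v.
  by apply/colP => i; rewrite !mxE functionalZ rmorphM.
pose b0' (v : gE1' T) : 'cV[loc z]_n := \col_i (zp (e i) * phi1 (xi i (Psi v))).
have b0'D u v : b0' (u + v) = b0' u + b0' v.
  by apply/colP => i; rewrite !mxE !linearD rmorphD mulrDr.
have b0'Z c v : b0' (c *: v) = phi1 c *: b0' v.
  by apply/colP => i; rewrite !mxE linearZ functionalZ rmorphM mulrCA.
pose a0 (u : gE T) : 'cV[loc f]_n := \col_i phi (aval iota (xi i (gloc T u))).
have a0b u : b0 (gloc T u) = map_mx psi (a0 u).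
  by apply/colP => i; rewrite !mxE -phi1E (avalE (xiA i u)).
have mapI (c d : 'cV[loc f]_n) : map_mx psi c = map_mx psi d -> c = d.
  by move=> /colP E; apply/colP => i; apply: psiinj; have := E i; rewrite !mxE.
have a0D u v : a0 (u + v) = a0 u + a0 v.
  by apply: mapI; rewrite map_mxD -!a0b linearD b0D.
have a0Z c v : a0 (c *: v) = phi c *: a0 v.
  by apply: mapI; rewrite map_mxZ -!a0b linearZ /= b0Z phi1E.
have /choice[a0' a0'b] u : exists q, b0' (gloc' T u) = map_mx psi q.
  have /choice[q qE] i : exists q, zp (e i) * phi1 (xi i (Psi (gloc' T u))) = psi q.
    have Fu : F (- e i) (xi i (Psi (gloc' T u))) by apply: xiS'0; exists u; rewrite PsiK.
    have [q qE] := phi1_fpow H phi1E phi_gen zw Fu.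
    by exists q; rewrite qE mulrA zpow_opp // mul1r.
  by exists (\col_i q i); apply/colP => i; rewrite !mxE.
have a0'D u v : a0' (u + v) = a0' u + a0' v.
  by apply: mapI; rewrite map_mxD -!a0'b linearD b0'D.
have a0'Z c v : a0' (c *: v) = phi c *: a0' v.
  by apply: mapI; rewrite map_mxZ -!a0'b linearZ /= b0'Z phi1E.
have kerV (v : V) : (forall i, phi1 (xi i v) = 0) -> exists c, iota (f ^+ c) *: v = 0.
  move=> vP; have [c cE] : exists c, forall i, iota (f ^+ c) * xi i v = 0.
    apply: (@pow_uniform _ _ _ (fun i s => iota s * xi i v = 0)) => [i s t E|i].
      by rewrite rmorphM -mulrA E mulr0.
    exact: phi1ker.
  exists c.+1; rewrite exprSr rmorphM -scalerA xE scaler_sumr big1 // => i _.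
  by rewrite scalerA cE scale0r.
exists (loc z), psi, phi1, z, w, n, e, (mksemilin a0 a0D a0Z), (mksemilin a0' a0'D a0'Z),
  (mksemilin b0 b0D b0Z), (mksemilin b0' b0'D b0'Z).
split=> //; last first.
- split=> // v; apply/colP => i; rewrite mul_diag_mx !mxE PhiK.
  by [].
split.
- have /choice[X XE] i : exists u, gloc T u = x i by apply: glocE; have [] := Mx i.
  apply: (base_change_free phif (x := X) (u := fun=> phi f) (w := fun=> wf)) => // [i|u /= au].
    apply/colP => k; rewrite /= /a0 !mxE XE del eqxx andbT mulr_natr.
    by rewrite -rmorphMn (avalK H) rmorphMn eq_sym.
  have [|c cE] := kerV (gloc T u).
    by move=> i; have /colP/(_ i) := a0b u; rewrite au !mxE rmorph0.
  by exists c; apply: (gloc_inj H); rewrite [LHS]linearZ linear0.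
- have /choice[X XE] i : exists u, gPhi T (eta i *: x i) = gloc' T u.
    by have [_ S'x] := Mx i; have [u uE] := S'x _ (etaF i); exists u.
  have /choice[q qE] := etaE.
  have /choice[wq wqE] i := basic_powunit phif (q i).+1.
  apply: (base_change_free phif (x := X)
    (u := fun i => phi (f ^+ (q i).+1)) (w := wq)) => // [i|u /= au].
    apply: mapI; rewrite /= -a0'b -XE; apply/colP => k.
    rewrite !mxE PhiK functionalZ del eqxx andbT -[tolocf z _]/(psi _) -[tolocf f _]/(phi _).
    case: eqP => [->|_]; last by rewrite mulr0n !mulr0 !rmorph0 mulr0.
    rewrite mulr1n mulr1 rmorphM mulrA [zp _ * _]mulrC qE phi1E -!rmorphM -exprSr.
    by [].
  have [|c cE] := kerV (Psi (gloc' T u)).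
    move=> i; have /colP/(_ i) := a0'b u; rewrite au !mxE rmorph0 => E.
    by rewrite -[LHS]mul1r -(zpow_opp zw (e i)) mulrAC E mul0r.
  exists c; apply: (gloc'_inj H); rewrite [LHS]linearZ linear0 /=.
  by rewrite -[gloc' T u]PsiK -[LHS]linearZ cE linear0.
Qed.
End AdaptedDiagonal.

(** * The equivalences *)

Theorem proposition5p14 (A : comPzRingType) (L : lmodType A)
    (v : {linear L -> A^o}) (Linv : invertible_module L) (vinj : injective v)
    (I : set A) (IE : I = range v)
    (R : comPzRingType) (pi : {rmorphism A -> R})
    (pi_surj : forall r, exists a, pi a = r)
    (pi_ker : forall a, pi a = 0 <-> I a)
    (A1 : comPzRingType) (iota : {rmorphism A -> A1})
    (A1E : is_complement I iota)
    (T : gluing iota) :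
  let M := lattice I T in
  let cond_ii :=
    [/\ forall j : int, finite_projective (subm (M j)),
        (exists j0 : int, forall j, j <= j0 -> smem (M j) = smem (M (j - 1))) /\
        (exists j0 : int, forall j, j0 <= j ->
           smem (M (j + 1)) = mulspan [set iota a | a in I] (smem (M j)))
      & forall j : int, finite_projective_quotient pi
          [set x : subm (M j) | lattice_denom I T j (subm_val x)]] in
  (in_essential_image I T <-> cond_ii) /\
  (cond_ii <-> zariski_locally (diagonal_over I T)).
Proof.
move=> M cond_ii.
have H : invertible_ideal iota I := invertible_idealP Linv vinj IE A1E.
have gdb_ii : gdb I (Esub T) (E'sub T) 1 -> cond_ii.
  move=> [K [e [x [xi [Mx xiS xiS' E]]]]].
  have xE y : y = \sum_k xi k y *: x k by rewrite -E rmorph1 scale1r.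
  split=> [j||j]; first exact: (lattice_fp H Mx xiS xiS' xE).
    split.
      have [m low] := lat_low H (dualizable_E I T) (dualizable_E' I T).
      exists (- m%:Z) => j jm; rewrite !(latticeP H); apply/seteqP.
      by split=> y [Sy _]; apply: low => //; lia.
    have [m high] := lat_high_step H (dualizable_E I T) (dualizable_E' I T).
    exists m => j jm; rewrite !(latticeP H); apply/seteqP.
    by split=> y; apply high.
  exact: (lattice_fp_quotient H Mx xiS xiS' xE pi_surj pi_ker).
have ii_adapted m : cond_ii -> is_prime m -> exists2 f, ~ m f & adapted I T f.
  move=> [_ _ Mfp] pm; have [Im|NIm] := pselect (I `<=` m).
    exact: (adapted_at H pm Im pi_surj pi_ker Mfp).
  exact: (adapted_away H T pm NIm).
have ii_gdb : cond_ii -> gdb I (Esub T) (E'sub T) 1.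
  move=> ii; apply: (prime_cover (gdb_ideal I _ _)) => m pm.
  by have [f Nf /adapted_gdb] := ii_adapted m ii pm; exists f.
split.
  split=> [|/ii_gdb]; last exact: gdb_essential_image.
  by move=> /(essential_image_gdb H).
split=> [ii|/(zariski_diagonal_gdb H)] //.
(* The adapted f generate the unit ideal, and finitely many of them give the open cover on which Phi
   is diagonal. *)
have gen1 : ideal_gen [set f | adapted I T f] 1.
  apply: (prime_cover (ideal_gen_ideal _)) => m pm.
  by have [f Nf af] := ii_adapted m ii pm; exists f => //; exact: ideal_gen_sub.
have [n [c [f [fP fE]]]] := ideal_gen_exists gen1.
exists n, f; split; first by rewrite fE; exact: ideal_gen_sum.
move=> k; exists (loc (f k)), (toloc (f k)); split; first exact: loc_complement.
exact: (adapted_diagonal H A1E (fP k)).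
Qed.
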